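(* Let $r\in\mathbb{N}$ and $M>0$, and consider the problem of uniform approximation of functions in $F_{r,M}^d$, $d\in\mathbb{N}$, with deterministic algorithms based on function values. (i) The problem suffers from the curse of dimensionality if and only if $M\in[2^r r!,\infty)$. (ii) If $M\in(r!,2^r r!)$, the problem is quasi-polynomially tractable but not polynomially tractable. (iii) If $M\in(0,r!]$, the problem is polynomially tractable but not strongly polynomially tractable.
   Context: For $r,d\in\mathbb{N}$ and $M>0$ let $$F_{r,M}^d=\Big\{\bigotimes_{i=1}^d f_i \;\Big|\; f_i:[0,1]\to[-1,1],\ f_i\in W_\infty^r([0,1]),\ \|f_i^{(r)}\|_\infty\le M\Big\},$$ where $\big(\bigotimes_{i=1}^d f_i\big)(x)=\prod_{i=1}^d f_i(x_i)$ for $x\in[0,1]^d$, $W_\infty^r([0,1])$ is the space of univariate functions having $r$ weak derivatives in $L_\infty([0,1])$ (identified with their continuous representatives), and $f_i^{(r)}$ is the $r$th weak derivative. $\|\cdot\|_\infty$ is the uniform norm. For $n\in\mathbb{N}$, a deterministic algorithm using at most $n$ function values is a map of the form $A_n(f)=\phi(f(x_1),\dots,f(x_n))$ with $\phi:\mathbb{R}^n\to L_\infty([0,1]^d)$, where the points $x_i\in[0,1]^d$ may be chosen adaptively, i.e. $x_i$ may depend on the already known values $f(x_1),\dots,f(x_{i-1})$. Its worst case error is $\mathrm{e}(A_n)=\sup_{f\in F_{r,M}^d}\|f-A_n(f)\|_\infty$. Put $e(n,d)=\inf_{A_n}\mathrm{e}(A_n)$, the infimum being over all such algorithms, and $n(\varepsilon,d)=\inf\{n\mid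 e(n,d)\le\varepsilon\}$. For fixed $r$ and $M$, the problem - is strongly polynomially tractable if there are $c,p>0$ with $n(\varepsilon,d)\le c\,\varepsilon^{-p}$ for all $\varepsilon\in(0,1)$, $d\in\mathbb{N}$; - is polynomially tractable if there are $c,q,p>0$ with $n(\varepsilon,d)\le c\,\varepsilon^{-p}d^q$ for all $\varepsilon\in(0,1)$, $d\in\mathbb{N}$; - is quasi-polynomially tractable if there are $c,t>0$ with $n(\varepsilon,d)\le c\exp\left(t(1+\ln(\varepsilon^{-1}))(1+\ln d)\right)$ for all $\varepsilon\in(0,1)$, $d\in\mathbb{N}$; - suffers from the curse of dimensionality if there are $\varepsilon>0$, $c>0$ and $\alpha>1$ with $n(\varepsilon,d)\ge c\,\alpha^d$ for all $d\in\mathbb{N}$. *)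

(* Defs.v *)
From HB Require Import structures.
From mathcomp Require Import all_boot all_order all_algebra.
From mathcomp Require Import all_classical all_reals all_analysis.

Set Implicit Arguments.
Unset Strict Implicit.
Unset Printing Implicit Defensive.
Import Order.TTheory GRing.Theory Num.Theory.
Import numFieldNormedType.Exports.
Local Open Scope classical_set_scope.
Local Open Scope ring_scope.

(* The d-fold product of a sigma-finite measure on the product sigma-algebra of
   d.-tuple T, built by recursion on d by transporting mu \x (power of order d)
   along (x, t) |-> x :: t. Sigma-finiteness is reproved here because the
   canonical instance found for _ \x _ expects subprobability measures. *)
Section TuplePower.
Context {disp : measure_display} {T : measurableType disp} {R : realType}.

Definition tcons d (p : T * d.-tuple T) : d.+1.-tuple T :=
  [the d.+1.-tuple T of p.1 :: p.2].

Lemma measurable_tcons d : measurable_fun setT (@tcons d).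
Proof. exact: measurable_cons. Qed.

Variables (mu : {sigma_finite_measure set T -> \bar R}).

Section step.
Variables (d : nat) (m : {sigma_finite_measure set (d.-tuple T) -> \bar R}).

Definition power_step : set (d.+1.-tuple T) -> \bar R :=
  pushforward (mu \x m)%E (@tcons d).

Let pm : {measure set (d.+1.-tuple T) -> \bar R} :=
  measure_function_pushforward__canonical__measure_function_Measure
    (mu \x m)%E (@measurable_tcons d).

HB.instance Definition _ := isMeasure.Build _ _ _ power_step
  (measure0 pm) (measure_ge0 pm) (@measure_semi_sigma_additive _ _ _ pm).

Lemma power_stepE (A : set T) (B : set (d.-tuple T)) :
  measurable A -> measurable B ->
  power_step [set t | A (thead t) /\ B [tuple of behead t]] = (mu A * m B)%E.
Proof.
move=> mA mB; rewrite -product_measure1E// /power_step /pushforward.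
congr (_ _); apply/seteqP; split => -[x t] /=.
  by rewrite (_ : [tuple of _] = t)//; exact: val_inj.
by rewrite (_ : [tuple of _] = t)//; exact: val_inj.
Qed.

Lemma sigma_finite_power_step : sigma_finite setT power_step.
Proof.
have /sigma_finiteP[F [TF ndF Foo]] := sigma_finiteT mu.
have /sigma_finiteP[G [TG ndG Goo]] := sigma_finiteT m.
exists (fun k => [set t | F k (thead t) /\ G k [tuple of behead t]]).
  apply/seteqP; split => // t _.
  have : setT (thead t) by []. rewrite TF => -[i _ Fi].
  have : setT [tuple of behead t] by []. rewrite TG => -[j _ Gj].
  exists (maxn i j) => //; split.
    by move: Fi; exact/subsetPset/ndF/leq_maxl.
  by move: Gj; exact/subsetPset/ndG/leq_maxr.
move=> k; have [mF Fk] := Foo k; have [mG Gk] := Goo k; split; last first.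
  by rewrite power_stepE// lte_mul_pinfty// ge0_fin_numE.
apply: measurableI.
  by rewrite -[X in measurable X]setTI; exact: (measurable_tnth ord0).
by rewrite -[X in measurable X]setTI; exact: measurable_behead.
Qed.

HB.instance Definition _ := Measure_isSigmaFinite.Build _ _ _ power_step
  sigma_finite_power_step.

End step.

Fixpoint power_measure d : {sigma_finite_measure set (d.-tuple T) -> \bar R} :=
  match d with
  | 0 => \d_([tuple] : 0.-tuple T)
  | d'.+1 => power_step (power_measure d')
  end.


Lemma power_measureE d (A : 'I_d -> set T) : (forall i, measurable (A i)) ->
  power_measure d [set t | forall i, A i (tnth t i)] =
  (\prod_(i < d) mu (A i))%E.
Proof.
elim: d A => [|d IH] A mA.
  rewrite big_ord0 /= (_ : [set _ | _] = setT) ?diracT//.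
  by apply/seteqP; split => // t _ [].
rewrite big_ord_recl -IH// -power_stepE//=; last first.
  rewrite (_ : [set _ | _] =
    \bigcap_(i in setT) ((@tnth d T ^~ i) @^-1` A (lift ord0 i))).
    apply: fin_bigcap_measurable => // i _.
    by rewrite -[X in measurable X]setTI; exact: measurable_tnth.
  by apply/seteqP; split => t /= At i; [move=> _|]; exact: At.
have tnth_behead (t : d.+1.-tuple T) j :
    tnth t (lift ord0 j) = tnth [tuple of behead t] j.
  by rewrite [in LHS](tuple_eta t) tnthS.
congr (_ _); apply/seteqP; split => t /=.
  by move=> At; split => [|i]; [exact: At|rewrite -tnth_behead; exact: At].
move=> [A0 AS] i; case: (unliftP ord0 i) => [j|] ->; last exact: A0.
by rewrite tnth_behead; exact: AS.
Qed.

End TuplePower.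

Section Linfty.
Context {disp : measure_display} {T : measurableType disp} {R : realType}.
Variables (mu : {measure set T -> \bar R}) (D : set T).

(* L_oo norm over D, i.e. the essential supremum of |f| on D. Extending f by 0
   outside D does not change it provided that mu D > 0. *)
Definition Linfty_norm (f : T -> R) : \bar R :=
  'N[mu]_+oo [EFin \o (f \_ D)].

Definition Linfty : set (T -> R) := [set f | f \_ D \in Lfun mu +oo%E].

End Linfty.

Section Problem.
Context {R : realType}.
Local Notation RT := (measurableTypeR R).
Local Notation leb := (@lebesgue_measure R).

Definition unit_itv : set R := `[0, 1].

Definition cube d : set (d.-tuple RT) :=
  [set x | forall i, unit_itv (tnth x i)].

Definition test_function (phi : R -> R) :=
  (forall k x, derivable (derive1n k phi) x 1) /\
  exists K : set R, [/\ compact K, K `<=` `]0, 1[ &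
    forall x, ~ K x -> phi x = 0].

(* g is a k-th weak derivative of f on ]0, 1[; the end points have measure 0. *)
Definition weak_derivative k (f g : R -> R) :=
  forall phi, test_function phi ->
    \int[leb]_(x in unit_itv) (f x * derive1n k phi x) =
    (-1) ^+ k * \int[leb]_(x in unit_itv) (g x * phi x).

(* W^r_oo([0, 1]) for r >= 1: functions are elements of R -> R of which only the
   values on [0, 1] matter, and continuity there selects the continuous
   representative of the class. *)
Definition sobolev r : set (R -> R) :=
  [set f | {within unit_itv, continuous f} /\
    forall k, (k <= r)%N ->
      exists2 g, Linfty leb unit_itv g & weak_derivative k f g].

(* The r-th weak derivative being unique almost everywhere, the bound on its
   norm does not depend on the g that is chosen. *)
Definition factor_class r (M : R) : set (R -> R) :=
  [set f | [/\ forall x, unit_itv x -> `[-1, 1]%classic (f x),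
    sobolev r f &
    exists g, [/\ Linfty leb unit_itv g, weak_derivative r f g &
      (Linfty_norm leb unit_itv g <= M%:E)%E]]].

Definition rank_one r (M : R) d : set (d.-tuple RT -> R) :=
  [set f | exists2 g : 'I_d -> R -> R, (forall i, factor_class r M (g i)) &
    forall x, cube x -> f x = \prod_(i < d) g i (tnth x i)].

(* An adaptive algorithm using n function values: the list of the values known so
   far, whose size is the index of the current step, determines the next point.
   The output is a representative of a class in L_oo([0, 1]^d). *)
Record algorithm d n := Algorithm {
  query : seq R -> d.-tuple RT;
  query_cube : forall y, cube (query y);
  output : n.-tuple R -> d.-tuple RT -> R;
  output_Linfty : forall y, Linfty (power_measure leb d) (@cube d) (output y)
}.

Fixpoint observe d (q : seq R -> d.-tuple RT) (f : d.-tuple RT -> R) k :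
    k.-tuple R :=
  match k with
  | 0 => [tuple]
  | k'.+1 => let y := observe q f k' in [tuple of rcons y (f (q y))]
  end.

Definition run d n (A : algorithm d n) (f : d.-tuple RT -> R) :
    d.-tuple RT -> R :=
  output A (observe (query A) f n).

Definition worst_case_error r M d n (A : algorithm d n) : \bar R :=
  ereal_sup [set Linfty_norm (power_measure leb d) (@cube d)
                   (fun x => f x - run A f x)
            | f in @rank_one r M d].

Definition minimal_error r M n d : \bar R :=
  ereal_inf [set worst_case_error r M A | A in [set: algorithm d n]].

(* As an infimum in \bar R, this is +oo when no n reaches the error eps. *)
Definition complexity r M (eps : R) d : \bar R :=
  ereal_inf [set n%:R%:E | n in
    [set n : nat | (0 < n)%N /\ (minimal_error r M n d <= eps%:E)%E]].

Definition strongly_polynomially_tractable r M :=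
  exists c p : R, [/\ 0 < c, 0 < p &
    forall eps d, 0 < eps < 1 -> (0 < d)%N ->
      (complexity r M eps d <= (c * eps `^ (- p))%:E)%E].

Definition polynomially_tractable r M :=
  exists c q p : R, [/\ 0 < c, 0 < q, 0 < p &
    forall eps d, 0 < eps < 1 -> (0 < d)%N ->
      (complexity r M eps d <= (c * eps `^ (- p) * d%:R `^ q)%:E)%E].

Definition quasi_polynomially_tractable r M :=
  exists c t : R, [/\ 0 < c, 0 < t &
    forall eps d, 0 < eps < 1 -> (0 < d)%N ->
      (complexity r M eps d <=
        (c * expR (t * (1 + ln (eps^-1)) * (1 + ln d%:R)))%:E)%E].

Definition curse_of_dimensionality r M :=
  exists eps c alpha : R, [/\ 0 < eps, 0 < c, 1 < alpha &
    forall d, (0 < d)%N -> ((c * alpha ^+ d)%:E <= complexity r M eps d)%E].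

End Problem.

(* Main.v *)
(* Mollification and Rolle's theorem bound the divided differences of order r of a factor
   by M / r!. Hence the factors have a common Lipschitz constant, and a factor with r zeros
   at distance at most a from x satisfies |f x| <= M a^r / r!.

   Upper bounds: once a point z with f z <> 0 is known, f is determined by its values on
   the axis-parallel lines through z, which are sampled on a grid. A random z succeeds with
   probability equal to the product of the fractions of sampling points where the factors
   do not vanish, and a union bound over all families of zero sets turns this into a fixed
   finite set of points. If M <= r!, a uniform grid gives a factor of absolute value u a
   fraction of about u, so that the product is at least eps / 4 when |f x| > eps / 2. If
   M < 2^r r!, most sampling points are put near 1/2, at distance less than 1/2 + eta from
   every point; a factor with u > beta, for some beta < 1, then has almost no zeros, while
   a factor with u <= beta has a fraction of at least u / (8 K d) >= u^(1 + tau), where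
   tau = O(ln d). The product is thus at least (eps / 2)^(1 + tau) / 2.

   Lower bounds: products of the truncated powers (x - delta)_+^r and (delta - x)_+^r have
   disjoint supports, and one query excludes at most one of them up to sign. For
   M >= 2^r r! and delta = 1/2 this gives 2^d functions of norm 1; for M > r! and small
   delta, choosing the second power in exactly k coordinates gives 'C(d, k) functions whose
   norm does not depend on d. For every M > 0, the constant 1 cannot be told apart in n
   queries from a product of factors with one dip each, placed in a cell that contains no
   query, and this product tends to 0 at its minimum as d grows. *)

Require Import Defs.
From mathcomp Require Import all_boot all_order all_algebra.
From mathcomp Require Import all_classical all_reals all_analysis.
From mathcomp Require Import measurable_realfun ess_sup_inf zify ring lra.
Import Order.TTheory GRing.Theory Num.Theory.
Import numFieldNormedType.Exports.
Set Implicit Arguments.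
Unset Strict Implicit.
Unset Printing Implicit Defensive.
Local Open Scope ring_scope.

(** * Hitting sets *)

Section HittingSet.
Context {R : realType}.

(* Averaging: some point of X meets at least a fraction p of the family, so n greedy
   choices leave fewer than one member unhit. *)
Lemma greedy_hitting (X : finType) (fam : {set {set X}}) (p : R) (n : nat) :
  0 <= p <= 1 -> (forall A, A \in fam -> p * #|X|%:R <= #|A|%:R) ->
  #|fam|%:R * (1 - p) ^+ n < 1 -> (0 < #|X|)%N ->
  exists2 s : seq X, size s = n & forall A, A \in fam -> exists2 x, x \in s & x \in A.
Proof.
move=> /andP[p0 p1] + + X0; have [x0 _] : exists x0 : X, x0 \in X by apply/card_gt0P.
elim: n fam => [|n IH] fam famp.
  rewrite expr0 mulr1 -[X in _ < X]/(1%:R) ltr_nat ltnS leqn0 cards_eq0 => /eqP ->.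
  by exists [::] => // A; rewrite inE.
move=> famn.
have [x xP] : exists x : X, #|[set A in fam | x \notin A]|%:R <= (1 - p) * #|fam|%:R.
  apply: contrapT => /forallNP H.
  have : \sum_(x : X) ((1 - p) * #|fam|%:R) < \sum_(x : X) #|[set A in fam | x \notin A]|%:R :> R.
    apply: ltr_sum => [|x _]; last by rewrite ltNge; apply/negP; exact: H.
    by apply/hasP; exists x0; rewrite ?mem_index_enum.
  rewrite sumr_const -natr_sum.
  (* Double counting of the pairs (x, A) with x outside A. *)
  have -> : (\sum_(x : X) #|[set A in fam | x \notin A]| = \sum_(A in fam) #|~: A|)%N.
    rewrite (eq_bigr (fun x => \sum_(A in fam) (x \notin A : nat))%N) => [|x _]; last first.
      by rewrite -sum1dep_card big_mkcondr.
    rewrite exchange_big /=; apply: eq_bigr => A _.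
    rewrite -sum1_card [RHS]big_mkcond /=; apply: eq_bigr => x _.
    by rewrite inE; case: (x \in A).
  rewrite natr_sum.
  have : \sum_(A in fam) #|~: A|%:R <= \sum_(A in fam) ((1 - p) * #|X|%:R) :> R.
    apply: ler_sum => A Af; rewrite cardsCs finset.setCK natrB ?max_card // mulrBl mul1r.
    by rewrite lerD2l lerN2 famp.
  rewrite sumr_const => le1 lt1; have := lt_le_trans lt1 le1.
  by rewrite -[ltLHS]mulr_natr -[ltRHS]mulr_natr mulrAC ltxx.
have [||s ss sP] := IH [set A in fam | x \notin A].
- by move=> A; rewrite inE => /andP[/famp].
- apply: le_lt_trans famn; rewrite exprS mulrA (mulrC _ (1 - p)).
  by rewrite ler_wpM2r // exprn_ge0 // subr_ge0.
exists (x :: s) => /=; first by rewrite ss.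
move=> A Af; have [xA|xA] := boolP (x \in A); first by exists x; rewrite ?mem_head.
have [|y ys yA] := sP A; first by rewrite inE Af.
by exists y => //; rewrite inE ys orbT.
Qed.

(* The union bound runs over all 2 ^ (#|S| d) product sets. *)
Lemma product_hitting (S : finType) (d n : nat) (p : R) : 0 < p <= 1 ->
  (0 < #|S|)%N -> (0 < d)%N -> (#|S| * d)%:R <= n%:R * p ->
  exists2 s : seq {ffun 'I_d -> S}, size s = n &
    forall B : 'I_d -> {set S}, p <= \prod_i (#|B i|%:R / #|S|%:R) ->
      exists2 x : {ffun 'I_d -> S}, x \in s & forall i, x i \in B i.
Proof.
move=> /andP[p0 p1] S0 d0 np.
pose box (B : {ffun 'I_d -> {set S}}) : {set {ffun 'I_d -> S}} := [set x : {ffun 'I_d -> S} | [forall i, x i \in B i]].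
have cbox (B : {ffun 'I_d -> {set S}}) : #|box B| = (\prod_i #|B i|)%N.
  transitivity #|family (fun i => mem (B i))|; last by rewrite card_family foldrE big_image.
  by rewrite /box cardsE; apply: eq_card => x; rewrite [LHS]unfold_in; apply/forallP/familyP.
pose fam := [set box B | B in [set B : {ffun 'I_d -> {set S}} | p <= \prod_i (#|B i|%:R / #|S|%:R)]].
have S0' : (#|S|%:R : R) != 0 by rewrite pnatr_eq0 -lt0n.
have X0 : (0 < #|{ffun 'I_d -> S}|)%N by rewrite card_ffun expn_gt0 S0.
have [||||s ss sP] := @greedy_hitting _ fam p n; last 2 first.
- exact: X0.
- exists s => // B pB; have [|x xs] := sP (box (finfun B)).
    apply/imsetP; exists (finfun B) => //; rewrite inE (le_trans pB) //.
    by rewrite le_eqVlt; apply/orP; left; apply/eqP; apply: eq_bigr => i _; rewrite ffunE.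
  rewrite inE => /forallP xB; exists x => // i.
  by have := xB i; rewrite ffunE.
- by rewrite ltW.
- move=> A /imsetP[B]; rewrite inE => pB ->.
  rewrite cbox card_ffun card_ord natr_prod natrX.
  rewrite -ler_pdivlMr ?exprn_gt0 ?ltr0n // (le_trans pB) //.
  by rewrite big_split /= prodr_const card_ord exprVn.
- have famn : (#|fam| <= 2 ^ (#|S| * d))%N.
    rewrite (leq_trans (leq_imset_card _ _)) // (leq_trans (max_card _)) //.
    by rewrite card_ffun card_ord -cardsT -powersetT card_powerset cardsT expnM.
  (* (1 - p)^n <= exp(- n p) <= exp(- #|S| d), which beats the 2^(#|S| d) members of the family
     because 2 < e. *)
  have e1 : (1 - p) ^+ n <= expR (- (#|S| * d)%:R).
    have : (1 - p) ^+ n <= expR (- p) ^+ n.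
      by apply: lerXn2r; rewrite ?nnegrE ?subr_ge0 ?expR_ge0 // expR_ge1Dx.
    by move=> /le_trans; apply; rewrite -expRM_natl ler_expR mulrN lerN2.
  have : #|fam|%:R * (1 - p) ^+ n <= (2 ^ (#|S| * d))%:R * expR (- (#|S| * d)%:R).
    by apply: ler_pM => //; rewrite ?ler_nat // exprn_ge0 // subr_ge0.
  move=> /le_lt_trans; apply.
  rewrite expRN ltr_pdivrMr ?expR_gt0 // mul1r natrX.
  rewrite -[X in expR X]mulr1 expRM_natl ltrXn2r ?nnegrE ?expR_ge0 ?muln_eq0 ?negb_or -?lt0n ?S0 //.
  by have := @expR_gt1Dx R 1 (oner_neq0 _); rewrite -[X in X < _]/(2%:R).
Qed.

End HittingSet.

Local Open Scope classical_set_scope.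
Local Open Scope ring_scope.

(** * Smooth functions and mollification *)

Section Smooth.
Context {R : realType}.
Implicit Types (f g : R -> R) (p : {poly R}).

(** The recursion strips the innermost derivative, whereas [derive1n] adds the outermost one.
    Closure under sums, products and affine substitutions is then an induction on k that generalises
    over the functions. *)
Fixpoint nderivable k f : Prop :=
  if k is k'.+1 then (forall x, derivable f x 1) /\ nderivable k' (derive1 f)
  else True.

Lemma nderivableW k f : nderivable k.+1 f -> nderivable k f.
Proof.
by elim: k f => [//|k IH] f [df dk]; split => //; exact: IH.
Qed.

Lemma smoothP f :
  (forall k x, derivable (derive1n k f) x 1) <-> forall k, nderivable k f.
Proof.
split => [sf k|sf k].
  elim: k f sf => [//|k IH] f sf; split; first exact: (sf 0%N).
  by apply: IH => j x; rewrite -derive1Sn.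
elim: k f sf => [|k IH] f sf x; first by have [] := sf 1%N.
by rewrite derive1Sn; apply: IH => j; have [] := sf j.+1.
Qed.

Lemma derivable_continuous f : (forall x, derivable f x 1) -> continuous f.
Proof.
by move=> df x; apply: differentiable_continuous; apply/derivable1_diffP.
Qed.

Lemma nderivable_cst k (c : R) : nderivable k (fun=> c).
Proof.
elim: k c => [//|k IH] c; split => [x|]; first exact: derivable_cst.
rewrite (_ : derive1 _ = fun=> 0); first exact: IH.
by apply/funext => x; rewrite derive1_cst.
Qed.

Lemma nderivableD k f g :
  nderivable k f -> nderivable k g -> nderivable k (fun x => f x + g x).
Proof.
elim: k f g => [//|k IH] f g [df dfk] [dg dgk]; split => [x|].
  exact: derivableD.
rewrite (_ : derive1 _ = fun x => f^`()%classic x + g^`()%classic x); first exact: IH.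
by apply/funext => x; rewrite !derive1E deriveD.
Qed.

Lemma nderivableM k f g :
  nderivable k f -> nderivable k g -> nderivable k (fun x => f x * g x).
Proof.
elim: k f g => [//|k IH] f g nf ng; have [df dfk] := nf; have [dg dgk] := ng.
split => [x|]; first exact: derivableM.
rewrite (_ : derive1 _ = fun x => f x * g^`()%classic x + g x * f^`()%classic x).
  by apply: nderivableD; apply: IH => //; exact: nderivableW.
by apply/funext => x; rewrite !derive1E deriveM.
Qed.

Lemma is_derive_affine (a b x : R) : is_derive x (1 : R) (fun x => a * x + b) a.
Proof.
rewrite (_ : (fun _ => _) = horner (a%:P * 'X + b%:P)); last first.
  by apply/funext => y; rewrite !hornerE.
by apply: is_derive_eq; rewrite derivD derivM derivX !derivC !hornerE.
Qed.

Lemma is_derive_comp_affine f (a b x : R) : derivable f (a * x + b) 1 ->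
  is_derive x (1 : R) (fun x => f (a * x + b)) (derive1 f (a * x + b) * a).
Proof.
move=> df; apply: (@is_derive1_comp _ f); last exact: is_derive_affine.
by rewrite derive1E; exact: derivableP.
Qed.

Lemma nderivable_affine k f (a b : R) :
  nderivable k f -> nderivable k (fun x => f (a * x + b)).
Proof.
elim: k f => [//|k IH] f [df dfk].
have dh x := is_derive_comp_affine (df (a * x + b)).
split => [x|]; first exact: (@ex_derive _ _ _ _ _ _ _ (dh x)).
rewrite (_ : derive1 _ = fun x => f^`()%classic (a * x + b) * a).
  by apply: nderivableM; [exact: IH|exact: nderivable_cst].
by apply/funext => x; rewrite derive1E (@derive_val _ _ _ _ _ _ _ (dh x)).
Qed.

Lemma nderivable_horner k p : nderivable k (horner p).
Proof.
elim: k p => [//|k IH] p; split; first exact: derivable_horner.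
by rewrite -derivE.
Qed.

Lemma derive1n_horner k p : derive1n k (horner p) = horner p^`(k).
Proof. by elim: k => [//|k IH]; rewrite derive1nS IH derivnS derivE. Qed.

Lemma derive1nB k f g : nderivable k f -> nderivable k g ->
  derive1n k (fun x => f x - g x) = fun x => derive1n k f x - derive1n k g x.
Proof.
elim: k f g => [//|k IH] f g [df dfk] [dg dgk]; rewrite !derive1Sn -IH //.
by congr (derive1n k _); apply/funext => x; rewrite !derive1E deriveB.
Qed.

Lemma derive1n_affine k f (a b : R) : nderivable k f ->
  derive1n k (fun x => f (a * x + b)) = fun x => a ^+ k * derive1n k f (a * x + b).
Proof.
move=> nf; elim: k => [|k IH] in nf *.
  by apply/funext => x; rewrite expr0 mul1r.
have nk : forall x, derivable (derive1n k f) x 1.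
  elim: k f nf {IH} => [|j IHj] f [df dfk] x //; rewrite derive1Sn; exact: IHj.
rewrite derive1nS IH; last exact: nderivableW.
have dh x := is_derive_comp_affine (nk (a * x + b)).
apply/funext => x; rewrite derive1Ml; last exact: (@ex_derive _ _ _ _ _ _ _ (dh x)).
rewrite derive1E (@derive_val _ _ _ _ _ _ _ (dh x)).
by rewrite -derive1nS exprSr mulrAC mulrA.
Qed.

(* The family of these functions is closed under differentiation, see [is_derive_flat]. *)
Definition flat p (x : R) : R := if 0 < x then p.[x^-1] * expR (- x^-1) else 0.

(** With y = 1 / x and s = [size p], a single term of the exponential series gives exp y >= y^(s +
    2) / (s + 2)!, while |p(y)| <= c y^s. The quotient leaves y^-2 = x^2. *)
Lemma flat_small p : exists C : R, 0 <= C /\ forall x, `|x| <= 1 ->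
  `|flat p x| <= C * x ^+ 2.
Proof.
pose n := (size p).+1.
pose c := \sum_(i < size p) `|p`_i|.
have c0 : 0 <= c by apply: sumr_ge0.
exists (c * n.+1`!%:R); split => [|x x1]; first by rewrite mulr_ge0.
rewrite /flat; case: ifPn => [x0|_]; last by rewrite normr0 mulr_ge0 ?sqr_ge0 // mulr_ge0.
have x1' : x <= 1 by rewrite (le_trans _ x1) // ler_norm.
set y := x^-1; have y1 : 1 <= y by rewrite invr_ge1 ?unitf_gt0.
have y0 : 0 < y by rewrite invr_gt0.
have pc : `|p.[y]| <= c * y ^+ size p.
  rewrite horner_coef (le_trans (ler_norm_sum _ _ _)) // mulr_suml ler_sum // => i _.
  rewrite normrM ler_wpM2l // normrX gtr0_norm // ler_weXn2l //.
  by rewrite ltnW.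
have ey : y ^+ n.+1 / n.+1`!%:R <= expR y.
  by rewrite (le_trans _ (expR_ge1Dxn n (ltW y0))) // lerDr.
rewrite normrM (gtr0_norm (expR_gt0 _)) expRN.
have eyp : (expR y)^-1 <= n.+1`!%:R / y ^+ n.+1.
  rewrite -[leRHS]invrK lef_pV2 ?posrE ?expR_gt0 //; last first.
    by rewrite invr_gt0 divr_gt0 ?exprn_gt0 ?ltr0n ?fact_gt0.
  by rewrite invf_div.
rewrite (le_trans (ler_pM _ _ pc eyp)) ?invr_ge0 ?expR_ge0 //.
have yx : x = y^-1 by rewrite /y invrK.
rewrite yx /n -addn2 exprD le_eqVlt; apply/orP; left; apply/eqP.
by field; rewrite expf_neq0 ?gt_eqF.
Qed.

Lemma is_derive_quadratic f (C : R) : f 0 = 0 ->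
  (forall x, `|x| <= 1 -> `|f x| <= C * x ^+ 2) -> is_derive (0 : R) 1 f 0.
Proof.
move=> f0 fC.
have cv : h^-1 *: (f (h *: 1 + 0) - f 0) @[h --> 0^'] --> (0 : R).
  apply/cvgr0Pnorm_le => /= e e0.
  near=> h.
  have h0 : h != 0 by near: h; exact: nbhs_dnbhs_neq.
  have h1 : `|h| <= 1.
    near: h; apply: dnbhs0_le; exact: ltr01.
  have he : `|h| <= e / (`|C| + 1).
    by near: h; apply: dnbhs0_le; rewrite divr_gt0 // ltr_wpDl.
  rewrite f0 subr0 addr0 /GRing.scale /= mulr1 normrM normfV.
  rewrite ler_pdivrMl ?normr_gt0 // (le_trans (fC _ h1)) //.
  rewrite -[h ^+ 2]real_normK ?num_real // expr2 mulrCA ler_wpM2l //.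
  rewrite (@le_trans _ _ ((`|C| + 1) * `|h|)) //.
    by rewrite ler_wpM2r // (le_trans (ler_norm _)) // lerDl.
  by rewrite mulrC -ler_pdivlMr // ltr_wpDl.
apply: DeriveDef; first by apply/cvg_ex; exists 0.
by rewrite /derive; apply/cvg_lim.
Unshelve. all: end_near. Qed.

(** For x > 0 the chain rule produces the factor x^-2 (p - p')(1 / x). At 0, where the two formulas
    meet, the quadratic bound of [flat_small] makes the derivative vanish. *)
Lemma is_derive_flat p (x : R) :
  is_derive x (1 : R) (flat p) (flat ('X^2 * (p - p^`())) x).
Proof.
have [x0|x0|->] := ltgtP x 0.
- rewrite {2}/flat ltNge ltW //=.
  have := is_derive_cst (0 : R) x (1 : R); apply: near_eq_is_derive.
  near=> y; rewrite /flat ifF //; apply/negbTE; rewrite -leNgt ltW //.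
  by near: y; exact: lt_nbhsl.
- have dV : is_derive x (1 : R) (fun x : R => x^-1) (- x ^- 2).
    apply: is_derive_eq; first by apply: is_deriveV; rewrite gt_eqF.
    by rewrite /GRing.scale /= mulr1.
  have dp : is_derive x (1 : R) (horner p \o (fun x : R => x^-1))
      (p^`().[x^-1] * - x ^- 2).
    exact: is_derive1_comp.
  have de : is_derive x (1 : R) (expR \o (fun x : R => - x^-1))
      (expR (- x^-1) * - - x ^- 2).
    exact: is_derive1_comp.
  have := is_deriveM dp de; set v := (X in is_derive _ _ _ X) => dv.
  have -> : flat ('X^2 * (p - p^`())) x = v.
    transitivity (p.[x^-1] * (expR (- x^-1) * - - x ^- 2) +
      expR (- x^-1) * (p^`().[x^-1] * - x ^- 2)); last by [].
    rewrite /flat x0 hornerM hornerD hornerN hornerXn exprVn.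
    by set a := p.[_]; set b := p^`().[_]; set c := expR _; set d := x ^- 2; ring.
  move: dv; apply: near_eq_is_derive.
  near=> y; rewrite /flat ifT //.
  by near: y; exact: lt_nbhsr.
- rewrite {2}/flat ltxx.
  have [C [_ fC]] := flat_small p.
  by apply: (@is_derive_quadratic _ C) => //; rewrite /flat ltxx.
Unshelve. all: end_near. Qed.

Lemma nderivable_flat k p : nderivable k (flat p).
Proof.
elim: k p => [//|k IH] p; split => [x|].
  exact: (@ex_derive _ _ _ _ _ _ _ (is_derive_flat p x)).
rewrite (_ : derive1 _ = flat ('X^2 * (p - p^`()))); first exact: IH.
by apply/funext => x; rewrite derive1E (@derive_val _ _ _ _ _ _ _ (is_derive_flat p x)).
Qed.

(* Supported in [-h, h] and not normalised: its mass is computed by [mass] below. *)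
Definition mollifier (h x : R) : R := flat 1 (1 * x + h) * flat 1 (-1 * x + h).

Lemma nderivable_mollifier k h : nderivable k (mollifier h).
Proof.
by apply: nderivableM; apply: nderivable_affine; exact: nderivable_flat.
Qed.

Lemma flat1_ge0 x : 0 <= flat 1 x.
Proof. by rewrite /flat; case: ifP => // _; rewrite hornerE mul1r expR_ge0. Qed.

Lemma flat1_gt0 x : 0 < x -> 0 < flat 1 x.
Proof. by rewrite /flat => ->; rewrite hornerE mul1r expR_gt0. Qed.

Lemma mollifier_ge0 h x : 0 <= mollifier h x.
Proof. by rewrite mulr_ge0 // flat1_ge0. Qed.

Lemma mollifier_eq0 h x : h <= `|x| -> mollifier h x = 0.
Proof.
rewrite /mollifier /flat ler_normr => /orP[] hx.
  by rewrite [X in _ * X]ifF ?mulr0 //; apply/negbTE; rewrite -leNgt; lra.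
by rewrite ifF ?mul0r //; apply/negbTE; rewrite -leNgt; lra.
Qed.

End Smooth.

(** * Divided differences and their mean value form *)

Section DividedDifference.
Context {R : realType}.
Implicit Types (f h : R -> R) (p : {poly R}).

(** Rolle's theorem in each gap. The zeros of the derivative again form a sorted list strictly
    between the extreme zeros of h, so that the step can be iterated. *)
Lemma rolle_path h (x : R) (s : seq R) : (forall z, derivable h z 1) ->
  path <%R x s -> all (fun z => h z == 0) (x :: s) ->
  exists t, [/\ size t = size s, path <%R x t,
    all (fun z => z < last x s) t & all (fun z => derive1 h z == 0) t].
Proof.
move=> dh; elim: s x => [|y s IH] x /=; first by exists [::].
move=> /andP[xy ys] /and3P[hx hy hs].
have [|t [st yt ts t0]] := IH y ys; first by rewrite /= hy.
have [||c cxy dc] := Rolle xy (fun z _ => dh z).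
- exact/continuous_subspaceT/derivable_continuous.
- by rewrite (eqP hx) (eqP hy).
have [xc cy] : x < c /\ c < y by move: cxy; rewrite in_itv /= => /andP[].
exists (c :: t); split => /=; first by rewrite st.
- rewrite xc /=; case: t yt {st ts t0} => //= z t /andP[yz ->].
  by rewrite (lt_trans cy).
- rewrite ts andbT (lt_le_trans cy) //.
  by case: s ys {IH hs st ts} => //= z s /andP[yz /(order_path_min lt_trans)/allP zs];
    case: (lastP s) zs => [|s' w] zs; rewrite ?last_rcons ltW // (lt_trans yz) // zs // mem_rcons mem_head.
- by rewrite t0 andbT derive1E (@derive_val _ _ _ _ _ _ _ dc).
Qed.

(** Each use of [rolle_path] trades one zero for one derivative; n + 1 zeros leave one zero of the
    n-th derivative. *)
Lemma rolle_nderivable n h (x : R) (s : seq R) : nderivable n h ->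
  size s = n -> path <%R x s -> all (fun z => h z == 0) (x :: s) ->
  exists xi, [/\ x <= xi, xi <= last x s & derive1n n h xi = 0].
Proof.
elim: n h x s => [|n IH] h x s.
  by case: s => //= _ _ _ /andP[/eqP hx _]; exists x.
move=> [dh dhn] sn xs hs; have [t [st xt ts t0]] := rolle_path dh xs hs.
case: t st xt ts t0 => [|y t]; first by rewrite sn.
rewrite sn => -[st] /andP[xy yt] ts t0.
have [xi [yxi xit xi0]] := IH _ y t dhn st yt t0.
exists xi; rewrite derive1Sn; split => //; first by rewrite (le_trans (ltW xy)).
by rewrite (le_trans xit) // ltW // (allP ts) // mem_last.
Qed.

(** The barycentric weight of a node in Lagrange interpolation. *)
Definition node_weight n (x : 'I_n.+1 -> R) (j : 'I_n.+1) : R :=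
  (\prod_(i < n.+1 | i != j) (x j - x i))^-1.

Definition divided_difference n (x : 'I_n.+1 -> R) f : R :=
  \sum_(j < n.+1) f (x j) * node_weight x j.

Lemma derivn_monic n p : p \is monic -> size p = n.+1 ->
  p^`(n) = (n`!%:R)%:P.
Proof.
move=> mp sp; apply/polyP => i; rewrite coef_derivn coefC.
have lp : p`_n = 1 by move/monicP: mp; rewrite lead_coefE sp.
case: i => [|i]; first by rewrite addn0 lp ffactnn.
by rewrite nth_default ?mul0rn // sp addnS ltnS leq_addr.
Qed.

(** The function minus its Lagrange interpolant vanishes at the n + 1 nodes, so its n-th derivative
    has a zero xi in their range. The n-th derivative of the interpolant is the constant n! times
    its leading coefficient, the divided difference. *)
Lemma divided_difference_mean n (x : 'I_n.+1 -> R) (a b : R) f :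
  nderivable n f -> injective x -> (forall j, a <= x j <= b) ->
  exists2 xi, a <= xi <= b & n`!%:R * divided_difference x f = derive1n n f xi.
Proof.
move=> df xI xab.
pose q j : {poly R} := \prod_(i < n.+1 | i != j) ('X - (x i)%:P).
have qm j : q j \is monic by exact: monic_prod_XsubC.
have qs j : size (q j) = n.+1.
  by rewrite /q -big_enum size_prod_XsubC -cardE cardC1 card_ord.
(* The Lagrange interpolant; [q j] is the unnormalised basis polynomial, monic of degree n. *)
pose p : {poly R} := \sum_(j < n.+1) (f (x j) * node_weight x j) *: q j.
have px j : p.[x j] = f (x j).
  rewrite /p horner_sum (bigD1 j) //= big1 => [|i ij]; last first.
    rewrite hornerZ /q horner_prod (bigD1 j) 1?eq_sym //= hornerXsubC subrr.
    by rewrite mul0r mulr0.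
  rewrite addr0 hornerZ /q horner_prod -mulrA.
  rewrite (eq_bigr (fun i => x j - x i)) => [|i _]; last by rewrite hornerXsubC.
  rewrite mulVf ?mulr1 //.
  by apply/prodf_neq0 => i ij; rewrite subr_eq0 inj_eq // eq_sym.
have pn : p^`(n) = (n`!%:R * divided_difference x f)%:P.
  rewrite /p (big_morph (derivn n) (derivnD n) (raddf0 (derivn n))) /divided_difference mulr_sumr rmorph_sum /=.
  apply: eq_bigr => j _; rewrite derivnZ derivn_monic // -mul_polyC -polyCM.
  by rewrite mulrC.
pose s := sort <=%R (codom x).
have su : uniq s by rewrite sort_uniq; exact/injectiveP.
have ss : size s = n.+1 by rewrite size_sort size_codom card_ord.
have smem z : (z \in s) -> exists j, z = x j.
  by rewrite mem_sort => /codomP.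
have slt : sorted <%R s.
  by rewrite lt_sorted_uniq_le su; apply: sort_sorted; exact: le_total.
case: s su ss smem slt => [//|y s] su [ss] smem slt.
have hd : nderivable n (fun z => f z - p.[z]).
  rewrite (_ : (fun z => _) = fun z => f z + horner (- p) z); last first.
    by apply/funext => z; rewrite hornerN.
  by apply: nderivableD => //; exact: nderivable_horner.
have [|xi [yxi xiy]] := rolle_nderivable hd ss slt.
  by apply/allP => z /smem[j ->]; rewrite px subrr.
rewrite derive1nB //; last exact: nderivable_horner.
move=> /eqP; rewrite subr_eq0 derive1n_horner pn hornerC => /eqP fxi.
exists xi; last by rewrite fxi.
have [j yj] := smem y (mem_head _ _).
have [k yk] := smem _ (mem_last y s).
have /andP[aj _] := xab j; have /andP[_ kb] := xab k.
by rewrite (le_trans _ yxi) ?yj // (le_trans xiy) // yk.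
Qed.

End DividedDifference.

(** * Convolution over [0, 1] with a smooth kernel *)

Section Convolution.
Context {R : realType}.
Local Notation RT := (measurableTypeR R).
Local Notation leb := (@lebesgue_measure R).
Implicit Types (f g phi u : R -> R).

Lemma measurable_unit_itv : measurable (unit_itv : set RT).
Proof. exact: measurable_itv. Qed.
Hint Resolve measurable_unit_itv : core.

Lemma leb_unit_itv : leb unit_itv = 1%:E.
Proof. by rewrite lebesgue_measure_itv /= lte_fin ltr01 oppr0 adde0. Qed.

Lemma integrable_unit u (C : R) : measurable_fun (unit_itv : set RT) u ->
  (forall x, unit_itv x -> `|u x| <= C) -> leb.-integrable unit_itv (EFin \o u).
Proof.
move=> mu uC; apply: measurable_bounded_integrable => //.
  by rewrite [X in (X < _)%E]leb_unit_itv ltry.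
exists C; split => [|D CD x ux]; first exact: num_real.
by rewrite /= (le_trans (uC x ux)) // ltW.
Qed.

Lemma continuous_measurable (D : set RT) f : continuous f -> measurable D ->
  measurable_fun D f.
Proof.
move=> cf mD; apply: (measurable_funS measurableT) => //.
exact: continuous_measurable_fun.
Qed.

(** Only the values of f on [0, 1] are meaningful, so the integral is restricted to this interval.
    The price is that the mass of the kernel depends on x near the end points. *)
Definition convol f phi (x : R) : R := \int[leb]_(y in unit_itv) (f y * phi (x - y)).

Lemma shift_continuous phi (x : R) : continuous phi -> continuous (fun y => phi (x - y)).
Proof.
move=> cphi y; apply: (@continuous_comp _ _ _ (fun y => x - y) phi); last exact: cphi.
by apply: continuousB; [exact: cst_continuous|exact: cvg_id].
Qed.

Lemma convol_measurable f phi (x : R) : measurable_fun (unit_itv : set RT) f ->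
  continuous phi -> measurable_fun (unit_itv : set RT) (fun y => f y * phi (x - y)).
Proof.
move=> mf cphi; apply: measurable_funM => //.
by apply: continuous_measurable => //; exact: shift_continuous.
Qed.

Lemma convol_integrable f phi (x C : R) : measurable_fun (unit_itv : set RT) f ->
  (forall y, unit_itv y -> `|f y| <= 1) ->
  continuous phi -> (forall y, `|phi y| <= C) ->
  leb.-integrable unit_itv (EFin \o (fun y => f y * phi (x - y))).
Proof.
move=> mf f1 cphi phiC; apply: (@integrable_unit _ C); first exact: convol_measurable.
by move=> y uy; rewrite normrM -[C]mul1r ler_pM // f1.
Qed.

Lemma is_derive_reflect phi (x y : R) : derivable phi (x - y) 1 ->
  is_derive x (1 : R) (fun x => phi (x - y)) (derive1 phi (x - y)).
Proof.
move=> dphi; have := @is_derive_comp_affine R phi 1 (- y) x.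
rewrite mul1r mulr1 => /(_ dphi).
by rewrite (_ : (fun _ => _) = (fun x => phi (x - y))) //; apply/funext => z; rewrite mul1r.
Qed.

(** Differentiation under the integral sign, dominated by the constant C1. All regularity comes from
    the kernel. *)
Lemma convol_derive f phi (C0 C1 : R) (x : R) :
  measurable_fun (unit_itv : set RT) f ->
  (forall y, unit_itv y -> `|f y| <= 1) ->
  (forall y, derivable phi y 1) ->
  (forall y, `|phi y| <= C0) -> (forall y, `|derive1 phi y| <= C1) ->
  derivable (convol f phi) x 1 /\ derive1 (convol f phi) x = convol f (derive1 phi) x.
Proof.
move=> mf f1 dphi phi0 phi1.
have cphi := derivable_continuous dphi.
have dfx (a y : R) : is_derive a (1 : R) (fun x => f y * phi (x - y)) (f y * derive1 phi (a - y)).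
  have := @is_deriveZ _ _ _ _ (f y) a 1 _ (is_derive_reflect (dphi (a - y))).
  by [].
have d1 (a y : R) : partial1of2 (fun x y => f y * phi (x - y)) a y = f y * derive1 phi (a - y).
  by rewrite partial1of2E (@derive_val _ _ _ _ _ _ _ (dfx a y)).
have Ia : `]x - 1, x + 1[%classic x by rewrite /= in_itv /=; lra.
have intf (a : R) : `]x - 1, x + 1[%classic a ->
    leb.-integrable unit_itv (EFin \o (fun y => f y * phi (a - y))).
  by move=> _; exact: convol_integrable phi0.
have derf (a y : R) : `]x - 1, x + 1[%classic a -> unit_itv y ->
    derivable (fun x => f y * phi (x - y)) a 1.
  by move=> _ _; exact: (@ex_derive _ _ _ _ _ _ _ (dfx a y)).
have C10 : 0 <= C1 by exact: le_trans (phi1 0).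
have intG : leb.-integrable unit_itv (EFin \o (fun _ : RT => C1)).
  by apply: (@integrable_unit _ C1) => [|y _]; [exact: measurable_cst|rewrite ger0_norm].
have Gub (a y : R) : `]x - 1, x + 1[%classic a -> unit_itv y ->
    `|partial1of2 (fun x y => f y * phi (x - y)) a y| <= C1.
  by move=> _ uy; rewrite d1 normrM -[C1]mul1r ler_pM // f1.
split.
  exact: (@derivable_under_integral R _ RT leb _ unit_itv _ x _ _ Ia intf derf
    (fun=> C1) _ intG Gub).
rewrite /convol (@differentiation_under_integral R _ RT leb _ unit_itv _ x _ _ Ia intf derf
    (fun=> C1) _ intG Gub) //.
by apply: eq_Rintegral => y _; rewrite d1.
Qed.

Lemma convol_nderivable f phi n :
  measurable_fun (unit_itv : set RT) f ->
  (forall y, unit_itv y -> `|f y| <= 1) ->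
  (forall k, nderivable k phi) ->
  (forall k, exists C, forall y, `|derive1n k phi y| <= C) ->
  nderivable n (convol f phi) /\ derive1n n (convol f phi) = convol f (derive1n n phi).
Proof.
move=> mf f1; elim: n phi => [//|n IH] phi dphi phiC.
have [C0 phi0] := phiC 0%N; have [C1 phi1] := phiC 1%N.
have d0 y : derivable phi y 1 by have [] := dphi 1%N.
have dd x := convol_derive x mf f1 d0 phi0 phi1.
have e : derive1 (convol f phi) = convol f (derive1 phi).
  by apply/funext => x; have [] := dd x.
have [|k|dn en] := IH (derive1 phi).
- by move=> k; have [] := dphi k.+1.
- by have [C phik] := phiC k.+1; exists C => y; rewrite -derive1Sn.
split; last by rewrite derive1Sn e en derive1Sn.
by split => [x|]; [have [] := dd x|rewrite e].
Qed.

Lemma derive1n_eq0_open (phi : R -> R) (U : set R) k : open U ->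
  (forall x, U x -> phi x = 0) -> forall x, U x -> derive1n k phi x = 0.
Proof.
move=> oU phi0; elim: k => [|k IH] x Ux; first exact: phi0.
rewrite derive1nS derive1E.
rewrite (@near_eq_derive _ _ _ (derive1n k phi) (cst 0)); first by rewrite derive_cst.
by apply: filterS IH _; exact: open_nbhs_nbhs.
Qed.

Lemma derive1n_support phi k (h : R) :
  (forall x, h <= `|x| -> phi x = 0) -> forall x, h < `|x| -> derive1n k phi x = 0.
Proof.
have cn : continuous (fun x : R => `|x|) by exact: norm_continuous.
move=> phi0; apply: (@derive1n_eq0_open phi [set x | h < `|x|]) => [|x /ltW /phi0 //].
apply: (@open_comp _ _ (fun x : R => `|x|) [set y | h < y]) => [x _|]; [exact: cn|exact: open_gt].
Qed.

Lemma continuous_segment_bounded f (a b : R) : a <= b -> continuous f ->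
  exists C, forall x, a <= x <= b -> `|f x| <= C.
Proof.
move=> ab cf; have [|c _ fc] := @EVT_max _ (fun x => `|f x|) a b ab.
  apply: continuous_subspaceT => x.
  by apply: (@continuous_comp _ _ _ f Num.norm); [exact: cf|exact: norm_continuous].
by exists `|f c| => x axb; apply: fc; rewrite in_itv.
Qed.

Lemma derivable_mollifier k (h y : R) : derivable (derive1n k (mollifier h)) y 1.
Proof. by move: k y; apply/smoothP => j; exact: nderivable_mollifier. Qed.

Lemma mollifier_bounded k (h : R) : exists C, forall y, `|derive1n k (mollifier h) y| <= C.
Proof.
have dk := @derivable_mollifier k h.
have hh : - `|h| <= `|h| by rewrite ge0_cp.
have [C fC] := continuous_segment_bounded hh (derivable_continuous dk).
exists `|C| => y; have [yh|hy] := leP `|y| `|h|.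
  by rewrite (le_trans (fC y _)) ?ler_norm // -ler_norml.
rewrite (@derive1n_support _ k `|h|) ?normr0 // => x hx.
by apply: mollifier_eq0; rewrite (le_trans _ hx) // ler_norm.
Qed.

(** The margins keep the support [x - h, x + h] inside the open interval. *)
Lemma mollifier_test (h x : R) : h < x < 1 - h -> 0 < h ->
  test_function (fun y => mollifier h (x - y)).
Proof.
move=> hx h0.
have e : (fun y => mollifier h (x - y)) = (fun y => mollifier h (-1 * y + x)).
  by apply/funext => y; congr mollifier; lra.
split; last first.
  exists `[x - h, x + h]%classic; split; first exact: segment_compact.
    by move=> y /=; rewrite !in_itv /=; lra.
  move=> y /= /negP; rewrite in_itv /= negb_and -!ltNge => yh.
  by apply: mollifier_eq0; rewrite ler_normr; case/orP: yh => ?; apply/orP; [left|right]; lra.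
rewrite e; apply/smoothP => k.
by apply: nderivable_affine; exact: nderivable_mollifier.
Qed.

End Convolution.

(** * Divided differences of functions of the class *)

Section LinftyNorm.
Context {disp : measure_display} {T : measurableType disp} {R : realType}.
Variables (mu : {measure set T -> \bar R}) (D : set T).
Implicit Types (f : T -> R).

(** The positivity hypothesis excludes the default value 0 that the norm takes for a zero
    measure. *)
Lemma Linfty_norm_ae f (C : R) : (0 < mu [set: T])%E ->
  (Linfty_norm mu D f <= C%:E)%E -> {ae mu, forall x, D x -> `|f x| <= C}.
Proof.
rewrite /Linfty_norm unlock => -> /ess_supP; apply: filterS => x + Dx.
by rewrite /= lee_fin patchE mem_set.
Qed.

Lemma Linfty_norm_le f (C : R) : 0 <= C -> (forall x, D x -> `|f x| <= C) ->
  (Linfty_norm mu D f <= C%:E)%E.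
Proof.
move=> C0 fC; rewrite /Linfty_norm unlock; case: ifP => _; last by rewrite lee_fin.
apply/ess_supP; apply: aeW => x; rewrite /= lee_fin patchE.
by case: ifPn => [/set_mem/fC //|_]; rewrite normr0.
Qed.

Lemma Linfty_bounded f (C : R) : measurable_fun setT (f \_ D) ->
  (forall x, D x -> `|f x| <= C) -> Linfty mu D f.
Proof.
move=> mf fC; rewrite /Linfty /= /Lfun inE /=; apply/andP; split; rewrite inE //=.
have : (Linfty_norm mu D f <= `|C|%:E)%E.
  by apply: Linfty_norm_le => // x /fC fx; rewrite (le_trans fx) // ler_norm.
by move=> /le_lt_trans; apply; exact: ltry.
Qed.

Lemma Linfty_measurable f : Linfty mu D f -> measurable_fun setT (f \_ D).
Proof. by rewrite /Linfty /= => /sub_Lfun_mfun; rewrite inE. Qed.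

End LinftyNorm.

(** * From a bound on the weak derivative to a bound on divided differences *)

Section SobolevDividedDifference.
Context {R : realType}.
Local Notation RT := (measurableTypeR R).
Local Notation leb := (@lebesgue_measure R).
Implicit Types (f g phi : R -> R).
Hint Resolve measurable_unit_itv : core.

Lemma leb_setT_gt0 : (0 < leb [set: RT])%E.
Proof.
apply: (@lt_le_trans _ _ (leb unit_itv)).
  by rewrite [X in (_ < X)%E]leb_unit_itv lte_fin.
by apply: le_measure; rewrite ?inE.
Qed.

(* Constant on [h, 1 - h], where it is the integral of the mollifier. *)
Local Notation mass h := (convol (cst 1) (mollifier h)).

Lemma mollifier_derivable h x : derivable (mollifier h : R -> R) x 1.
Proof. exact: (@derivable_mollifier R 0 h x). Qed.

Lemma mollifier_continuous h : continuous (mollifier h : R -> R).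
Proof. by apply: derivable_continuous => x; exact: mollifier_derivable. Qed.

(** Differentiating under the integral and then integrating the derivative of the kernel over [0, 1]
    leaves the values of the mollifier at x and x - 1. Both vanish, since these points have absolute
    value at least h. *)
Lemma mass_derive (h x : R) : h <= x <= 1 - h ->
  is_derive x (1 : R) (mass h) 0.
Proof.
move=> /andP[hx xh].
have m1 : measurable_fun (unit_itv : set RT) (cst (1 : R)) by exact: measurable_cst.
have c1 (y : R) : unit_itv y -> `|cst (1 : R) y| <= 1 by rewrite normr1.
have [C0 p0] := mollifier_bounded 0 h; have [C1 p1] := mollifier_bounded 1 h.
have [d e] := convol_derive x m1 c1 (@mollifier_derivable h) p0 p1.
apply: DeriveDef => //; rewrite -derive1E e /convol.
have cd : continuous (fun y => derive1 (mollifier h) (x - y)).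
  by apply: shift_continuous; exact: derivable_continuous (@derivable_mollifier _ 1 h).
have dF (y : R) : is_derive y (1 : R) (fun y => - mollifier h (x - y)) (derive1 (mollifier h) (x - y)).
  have := @is_derive_comp_affine R (mollifier h) (-1) x y (@mollifier_derivable h _).
  move=> /is_deriveN; rewrite mulrN1 opprK (_ : -1 * y + x = x - y); last by lra.
  rewrite (_ : (- _) = (fun y => - mollifier h (x - y))) //.
  by apply/funext => z; congr (- mollifier _ _); lra.
have := @continuous_FTC2 R (fun y => derive1 (mollifier h) (x - y))
  (fun y => - mollifier h (x - y)) 0 1 ltr01.
rewrite /Rintegral => H.
under eq_integral do rewrite /= mul1r.
rewrite H.
- rewrite /= subr0 !mollifier_eq0 ?subrr ?oppr0 ?addr0 //.
  + by rewrite ler_normr; apply/orP; left.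
  + by rewrite ler_normr; apply/orP; right; lra.
- exact: continuous_subspaceT.
- have cF : continuous (fun y => - mollifier h (x - y)).
    by apply: derivable_continuous => y; exact: (@ex_derive _ _ _ _ _ _ _ (dF y)).
  split => [y _||].
  + exact: (@ex_derive _ _ _ _ _ _ _ (dF y)).
  + by apply: cvg_at_right_filter; exact: cF.
  + by apply: cvg_at_left_filter; exact: cF.
- by move=> y _; rewrite derive1E (@derive_val _ _ _ _ _ _ _ (dF y)).
Qed.

Lemma mass_const (h x y : R) : h <= x <= 1 - h -> h <= y <= 1 - h ->
  mass h x = mass h y.
Proof.
wlog xy : x y / x <= y.
  move=> H hx hy; have [xy|/ltW yx] := leP x y; first exact: H.
  by apply/esym; exact: H.
move=> /andP[hx xh] /andP[hy yh].
have dm z : z \in `[x, y] -> is_derive z (1 : R) (mass h) 0.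
  by rewrite in_itv /= => /andP[xz zy]; apply: mass_derive; lra.
move: (mass h) dm => m dm.
have cm : {within `[x, y], continuous m}.
  apply: derivable_within_continuous => z zxy.
  exact: (@ex_derive _ _ _ _ _ _ _ (dm z zxy)).
have dm' z : z \in `]x, y[ -> is_derive z (1 : R) m (cst 0 z).
  by move=> zxy; apply: dm; exact: subset_itv_oo_cc.
have [c _] := MVT_segment xy dm' cm.
by rewrite /= mul0r => /eqP; rewrite subr_eq0 => /eqP.
Qed.

Lemma mass_gt0 (h x : R) : 0 < h -> h <= x <= 1 - h -> 0 < mass h x.
Proof.
move=> h0 /andP[hx xh].
(* On this interval of length h both factors of the mollifier are at least [flat 1 (h / 2)]. *)
set A : set RT := `[x - h / 2, x + h / 2]%classic.
pose c : R := flat 1 (h / 2) * flat 1 (h / 2).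
have c0 : 0 < c by rewrite mulr_gt0 // flat1_gt0 // divr_gt0.
have mA : measurable A by exact: measurable_itv.
have AD : A `<=` unit_itv by move=> y; rewrite /A /unit_itv /= !in_itv /=; lra.
have flat_le (a b : R) : 0 < a <= b -> flat 1 a <= flat 1 b.
  move=> /andP[a0 ab]; rewrite /flat a0 (lt_le_trans a0 ab) !hornerE.
  by rewrite ler_expR lerN2 lef_pV2 ?posrE // (lt_le_trans a0).
apply: (@lt_le_trans _ _ (\int[leb]_(y in unit_itv) (c * \1_A y))).
  rewrite RintegralZl //; last first.
    apply: (@integrable_unit _ _ 1) => [|y _]; first exact: measurable_indic.
    by rewrite /indic; case: (_ \in _); rewrite ?normr1 ?normr0.
  rewrite mulr_gt0 // /Rintegral integral_indic // setIidl //.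
  rewrite [X in fine X]lebesgue_measure_itv /= lte_fin ifT; last lra.
  by rewrite /=; lra.
apply: le_Rintegral => //.
- apply: (@integrable_unit _ _ c) => [|y _].
    by apply: measurable_funM; [exact: measurable_cst|exact: measurable_indic].
  rewrite normrM (gtr0_norm c0) ger_pMr // /indic.
  by case: (_ \in _); rewrite ?normr1 ?normr0.
- have [C fC] := mollifier_bounded 0 h.
  apply: convol_integrable fC => // [y _|]; first by rewrite normr1.
  exact: mollifier_continuous.
- move=> y _; rewrite mul1r indicE; have [|_] := boolP (y \in A); last first.
    by rewrite mulr0 mollifier_ge0.
  rewrite inE /A /= in_itv /= mulr1 => /andP[y1 y2].
  by rewrite ler_pM ?flat1_ge0 // flat_le //; lra.
Qed.

Lemma convol_approx f (h x c eta : R) : measurable_fun (unit_itv : set RT) f ->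
  (forall y, unit_itv y -> `|f y| <= 1) ->
  (forall y, unit_itv y -> `|y - x| < h -> `|f y - c| <= eta) ->
  `|convol f (mollifier h) x - c * mass h x| <= eta * mass h x.
Proof.
move=> mf f1 fe.
have [C pC] := mollifier_bounded 0 h.
have cm := @mollifier_continuous h.
have i1 : leb.-integrable unit_itv (EFin \o (fun y => f y * mollifier h (x - y))).
  exact: convol_integrable pC.
have m1 : measurable_fun (unit_itv : set RT) (cst (1 : R)) by exact: measurable_cst.
have i2 : leb.-integrable unit_itv (EFin \o (fun y => cst 1 y * mollifier h (x - y))).
  by apply: convol_integrable pC => // y _; rewrite normr1.
have i3 (a : R) : leb.-integrable unit_itv (EFin \o (fun y => a * (cst 1 y * mollifier h (x - y)))).
  have := integrableZl measurable_unit_itv a i2.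
  by rewrite (_ : (fun _ => _) = EFin \o (fun y => a * (cst 1 y * mollifier h (x - y)))).
rewrite /convol -!RintegralZl // -RintegralB //.
apply: le_trans; first apply: le_normr_Rintegral => //.
  have := integrableB measurable_unit_itv i1 (i3 c).
  by rewrite (_ : (_ \- _)%E = EFin \o (fun y => f y * mollifier h (x - y) - c * (cst 1 y * mollifier h (x - y)))).
have iB := integrableB measurable_unit_itv i1 (i3 c).
apply: le_Rintegral => //.
  by have := integrable_abse iB.
move=> y uy /=; rewrite mul1r -mulrBl normrM (ger0_norm (mollifier_ge0 _ _)).
have [yh|hy] := ltP `|y - x| h; first by rewrite ler_wpM2r ?mollifier_ge0 // fe.
by rewrite mollifier_eq0 ?mulr0 // distrC.
Qed.

(** The reflected mollifier is a test function, so the weak derivative moves r derivatives from the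
    kernel onto g. The sign (-1)^r of the reflection cancels the one in [weak_derivative]. As the
    kernel is nonnegative, |g| <= M almost everywhere suffices. *)
Lemma weak_convol_bound f g r (M h x : R) : measurable_fun (unit_itv : set RT) f ->
  (forall y, unit_itv y -> `|f y| <= 1) ->
  Linfty leb unit_itv g -> weak_derivative r f g ->
  (Linfty_norm leb unit_itv g <= M%:E)%E -> 0 < h -> h < x < 1 - h ->
  `|convol f (derive1n r (mollifier h)) x| <= M * mass h x.
Proof.
move=> mf f1 Lg wfg gM h0 hx.
pose psi y : R := mollifier h (x - y).
have psiE : psi = (fun y => mollifier h (-1 * y + x)).
  by apply/funext => y; congr mollifier; lra.
have psi_r y : derive1n r psi y = (-1) ^+ r * derive1n r (mollifier h) (x - y).
  rewrite psiE derive1n_affine; last exact: nderivable_mollifier.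
  by have -> : -1 * y + x = x - y by lra.
have tp : test_function psi by exact: mollifier_test.
have [Cr pCr] := mollifier_bounded r h.
have [C pC] := mollifier_bounded 0 h.
have cr : continuous (derive1n r (mollifier h) : R -> R).
  by apply: derivable_continuous => y; exact: derivable_mollifier.
have cpsi : continuous psi by apply: shift_continuous; exact: mollifier_continuous.
have := wfg _ tp.
have -> : \int[leb]_(y in unit_itv) (f y * derive1n r psi y) =
    \int[leb]_(y in unit_itv) ((-1) ^+ r * (f y * derive1n r (mollifier h) (x - y))).
  by apply: eq_Rintegral => y _; rewrite psi_r mulrCA.
rewrite RintegralZl //; last exact: convol_integrable pCr.
have s0 : (-1 : R) ^+ r != 0 by rewrite signr_eq0.
move=> /(mulfI s0) E; rewrite /convol E.
have mg : measurable_fun (unit_itv : set RT) g.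
  by apply/(measurable_restrictT _ _).2 => //; exact: Linfty_measurable Lg.
have mgp : measurable_fun (unit_itv : set RT) (fun y => g y * psi y).
  by apply: measurable_funM => //; exact: continuous_measurable.
have psi0 y : 0 <= psi y by exact: mollifier_ge0.
have m1 : measurable_fun (unit_itv : set RT) (cst (1 : R)) by exact: measurable_cst.
have i2 : leb.-integrable unit_itv (EFin \o (fun y => cst 1 y * psi y)).
  by apply: convol_integrable pC => // [y _|]; [rewrite normr1|exact: mollifier_continuous].
have M0 : 0 <= M by rewrite -lee_fin (le_trans _ gM) // Lnorm_ge0.
have key : (`|\int[leb]_(y in unit_itv) (g y * psi y)%:E| <= (M * mass h x)%:E)%E.
  apply: le_trans; first by apply: le_abse_integral => //; exact/measurable_EFinP.
  have -> : ((M * mass h x)%:E = \int[leb]_(y in unit_itv) (M * (cst 1 y * psi y))%:E)%E.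
    rewrite -[RHS]fineK; first by congr EFin; rewrite -[RHS]/(Rintegral _ _ _) RintegralZl.
    by apply: integrable_fin_num => //; exact: (integrableZl measurable_unit_itv M i2).
  apply: ae_ge0_le_integral => //.
  - by apply: measurableT_comp => //; exact/measurable_EFinP.
  - by move=> y _; rewrite lee_fin mul1r mulr_ge0.
  - by apply: measurable_int; exact: (integrableZl measurable_unit_itv M i2).
  - have := Linfty_norm_ae leb_setT_gt0 gM; apply: filterS => y gy uy.
    by rewrite /= lee_fin mul1r normrM (ger0_norm (psi0 y)) ler_wpM2r // gy.
by rewrite /Rintegral; move: key; case: integral => [a| |].
Qed.

(** Meant for f a mollification of mass a and [g j] the values of the original function: a bound for
    the former passes to the latter up to eta times the sum of the absolute weights. *)
Lemma divided_differenceE n (x : 'I_n.+1 -> R) (g : 'I_n.+1 -> R) f (a C eta : R) : 0 < a ->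
  `|divided_difference x f| <= C * a ->
  (forall j, `|f (x j) - g j * a| <= eta * a) ->
  `|\sum_(j < n.+1) g j * node_weight x j| <= C + eta * \sum_(j < n.+1) `|node_weight x j|.
Proof.
move=> a0 fC fg.
rewrite -(ler_pM2r a0) -[X in `|_| * X](gtr0_norm a0) -normrM mulr_suml.
have -> : \sum_(j < n.+1) g j * node_weight x j * a =
    divided_difference x f - \sum_(j < n.+1) (f (x j) - g j * a) * node_weight x j.
  by rewrite /divided_difference -sumrB; apply: eq_bigr => j _; ring.
rewrite (le_trans (ler_normB _ _)) // mulrDl lerD //.
rewrite (le_trans (ler_norm_sum _ _ _)) // -mulrA mulr_suml mulr_sumr ler_sum // => j _.
rewrite normrM (mulrC `|node_weight x j|) mulrA.
by apply: ler_wpM2r.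
Qed.

Lemma unit_continuous_modulus f x eta : {within unit_itv, continuous f} ->
  unit_itv x -> 0 < eta ->
  exists2 delta : R, 0 < delta &
    forall y, unit_itv y -> `|y - x| < delta -> `|f y - f x| <= eta.
Proof.
move=> /subspace_continuousP cf ux eta0.
have /cvgrPdist_le /(_ _ eta0) := cf x ux.
rewrite near_withinE => -[d /= d0 fd]; exists d => // y uy yx.
by rewrite distrC; apply: fd => //=; rewrite distrC.
Qed.

(** The nodes are contracted towards 1/2, which makes room for a mollifier. For the mollified
    function the mean value form and [weak_convol_bound] give M / r!. Continuity of f bounds the
    cost of moving the nodes and of mollifying by an arbitrarily small e. *)
Lemma factor_divided_difference r (M : R) f (x : 'I_r.+1 -> R) :
  factor_class r M f -> injective x -> (forall j, unit_itv (x j)) ->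
  `|divided_difference x f| <= M / r`!%:R.
Proof.
move=> [f1 [cf _] [g [Lg wfg gM]]] xI ux.
have f1' y : unit_itv y -> `|f y| <= 1.
  by move=> /f1 /=; rewrite in_itv /= ler_norml.
have mf : measurable_fun (unit_itv : set RT) f.
  exact: (subspace_continuous_measurable_fun measurable_unit_itv cf).
set W := \sum_(j < r.+1) `|node_weight x j|.
have W0 : 0 <= W by exact: sumr_ge0.
apply/ler_addgt0Pr => e e0.
pose eta := e / (W + 1).
have eta0 : 0 < eta by rewrite divr_gt0 // ltr_wpDl.
have [delta d0 fd] : exists2 delta : R, 0 < delta & forall j y, unit_itv y ->
    `|y - x j| < delta -> `|f y - f (x j)| <= eta.
  have H j : exists d : R, 0 < d /\ forall y, unit_itv y -> `|y - x j| < d -> `|f y - f (x j)| <= eta.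
    by have [d d0 fd] := unit_continuous_modulus cf (ux j) eta0; exists d.
  have [d dP] := choice H.
  exists (\big[Order.min/1]_j d j).
    by apply/bigmin_gtP; split => // j _; have [] := dP j.
  move=> j y uy yx; apply: (dP j).2 => //; apply: (lt_le_trans yx).
  exact: bigmin_le.
(* Contraction by lam moves a node by less than delta / 2 and leaves it at distance at least (1 -
   lam) / 2 from 0 and 1. With h <= (1 - lam) / 4 and h <= delta / 4, the mollifier fits into [0, 1]
   and only sees points within delta of the original node. *)
pose lam := 1 - Num.min (1 / 2) (delta / 4).
have lamP : [/\ 0 < lam, lam < 1 & 1 - lam < delta / 2].
  rewrite /lam; case: (leP (1/2) (delta / 4)) => ?; split; lra.
have [lam0 lam1 lamd] := lamP.
pose h := Num.min ((1 - lam) / 4) (delta / 4).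
have h0 : 0 < h by rewrite lt_min !divr_gt0 // subr_gt0.
have h1 : h <= (1 - lam) / 4 by rewrite ge_min lexx.
have h2 : h <= delta / 4 by rewrite ge_min lexx orbT.
pose y j := 1 / 2 + lam * (x j - 1 / 2).
have yI : injective y.
  by move=> i j /addrI /(mulfI (lt0r_neq0 lam0)) /addIr /xI.
have xj j : 0 <= x j <= 1 by have := ux j; rewrite /unit_itv /= in_itv.
have yh j : h < y j < 1 - h.
  have := xj j; rewrite /y => /andP[x0 x1].
  have : lam * (x j - 1/2) <= lam * (1/2) by rewrite ler_pM2l //; lra.
  have : lam * (-1/2) <= lam * (x j - 1/2) by rewrite ler_pM2l //; lra.
  by lra.
have uy j : unit_itv (y j) by have := yh j; rewrite /unit_itv /= in_itv /=; lra.
have yx j : `|y j - x j| < delta / 2.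
  have -> : y j - x j = (1 - lam) * (1 / 2 - x j) by rewrite /y; ring.
  rewrite normrM gtr0_norm ?subr_gt0 //; apply: le_lt_trans lamd.
  by rewrite ger_pMr ?subr_gt0 // ler_norml; have := xj j; lra.
have [dF dFE] := convol_nderivable r mf f1' (fun k => nderivable_mollifier k h)
  (fun k => mollifier_bounded k h).
pose a := mass h (1 / 2).
have massE z : h <= z <= 1 - h -> mass h z = a.
  by move=> zh; apply: mass_const => //; lra.
have a0 : 0 < a by apply: mass_gt0 => //; lra.
(* The margin keeps the mean value point xi where [weak_convol_bound] applies. *)
have yrange : exists2 b : R, h < b /\ b < 1 / 2 & forall j, b <= y j <= 1 - b.
  exists (\big[Order.min/(1 / 2 + h) / 2]_j (Num.min (y j) (1 - y j))).
    split; last by rewrite (le_lt_trans (bigmin_le_id _ _ _ _)) //; lra.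
    apply/bigmin_gtP; split; first lra.
    by move=> j _; rewrite lt_min; have := yh j; lra.
  move=> j; have : \big[Order.min/(1 / 2 + h) / 2]_j (Num.min (y j) (1 - y j)) <= Num.min (y j) (1 - y j).
    exact: bigmin_le.
  by rewrite le_min => /andP[]; lra.
have [b [hb b1] yb] := yrange.
have [xi /andP[bxi xib] xiE] := divided_difference_mean dF yI yb.
have fact0 : (0 : R) < r`!%:R by rewrite ltr0n fact_gt0.
have ddF : `|divided_difference y (convol f (mollifier h))| <= M / r`!%:R * a.
  have xih : h < xi < 1 - h by lra.
  have := weak_convol_bound mf f1' Lg wfg gM h0 xih.
  rewrite -dFE -xiE massE; last lra.
  by rewrite normrM gtr0_norm // mulrAC ler_pdivlMr // mulrC.
have fy j : `|convol f (mollifier h) (y j) - f (x j) * a| <= eta * a.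
  rewrite -(massE (y j)); last by have := yh j; lra.
  apply: convol_approx => // z uz zy; apply: fd => //.
  rewrite -(subrK (y j) z) -addrA (le_lt_trans (ler_normD _ _)) //.
  by have := yx j; lra.
(* A weight is the inverse of a product of r differences, hence homogeneous of degree - r under the
   contraction. *)
have wE j : node_weight x j = lam ^+ r * node_weight y j.
  have -> : node_weight y j = (\prod_(i < r.+1 | i != j) (lam * (x j - x i)))^-1.
    by congr (_^-1); apply: eq_bigr => i _; rewrite /y; ring.
  rewrite big_split prodr_const cardC1 card_ord /= invfM mulVKf //.
  by rewrite expf_neq0 // gt_eqF.
have M0 : 0 <= M by rewrite -lee_fin (le_trans _ gM) // Lnorm_ge0.
have := divided_differenceE a0 ddF fy.
rewrite -(ler_pM2l (exprn_gt0 r lam0)) -[X in X * `|_|](ger0_norm (exprn_ge0 r (ltW lam0))).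
rewrite -normrM mulr_sumr (eq_bigr (fun j => f (x j) * node_weight x j)); last first.
  by move=> j _; rewrite wE mulrCA.
move=> /le_trans; apply; rewrite mulrDr lerD //.
  by rewrite ler_piMl ?divr_ge0 // exprn_ile1 // ltW.
rewrite mulrCA mulr_sumr (eq_bigr (fun j => `|node_weight x j|)); last first.
  by move=> j _; rewrite wE normrM ger0_norm // exprn_ge0 // ltW.
rewrite /eta -/W mulrAC ler_pdivrMr ?ltr_wpDl //; apply: ler_wpM2l; first exact: ltW.
by rewrite lerDl.
Qed.

End SobolevDividedDifference.

(** * Zeros and Lipschitz continuity of factors *)

Section FactorClass.
Context {R : realType}.
Implicit Types (f g : R -> R).

Lemma unit_itvE (x : R) : unit_itv x = (0 <= x <= 1) :> Prop.
Proof. by rewrite /unit_itv /= in_itv. Qed.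

Lemma factor_norm_le1 r (M : R) f x : factor_class r M f -> unit_itv x -> `|f x| <= 1.
Proof. by move=> [f1 _ _] /f1 /=; rewrite in_itv /= ler_norml. Qed.

Lemma prod_norm_le1 (I : Type) (s : seq I) (P : pred I) (a : I -> R) :
  (forall i, P i -> `|a i| <= 1) -> `|\prod_(i <- s | P i) a i| <= 1.
Proof. by move=> a1; rewrite normr_prod; apply: prodr_ile1 => i /a1 ->; rewrite normr_ge0. Qed.

Lemma prod_diff_le (I : Type) (s : seq I) (a b : I -> R) :
  (forall i, `|a i| <= 1) -> (forall i, `|b i| <= 1) ->
  `|\prod_(i <- s) a i - \prod_(i <- s) b i| <= \sum_(i <- s) `|a i - b i|.
Proof.
move=> a1 b1; elim: s => [|i s IH]; first by rewrite !big_nil subrr normr0.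
rewrite !big_cons.
set A := \prod_(_ <- _) _; set B := \prod_(_ <- _) _.
have -> : a i * A - b i * B = (a i - b i) * A + b i * (A - B) by ring.
rewrite (le_trans (ler_normD _ _)) // lerD // normrM.
  by rewrite ler_piMr // prod_norm_le1.
by rewrite (le_trans _ IH) // ler_piMl.
Qed.

(** In the divided difference at x and the r zeros, only the term of x survives: f(x) divided by the
    product of the x - z j. *)
Lemma factor_zeros r (M : R) f (z : 'I_r -> R) x : factor_class r M f -> 0 <= M ->
  injective z -> (forall j, unit_itv (z j)) -> (forall j, f (z j) = 0) ->
  unit_itv x -> `|f x| <= M / r`!%:R * \prod_(j < r) `|x - z j|.
Proof.
move=> ff M0 zI uz fz ux.
have rhs0 : 0 <= M / r`!%:R * \prod_(j < r) `|x - z j|.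
  by rewrite mulr_ge0 ?divr_ge0 // prodr_ge0.
have [[j e]|xz] := pselect (exists j, x = z j).
  by rewrite [in leLHS]e fz normr0.
pose y (i : 'I_r.+1) := oapp z x (unlift ord0 i).
have y0 : y ord0 = x by rewrite /y unlift_none.
have yS j : y (lift ord0 j) = z j by rewrite /y liftK.
have yI : injective y.
  move=> i1 i2; case: (unliftP ord0 i1) => [j1|] ->; case: (unliftP ord0 i2) => [j2|] ->;
    rewrite ?y0 ?yS // => e.
  - by rewrite (zI _ _ e).
  - by case: xz; exists j1.
  - by case: xz; exists j2.
have uy j : unit_itv (y j) by case: (unliftP ord0 j) => [k|] ->; rewrite ?y0 ?yS.
have := factor_divided_difference ff yI uy.
rewrite /divided_difference big_ord_recl big1 => [|j _]; last by rewrite yS fz mul0r.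
rewrite addr0 y0 normrM /node_weight big_mkcond big_ord_recl eqxx /= mul1r y0.
rewrite normfV normr_prod => H.
have -> : \prod_(j < r) `|x - z j| = \prod_(i < r)
    `|if lift ord0 i != ord0 then x - y (lift ord0 i) else 1|.
  by apply: eq_bigr => j _; rewrite yS.
rewrite -ler_pdivrMr //; apply: prodr_gt0 => j _.
by rewrite yS normr_gt0 subr_eq0; apply/eqP => e; apply: xz; exists j.
Qed.

Lemma factor_many_zeros r (M : R) f (S : finType) (Z : {set S}) (pt : S -> R) (a x : R) :
  factor_class r M f -> 0 <= M -> {in Z &, injective pt} -> (r <= #|Z|)%N ->
  (forall s, s \in Z -> [/\ unit_itv (pt s), f (pt s) = 0 & `|x - pt s| <= a]) ->
  unit_itv x -> `|f x| <= M / r`!%:R * a ^+ r.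
Proof.
move=> ff M0 ptI rZ hZ ux.
pose z (j : 'I_r) := pt (enum_val (widen_ord rZ j)).
have zZ (j : 'I_r) : enum_val (widen_ord rZ j) \in Z by exact: enum_valP.
have zI : injective z.
  by move=> i j /(ptI _ _ (zZ i) (zZ j)) /enum_val_inj [] /val_inj.
have := factor_zeros ff M0 zI _ _ ux; move=> /(_ (fun j => _)) H.
apply: le_trans (H _ _) _ => [j|j|].
- by have [] := hZ _ (zZ j).
- by have [] := hZ _ (zZ j).
rewrite ler_wpM2l ?divr_ge0 // -[in leRHS](card_ord r) -prodr_const.
by apply: ler_prod => j _; rewrite normr_ge0; have [] := hZ _ (zZ j).
Qed.

(** For r = n + 1, a divided difference with nodes x, y and n auxiliary points away from both
    controls f(x) / A - f(y) / A' by a multiple of |x - y|, where A and A' are the products of the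
    distances to the auxiliary points, with signs. Since A and A' differ by at most n |x - y|, the
    bound passes to f(x) - f(y). *)
Lemma factor_lipschitz r (M : R) : (0 < r)%N -> 0 <= M -> exists2 K : R, 1 <= K &
  forall f, factor_class r M f -> forall x y, unit_itv x -> unit_itv y ->
    `|f x - f y| <= K * `|x - y|.
Proof.
case: r => // n _ M0.
(* Half the spacing 1 / (n + 3) of the n + 2 candidates [w j]. Each of x and y is closer than sigma
   to at most one candidate, so that n of them remain. *)
pose sigma : R := (n.+3%:R * 2)^-1.
have s0 : 0 < sigma by rewrite invr_gt0 mulr_gt0 // ltr0n.
pose C := M / n.+1`!%:R + n%:R * (sigma ^+ n.+1)^-1 + n%:R * (sigma ^+ n)^-1.
exists (C + 1) => [|f ff x y ux uy].
  by rewrite lerDr !addr_ge0 ?mulr_ge0 ?invr_ge0 // exprn_ge0 // ltW.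
have [->|xy] := eqVneq x y; first by rewrite !subrr normr0 mulr0.
suff : `|f x - f y| <= C * `|x - y|.
  by move=> /le_trans; apply; rewrite ler_wpM2r // lerDl.
pose w (j : 'I_n.+2) : R := j.+1%:R / n.+3%:R.
have uw j : unit_itv (w j).
  by rewrite unit_itvE divr_ge0 //= ler_pdivrMr ?ltr0n // mul1r ler_nat ltnW // ltnS.
have wsep i j : i != j -> sigma * 2 <= `|w i - w j|.
  move=> ij; have -> : sigma * 2 = n.+3%:R^-1.
    by rewrite /sigma invfM mulfVK // pnatr_eq0.
  rewrite /w -mulrBl normrM [X in _ * X]ger0_norm ?invr_ge0 // ler_peMl ?invr_ge0 //.
  have nij : (i != j :> nat) by [].
  have [lij|lji|e] := ltngtP i j; last by rewrite e eqxx in nij.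
  - by rewrite distrC -natrB ?ltnS ?(ltnW lij) // ger0_norm // ler1n subn_gt0 ltnS.
  - by rewrite -natrB ?ltnS ?(ltnW lji) // ger0_norm // ler1n subn_gt0 ltnS.
pose B t : {set 'I_n.+2} := [set j : 'I_n.+2 | `|w j - t| < sigma]%SET.
have cB t : (#|B t| <= 1)%N.
  rewrite leqNgt; apply/negP => /card_gt1P[i [j []]]; rewrite !inE => it jt /wsep.
  apply/negP; rewrite -ltNge mulr2n mulrDr mulr1.
  have -> : w i - w j = (w i - t) - (w j - t) by ring.
  by rewrite (le_lt_trans (ler_normB _ _)) // ltrD.
have cG : (n <= #|~: (B x :|: B y)|)%N.
  have := cardsC (B x :|: B y); rewrite card_ord.
  by have := cB x; have := cB y; have := cardsU (B x) (B y); lia.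
pose v (j : 'I_n) : 'I_n.+2 := enum_val (widen_ord cG j).
have vI : injective v by move=> i j /enum_val_inj [] /val_inj.
have vP j t : (t = x \/ t = y) -> sigma <= `|t - w (v j)|.
  have : v j \in ~: (B x :|: B y) by exact: enum_valP.
  by rewrite !inE negb_or -!leNgt !(distrC (w _)) => /andP[? ?] [->|->].
pose wv j := w (v j).
have wvI i j : wv i = wv j -> i = j.
  move=> e; apply: vI; apply/eqP; apply: contraT => /wsep.
  by rewrite -/(wv i) e subrr normr0 leNgt mulr_gt0.
pose u (i : 'I_n.+2) : R :=
  oapp (fun j : 'I_n.+1 => oapp wv y (unlift ord0 j)) x (unlift ord0 i).
have u0 : u ord0 = x by rewrite /u unlift_none.
have u1 : u (lift ord0 ord0) = y by rewrite /u liftK /= unlift_none.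
have u2 j : u (lift ord0 (lift ord0 j)) = wv j by rewrite /u liftK /= liftK.
have xw j : x != wv j.
  by apply/eqP => e; have := vP j x (or_introl erefl); rewrite -/(wv j) -e subrr normr0 leNgt s0.
have yw j : y != wv j.
  by apply/eqP => e; have := vP j y (or_intror erefl); rewrite -/(wv j) -e subrr normr0 leNgt s0.
have uI : injective u.
  move=> i1 i2; case: (unliftP ord0 i1) => [j1|] ->; case: (unliftP ord0 i2) => [j2|] -> //;
  try (case: (unliftP ord0 j1) => [k1|] ->); try (case: (unliftP ord0 j2) => [k2|] ->);
    rewrite ?u0 ?u1 ?u2 // => e.
  - by rewrite (wvI _ _ e).
  - by have := yw k1; rewrite e eqxx.
  - by have := yw k2; rewrite e eqxx.
  - by have := xw k1; rewrite e eqxx.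
  - by have := xy; rewrite e eqxx.
  - by have := xw k2; rewrite e eqxx.
  - by have := xy; rewrite e eqxx.
have uu i : unit_itv (u i).
  case: (unliftP ord0 i) => [j|] ->; rewrite ?u0 //.
  by case: (unliftP ord0 j) => [k|] ->; rewrite ?u1 ?u2 //; exact: uw.
have DD := factor_divided_difference ff uI uu.
have f1 t : unit_itv t -> `|f t| <= 1 by exact: factor_norm_le1 ff.
set A := \prod_(j < n) (x - wv j); set A' := \prod_(j < n) (y - wv j).
have A0 : A != 0 by apply/prodf_neq0 => j _; rewrite subr_eq0.
have A'0 : A' != 0 by apply/prodf_neq0 => j _; rewrite subr_eq0.
have weight0 : node_weight u ord0 = ((x - y) * A)^-1.
  rewrite /node_weight big_mkcond !big_ord_recl eqxx /= mul1r u0 u1; congr ((_ * _)^-1).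
  by apply: eq_bigr => j _; rewrite u2.
have weight1 : node_weight u (lift ord0 ord0) = ((y - x) * A')^-1.
  rewrite /node_weight big_mkcond !big_ord_recl eqxx /= u0 u1 mul1r; congr ((_ * _)^-1).
  by apply: eq_bigr => j _; rewrite u2.
have weight2 j : `|node_weight u (lift ord0 (lift ord0 j))| <= (sigma ^+ n.+1)^-1.
  rewrite /node_weight normfV lef_pV2 ?posrE ?exprn_gt0 //; last first.
    by rewrite normr_gt0; apply/prodf_neq0 => i ij; rewrite subr_eq0 (inj_eq uI) eq_sym.
  rewrite normr_prod.
  have -> : sigma ^+ n.+1 = \prod_(i < n.+2 | i != lift ord0 (lift ord0 j)) sigma.
    by rewrite prodr_const cardC1 card_ord.
  apply: ler_prod => i ij; rewrite (ltW s0) /= u2.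
  case: (unliftP ord0 i) ij => [i'|] -> ij; last by rewrite u0 distrC; apply: vP; left.
  case: (unliftP ord0 i') ij => [k|] -> ij; last by rewrite u1 distrC; apply: vP; right.
  rewrite u2 (le_trans _ (wsep _ _ _)) ?ler_peMr ?ltW //; first by rewrite ltr1n.
  by rewrite inj_eq //; apply: contra ij => /eqP ->.
rewrite /divided_difference !big_ord_recl u0 u1 weight0 weight1 in DD.
set S := \sum_(i < n) _ in DD.
have SC : `|S| <= n%:R * (sigma ^+ n.+1)^-1.
  rewrite (le_trans (ler_norm_sum _ _ _)) // -[X in X%:R * _]card_ord mulr_natl -sumr_const ler_sum // => j _.
  by rewrite normrM -[leRHS]mul1r ler_pM // f1.
have xy0 : x - y != 0 by rewrite subr_eq0.
have yx0 : y - x != 0 by rewrite subr_eq0 eq_sym.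
have key : `|f x / A - f y / A'| <= `|x - y| * (M / n.+1`!%:R + n%:R * (sigma ^+ n.+1)^-1).
  have -> : f x / A - f y / A' = (x - y) * ((f x / ((x - y) * A) + (f y / ((y - x) * A') + S)) - S).
    by field; rewrite ?A0 ?A'0 ?xy0 ?yx0.
  by rewrite normrM ler_wpM2l // (le_trans (ler_normB _ _)) // lerD.
have wv1 t j : unit_itv t -> `|t - wv j| <= 1.
  have := uw (v j); rewrite /wv !unit_itvE ler_norml; lra.
have AA' : `|A - A'| <= n%:R * `|x - y|.
  rewrite (le_trans (prod_diff_le _ _ _)) // => [j|j|]; try exact: wv1.
  rewrite (eq_bigr (fun=> `|x - y|)) => [|j _]; last by congr `|_|; ring.
  by rewrite sumr_const card_ord mulr_natl.
have A1 : `|A| <= 1 by apply: prod_norm_le1 => j _; exact: wv1.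
have A's : `|A'^-1| <= (sigma ^+ n)^-1.
  rewrite normfV lef_pV2 ?posrE ?normr_gt0 ?exprn_gt0 // normr_prod.
  rewrite -[X in _ ^+ X]card_ord -prodr_const; apply: ler_prod => j _.
  by rewrite (ltW s0) /=; apply: vP; right.
have -> : f x - f y = A * (f x / A - f y / A') + f y * A'^-1 * (A - A').
  by field; rewrite ?A0 ?A'0.
rewrite (le_trans (ler_normD _ _)) // !normrM /C mulrDl lerD //.
  by rewrite [leRHS]mulrC (le_trans _ key) // ler_piMl.
rewrite (_ : _ * `|x - y| = 1 * (sigma ^+ n)^-1 * (n%:R * `|x - y|)); last by ring.
by apply: ler_pM => //; apply: ler_pM => //; exact: f1.
Qed.

End FactorClass.

(** * Upper bounds *)

Section UpperBound.
Context {R : realType}.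
Local Notation RT := (measurableTypeR R).
Local Notation leb := (@lebesgue_measure R).
Local Notation pow d := (power_measure leb d).

Lemma factor_measurable r (M : R) g : factor_class r M g ->
  measurable_fun (setT : set RT) (g \_ unit_itv).
Proof.
move=> [_ [cg _] _].
apply/(measurable_restrictT _ _).1; first exact: measurable_unit_itv.
exact: (subspace_continuous_measurable_fun measurable_unit_itv cg).
Qed.

Lemma rank_one_restrict (d : nat) (f : d.-tuple RT -> R) (g : 'I_d -> R -> R) :
  (forall x, cube x -> f x = \prod_(i < d) g i (tnth x i)) ->
  f \_ (@cube R d) = fun x => \prod_(i < d) (g i \_ unit_itv) (tnth x i).
Proof.
move=> fg; apply/funext => x; rewrite patchE; case: ifPn => [/set_mem cx|/negP cx].
  by rewrite fg //; apply: eq_bigr => i _; rewrite patchE mem_set //; exact: cx.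
have [i ui] : exists i, ~ unit_itv (tnth x i).
  by apply/existsNP => H; apply: cx; rewrite inE.
by rewrite (bigD1 i) //= patchE memNset // mul0r.
Qed.

Lemma rank_one_measurable r (M : R) d f : rank_one r M f ->
  measurable_fun setT (f \_ (@cube R d)).
Proof.
move=> [g gF fg]; rewrite (rank_one_restrict fg); apply: measurable_prod => i _.
exact: (measurableT_comp (factor_measurable (gF i)) (measurable_tnth i)).
Qed.

Lemma rank_one_norm_le1 r (M : R) d (f : d.-tuple RT -> R) x :
  rank_one r M f -> cube x -> `|f x| <= 1.
Proof.
move=> [g gF fg] cx; rewrite fg //; apply: prod_norm_le1 => i _.
exact: factor_norm_le1 (gF i) (cx i).
Qed.

Lemma observeS d (q : seq R -> d.-tuple RT) (f h : d.-tuple RT -> R) k :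
  observe q f k.+1 = observe q h k.+1 ->
  observe q f k = observe q h k /\ f (q (observe q f k)) = h (q (observe q f k)).
Proof.
move=> /(congr1 val) /= /eqP; rewrite eqseq_rcons => /andP[/eqP /val_inj e /eqP].
by rewrite -e.
Qed.

(** The algorithm queries the points of L in order and returns any function of the class that is
    consistent with the data. Two consistent functions differ by at most eps. *)
Lemma complexity_le_size r (M eps : R) d (L : seq (d.-tuple RT)) : 0 <= eps ->
  (0 < size L)%N -> (forall x, x \in L -> cube x) ->
  (forall f h, rank_one r M f -> rank_one r M h -> {in L, f =1 h} ->
    forall x, cube x -> `|f x - h x| <= eps) ->
  (complexity r M eps d <= (size L)%:R%:E)%E.
Proof.
move=> eps0 L0 cL LP; case: L L0 cL LP => // x0 L' _; set L := x0 :: L' => cL LP.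
(* The length of the transcript is the index of the next query; past the end of L the default [x0]
   is still a point of the cube. *)
pose q (y : seq R) := nth x0 L (size y).
have cq y : cube (q y).
  rewrite /q; have [yL|Ly] := ltnP (size y) (size L); first exact/cL/mem_nth.
  by rewrite nth_default //; apply: cL; rewrite mem_head.
pose good (y : (size L).-tuple R) (f : d.-tuple RT -> R) :=
  rank_one r M f /\ observe q f (size L) = y.
(* The value 0 is returned on data that no function of the class produces. *)
pose out (y : (size L).-tuple R) : d.-tuple RT -> R :=
  if pselect (exists f, good y f) is left H then projT1 (cid H) else cst 0.
have outL y : Linfty (pow d) (@cube R d) (out y).
  apply: (@Linfty_bounded _ _ _ _ _ _ 1); rewrite /out; case: pselect => [H|_].
  - by case: cid => f [] /= /rank_one_measurable.
  - rewrite (_ : _ \_ _ = cst 0); first exact: measurable_cst.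
    by apply/funext => x; rewrite patchE; case: ifP.
  - by case: cid => f [] /= ff _ x; exact: rank_one_norm_le1 ff.
  - by move=> x _; rewrite normr0.
pose A := Algorithm cq outL.
apply: ereal_inf_lbound; exists (size L) => //; split => //.
apply: (@le_trans _ _ (worst_case_error r M A)); first by apply: ereal_inf_lbound; exists A.
apply: ge_ereal_sup => _ [f ff <-].
apply: Linfty_norm_le => // x cx; rewrite /run /= /out.
case: pselect => [H|[]]; last by exists f.
case: cid => h [] /= hh e; apply: LP => // z zL.
have obs k : (k <= size L)%N -> observe q f k = observe q h k.
  move=> kL; rewrite -(subKn kL); elim: (size L - k)%N (leq_subr k (size L)) => [|j IH] jL.
    by rewrite subn0.
  have := IH (ltnW jL); rewrite -[(size L - j)%N]prednK ?subn_gt0 // -subnS.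
  by move=> /observeS[].
have zi : (index z L < size L)%N by rewrite index_mem.
have [_] := observeS (obs _ zi).
by rewrite /q size_tuple nth_index.
Qed.

Definition tuple_update d (z : d.-tuple RT) (i : 'I_d) (t : R) : d.-tuple RT :=
  [tuple if j == i then t else tnth z j | j < d].

Lemma tuple_updateE d (z : d.-tuple RT) i t j :
  tnth (tuple_update z i t) j = if j == i then t else tnth z j.
Proof. by rewrite tnth_mktuple. Qed.

(* A rank one tensor is determined by its values on the lines parallel to the axes
   through a point z where it does not vanish. *)
Lemma rank_one_lines d (g : 'I_d -> R -> R) (z y : d.-tuple RT) :
  (\prod_i g i (tnth y i)) * (\prod_i g i (tnth z i)) ^+ d =
  (\prod_i g i (tnth z i)) * \prod_i \prod_j g j (tnth (tuple_update z i (tnth y i)) j).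
Proof.
set F := \prod_i g i (tnth z i).
have -> : F ^+ d = \prod_(i < d) F by rewrite prodr_const card_ord.
rewrite {2}/F -!big_split /=; apply: eq_bigr => i _.
rewrite (bigD1 i) //= tuple_updateE eqxx /F (bigD1 i) //= mulrCA; congr (_ * (_ * _)); apply: eq_bigr => j ji.
by rewrite tuple_updateE (negbTE ji).
Qed.

Lemma nearest_grid (m : nat) (x : R) : (0 < m)%N -> unit_itv x ->
  exists l : 'I_m.+1, `|x - l%:R / m%:R| <= m%:R^-1.
Proof.
move=> m0; rewrite unit_itvE => /andP[x0 x1].
have m0' : (0 : R) < m%:R by rewrite ltr0n.
have xm0 : 0 <= x * m%:R by rewrite mulr_ge0 // ltW.
have /andP[t1 t2] := truncn_itv xm0.
have tm : (Num.truncn (x * m%:R) < m.+1)%N.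
  by rewrite ltnS -(ler_nat R) (le_trans t1) // ger_pMl.
exists (Ordinal tm) => /=.
rewrite -[X in `|X|](mulfK (lt0r_neq0 m0')) normrM normfV (gtr0_norm m0').
rewrite ler_pdivrMr // mulVf ?gt_eqF // mulrBl mulfVK ?gt_eqF //.
rewrite ger0_norm ?subr_ge0 // lerBlDr ltW // (lt_le_trans t2) //.
by rewrite -natr1 addrC.
Qed.

(** The queries are the points of a hitting set P and, through each of them, d axis-parallel lines
    with m + 1 grid points. If f does not vanish on P, then f and h agree on the whole grid by
    [rank_one_lines], and the Lipschitz bound costs 2 d K / m <= eps. Otherwise both vanish on P and
    are at most eps / 2 at x. *)
Lemma complexity_le_hitting r (M K eps p : R) d (S : finType) (pt : S -> R) n m :
  (0 < d)%N -> 0 < eps -> 0 < p <= 1 -> (0 < m)%N ->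
  (forall s, unit_itv (pt s)) ->
  (forall f, factor_class r M f -> forall x y, unit_itv x -> unit_itv y ->
    `|f x - f y| <= K * `|x - y|) ->
  (forall (g : 'I_d -> R -> R) (x : d.-tuple RT), (forall i, factor_class r M (g i)) ->
    cube x -> eps / 2 < \prod_i `|g i (tnth x i)| ->
    p <= \prod_i (#|[set s | g i (pt s) != 0]%SET|%:R / #|S|%:R)) ->
  (0 < #|S|)%N -> (#|S| * d)%:R <= n%:R * p -> 2 * K * d%:R <= eps * m%:R ->
  (complexity r M eps d <= (n * (d * m.+1).+1)%:R%:E)%E.
Proof.
move=> d0 eps0 /[dup] p01 /andP[p0 p1] m0 upt lipK hit S0 np Km.
have [P sP hP] := product_hitting p01 S0 d0 np.
pose point (z : {ffun 'I_d -> S}) : d.-tuple RT := [tuple pt (z i) | i < d].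
pose lines (z : d.-tuple RT) := [seq tuple_update z i ((l : 'I_m.+1)%:R / m%:R) |
  i <- enum 'I_d, l <- enum 'I_m.+1].
pose L := flatten [seq point z :: lines (point z) | z <- P].
have m0' : (0 : R) < m%:R by rewrite ltr0n.
have ul (l : 'I_m.+1) : unit_itv (l%:R / m%:R : R).
  by rewrite unit_itvE divr_ge0 //= ler_pdivrMr // mul1r ler_nat -ltnS.
have cpoint z : cube (point z) by move=> i; rewrite tnth_mktuple.
have sL : size L = (n * (d * m.+1).+1)%N.
  rewrite size_flatten /shape -map_comp -sP; elim: P {sP hP L} => //= z P IH.
  rewrite IH /lines size_allpairs -!cardE !card_ord.
  by rewrite mulSn.
have n0 : (0 < n)%N.
  rewrite lt0n; apply/eqP => n0; move: np; rewrite n0 mul0r lern0 muln_eq0.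
  by move=> /orP[] /eqP e; [move: S0|move: d0]; rewrite e.
rewrite -sL; apply: complexity_le_size; first exact: ltW.
- by rewrite sL muln_gt0 n0.
- move=> x /flatten_mapP[z zP]; rewrite inE => /predU1P[-> //|/allpairsP[[i l] /= [_ _ ->]]].
  by move=> j; rewrite tuple_updateE; case: ifP => // _; exact: cpoint.
move=> f h [g gF fg] [k kF hk] fh x cx.
have mem_point z : z \in P -> point z \in L.
  by move=> zP; apply/flatten_mapP; exists z => //; rewrite mem_head.
have mem_line z i l : z \in P -> tuple_update (point z) i ((l : 'I_m.+1)%:R / m%:R) \in L.
  move=> zP; apply/flatten_mapP; exists z => //; rewrite inE; apply/orP; right.
  by apply/allpairsP; exists (i, l); rewrite /= !mem_enum.
have [[z zP fz]|fz0] := pselect (exists2 z, z \in P & f (point z) != 0).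
  have /choice[l lP] : forall i, exists l : 'I_m.+1, `|tnth x i - l%:R / m%:R| <= m%:R^-1.
    by move=> i; apply: nearest_grid => //; exact: cx.
  pose y : d.-tuple RT := [tuple (l i)%:R / m%:R | i < d].
  have cy : cube y by move=> i; rewrite tnth_mktuple.
  have cu i : cube (tuple_update (point z) i (tnth y i)).
    by move=> j; rewrite tuple_updateE; case: ifP => _; [exact: cy|exact: cpoint].
  (* The data on the lines through the chosen point agree for f and h, and the nonzero power of the
     value there cancels. *)
  have fhy : f y = h y.
    have Ef : f y * f (point z) ^+ d =
        f (point z) * \prod_i f (tuple_update (point z) i (tnth y i)).
      rewrite !fg // rank_one_lines; congr (_ * _).
      by apply: eq_bigr => i _; rewrite fg.
    have Eh : h y * h (point z) ^+ d =
        h (point z) * \prod_i h (tuple_update (point z) i (tnth y i)).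
      rewrite !hk // rank_one_lines; congr (_ * _).
      by apply: eq_bigr => i _; rewrite hk.
    have fzd : f (point z) ^+ d != 0 by rewrite expf_neq0.
    apply: (mulIf fzd); rewrite Ef [in RHS]fh ?mem_point // Eh -fh ?mem_point //.
    congr (_ * _); apply: eq_bigr => i _; apply: fh.
    by rewrite tnth_mktuple; exact: mem_line.
  have close (u : 'I_d -> R -> R) : (forall i, factor_class r M (u i)) ->
      `|\prod_i u i (tnth x i) - \prod_i u i (tnth y i)| <= d%:R * (K / m%:R).
    move=> uF; rewrite (le_trans (prod_diff_le _ _ _)) // => [i|i|].
    - exact: factor_norm_le1 (uF i) (cx i).
    - exact: factor_norm_le1 (uF i) (cy i).
    rewrite mulr_natl -[X in _ *+ X]card_ord -sumr_const; apply: ler_sum => i _.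
    rewrite (le_trans (lipK _ (uF i) _ _ (cx i) (cy i))) // tnth_mktuple.
    have K0 : 0 <= K.
      have := lipK _ (uF i) 0 1; rewrite !unit_itvE !lexx ler01 sub0r normrN normr1 mulr1.
      by move=> H; apply: le_trans (H isT isT).
    by rewrite ler_wpM2l.
  have -> : f x - h x = (f x - f y) - (h x - h y) by rewrite fhy; ring.
  rewrite (le_trans (ler_normB _ _)) //.
  apply: (@le_trans _ _ (d%:R * (K / m%:R) + d%:R * (K / m%:R))).
    by rewrite lerD // ?fg ?hk // close.
  have -> : d%:R * (K / m%:R) + d%:R * (K / m%:R) = 2 * K * d%:R / m%:R by ring.
  by rewrite ler_pdivrMr.
(* The contrapositive of [hit]: a value above eps / 2 at x would give nonvanishing sets large enough
   for P to meet their product. *)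
have small (u : d.-tuple RT -> R) : rank_one r M u ->
    (forall z, z \in P -> u (point z) = 0) -> `|u x| <= eps / 2.
  move=> [v vF uv] uP; rewrite leNgt; apply/negP; rewrite uv // normr_prod => ux.
  have [z zP zB] := hP (fun i => [set s | v i (pt s) != 0]%SET) (hit v x vF cx ux).
  have := uP _ zP; rewrite uv // => /eqP/prodf_eq0[i _].
  by have := zB i; rewrite inE tnth_mktuple => /negbTE ->.
have fP z : z \in P -> f (point z) = 0.
  by move=> zP; apply: contrapT => /eqP nz; apply: fz0; exists z.
rewrite (le_trans (ler_normB _ _)) // [eps]splitr lerD //.
  by apply: small => //; exists g.
apply: small => [|z zP]; first by exists k.
by rewrite -fh ?mem_point // fP.
Qed.

End UpperBound.

(** * Uniform grids and the polynomial bound for M <= r! *)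

Section Tractability.
Context {R : realType}.
Local Notation RT := (measurableTypeR R).
Implicit Types (f : R -> R).

Definition grid (m : nat) (l : 'I_m.+1) : R := l%:R / m%:R.

Lemma grid_unit m (l : 'I_m.+1) : (0 < m)%N -> unit_itv (grid l).
Proof.
move=> m0; rewrite unit_itvE /grid divr_ge0 //= ler_pdivrMr ?ltr0n // mul1r ler_nat.
by rewrite -ltnS.
Qed.

Lemma grid_inj m : (0 < m)%N -> injective (@grid m).
Proof.
move=> m0 i j; rewrite /grid => /(divIf _) e; apply: val_inj; apply/eqP.
by rewrite -(eqr_nat R) e // pnatr_eq0 -lt0n.
Qed.

Lemma grid_neighbours (m k : nat) (x : R) : (0 < m)%N -> (k <= m.+1)%N -> unit_itv x ->
  (k <= #|[set l : 'I_m.+1 | (`|x - grid l| <= k%:R / m%:R)%R]%SET|)%N.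
Proof.
move=> m0 km; rewrite unit_itvE => /andP[x0 x1].
have m0' : (0 : R) < m%:R by rewrite ltr0n.
have xm0 : 0 <= x * m%:R by rewrite mulr_ge0 // ltW.
have /andP[t1 t2] := truncn_itv xm0; set t := Num.truncn _ in t1 t2.
have tm : (t <= m)%N by rewrite -(ler_nat R) (le_trans t1) // ger_pMl.
(* The window consists of k consecutive indices ending at the truncation t of x m. The truncated
   subtraction starts it at 0 when t + 1 < k. *)
pose b := (t.+1 - k)%N.
have bP (j : 'I_k) : (b + j < m.+1)%N by rewrite /b; have := ltn_ord j; lia.
pose F (j : 'I_k) : 'I_m.+1 := Ordinal (bP j).
have FI : injective F by move=> i j /(congr1 val) /= /addnI /val_inj.
rewrite -[X in (X <= _)%N]card_ord -(card_imset _ FI); apply: subset_leq_card.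
apply/fintype.subsetP => _ /imsetP[j _ ->]; rewrite inE /grid /=.
rewrite -[X in `|X|](mulfK (lt0r_neq0 m0')) normrM normfV (gtr0_norm m0').
rewrite ler_pM2r ?invr_gt0 // mulrBl mulfVK ?gt_eqF // ler_norml.
have jk := ltn_ord j.
have b1 : (b + j)%:R <= t%:R + k%:R :> R by rewrite -natrD ler_nat /b; lia.
have b2 : t.+1%:R <= (b + j)%:R + k%:R :> R by rewrite -natrD ler_nat /b; lia.
by apply/andP; split; lra.
Qed.

(** The radius a captures as many grid points as there are nonzeros plus q, so at least q zeros lie
    within a of x. If the grid has too few points for this, then a >= 1 and the bound is trivial. *)
Lemma grid_nonzero_count q (A x a : R) f m : (0 < m)%N -> (0 < q)%N -> unit_itv x ->
  0 <= A -> `|f x| <= 1 ->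
  (forall (Z : {set 'I_m.+1}), (q <= #|Z|)%N ->
    (forall l, l \in Z -> f (grid l) = 0 /\ `|x - grid l| <= a) -> `|f x| <= A) ->
  a = (#|[set l : 'I_m.+1 | f (grid l) != 0]%SET| + q)%:R / m%:R ->
  (1 <= a -> 1 <= A) -> `|f x| <= A.
Proof.
move=> m0 q0 ux A0 fx1 zer aE a1.
set nz := #|_| in aE.
have [km|mk] := leqP (nz + q) m.+1; last first.
  apply: (le_trans fx1); apply: a1.
  by rewrite aE ler_pdivlMr ?ltr0n // mul1r ler_nat; lia.
have := grid_neighbours m0 km ux; rewrite -aE => cN.
set N := [set l : 'I_m.+1 | _]%SET in cN.
apply: (zer (N :\: [set l : 'I_m.+1 | f (grid l) != 0])%SET).
  rewrite -(leq_add2l nz) (leq_trans cN) //.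
  rewrite -(cardsID [set l : 'I_m.+1 | f (grid l) != 0]%SET N) leq_add2r.
  exact/subset_leq_card/subsetIr.
by move=> l; rewrite !inE negbK => /andP[/eqP].
Qed.

(** Here r zeros within a <= 1 give |f x| <= M a^r / r! <= a^r <= a. *)
Lemma grid_nonzero_small r (M : R) f m x : (0 < r)%N -> 0 < M -> M <= r`!%:R ->
  factor_class r M f -> (0 < m)%N -> unit_itv x ->
  `|f x| <= (#|[set l : 'I_m.+1 | f (grid l) != 0]%SET| + r)%:R / m%:R.
Proof.
move=> r0 M0 Mr ff m0 ux.
set a := _ / _.
have a0 : 0 <= a by rewrite divr_ge0.
have f1 := factor_norm_le1 ff ux.
apply: (@grid_nonzero_count r a x a f m) => // Z rZ hZ.
have [a1|/ltW a1] := leP 1 a; first exact: le_trans a1.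
have H : `|f x| <= M / r`!%:R * a ^+ r.
  apply: (factor_many_zeros (Z := Z) (pt := @grid m)) => //.
  - exact: ltW.
  - by move=> i j _ _; exact: grid_inj.
  - by move=> s /hZ[]; split => //; exact: grid_unit.
apply: (le_trans H).
have fact0 : (0 : R) < r`!%:R by rewrite ltr0n fact_gt0.
rewrite -[leRHS]mul1r; apply: ler_pM.
- by rewrite divr_ge0 // ltW.
- by rewrite exprn_ge0.
- by rewrite ler_pdivrMr // mul1r.
- by rewrite -[leRHS]expr1 ler_wiXn2l.
Qed.

Lemma grid_nonzero_lipschitz r (M K : R) f m x : 1 <= K ->
  (forall f, factor_class r M f -> forall x y, unit_itv x -> unit_itv y ->
    `|f x - f y| <= K * `|x - y|) ->
  factor_class r M f -> (0 < m)%N -> unit_itv x ->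
  `|f x| <= K * ((#|[set l : 'I_m.+1 | f (grid l) != 0]%SET| + 1)%:R / m%:R).
Proof.
move=> K1 lipK ff m0 ux.
set a := _ / _.
have a0 : 0 <= a by rewrite divr_ge0.
have K0 : 0 <= K by rewrite (le_trans ler01).
have f1 := factor_norm_le1 ff ux.
apply: (@grid_nonzero_count 1 (K * a) x a f m) => // [|Z Z1 hZ|a1].
- by rewrite mulr_ge0.
- have /card_gt0P[l /hZ[fl xl]] := Z1.
  have := lipK _ ff _ _ ux (grid_unit l m0); rewrite fl subr0 => /le_trans; apply.
  by rewrite ler_wpM2l.
- by rewrite (le_trans a1) // ler_peMl.
Qed.

Lemma le_of_eq (x y : R) : x = y -> x <= y.
Proof. by move=> ->. Qed.

Lemma bernoulli (x : R) n : 0 <= x <= 1 -> 1 - n%:R * x <= (1 - x) ^+ n.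
Proof.
move=> /andP[x0 x1]; elim: n => [|n IH]; first by rewrite mul0r subr0 expr0.
rewrite exprS -natr1.
have h : 0 <= 1 - x by rewrite subr_ge0.
apply: le_trans (ler_wpM2l h IH).
have : 0 <= n%:R * x ^+ 2 by rewrite mulr_ge0 // sqr_ge0.
lra.
Qed.

Lemma prod_ge_factor d (u : 'I_d -> R) (j : 'I_d) : (forall i, 0 <= u i <= 1) ->
  \prod_i u i <= u j.
Proof.
move=> u01; rewrite (bigD1 j) //= ler_piMr //; first by have /andP[] := u01 j.
by apply: prodr_ile1 => i _; exact: u01.
Qed.

(** The successor makes the value positive, and an upper bound of negative x as well. *)
Definition nat_above (x : R) : nat := (Num.truncn x).+1.

Lemma nat_above_ge x : x <= (nat_above x)%:R.
Proof.
have [x0|/ltW x0] := leP 0 x; last by rewrite (le_trans x0).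
by have /andP[_ /ltW] := truncn_itv x0.
Qed.

Lemma nat_above_le x : 0 <= x -> (nat_above x)%:R <= x + 1.
Proof. by move=> x0; rewrite -natr1 lerD2r; have /andP[] := truncn_itv x0. Qed.

(** On a fine grid, each factor of absolute value u is nonzero on a fraction at least u (1 - 1 / (2
    d)) of the points. By Bernoulli's inequality the product loses at most a factor 2, and eps / 2
    becomes p = eps / 4. *)
Lemma complexity_small_bound r (M : R) : (0 < r)%N -> 0 < M -> M <= r`!%:R ->
  exists2 C : R, 0 < C & forall eps d, 0 < eps < 1 -> (0 < d)%N ->
    (complexity r M eps d <= (C * (eps^-1) ^+ 3 * d%:R ^+ 4)%:E)%E.
Proof.
move=> r0 M0 Mr; have [K K1 lipK] := factor_lipschitz r0 (ltW M0).
have K0 : 0 < K by rewrite (lt_le_trans ltr01).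
pose c1 : R := 4 * r.+2%:R + 2. pose c2 : R := 2 * K + 1.
pose C : R := (4 * c1 + 1) * (c2 + 2).
have c10 : 0 < c1 by rewrite addr_gt0 // mulr_gt0 // ltr0n.
have c20 : 0 < c2 by rewrite addr_gt0 // mulr_gt0.
exists C => [|eps d /andP[eps0 eps1] d0].
  by rewrite mulr_gt0 // addr_gt0 // mulr_gt0.
set e := eps^-1; have e1 : 1 <= e by rewrite invf_ge1 // ltW.
have e0 : 0 < e by rewrite (lt_le_trans ltr01).
have ee : eps * e = 1 by rewrite mulfV // gt_eqF.
set D : R := d%:R; have D1 : 1 <= D by rewrite ler1n.
have D0 : 0 < D by rewrite (lt_le_trans ltr01).
have eD1 : 1 <= e * D by rewrite -[leLHS]mulr1 ler_pM.
(* For u > eps / 2 this gives r + 2 <= u m1 / (2 d). The r pays for the error of the count in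
   [grid_nonzero_small], and the 2 for passing from m1 to the m1 + 1 points of the grid. *)
pose m1 := nat_above (4 * r.+2%:R * e * D).
pose m2 := nat_above (2 * K * e * D).
pose p : R := eps / 4.
pose n := nat_above (m1.+1%:R * D / p).
have m1le : m1.+1%:R <= c1 * (e * D).
  rewrite -natr1; have : m1%:R <= 4 * r.+2%:R * e * D + 1.
    by apply: nat_above_le; rewrite !mulr_ge0 // ltW.
  rewrite /c1; move: eD1; set X := e * D; set Y := r.+2%:R => eD1.
  have -> : 4 * Y * e * D = 4 * Y * X by rewrite /X; ring.
  by lra.
have m2le : m2%:R <= c2 * (e * D).
  have : m2%:R <= 2 * K * e * D + 1.
    by apply: nat_above_le; rewrite !mulr_ge0 // ltW.
  rewrite /c2; move: eD1; set X := e * D => eD1.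
  have -> : 2 * K * e * D = 2 * K * X by rewrite /X; ring.
  by lra.
have p01 : 0 < p <= 1 by rewrite /p; lra.
have pV : p^-1 = 4 * e by rewrite /p invfM invrK mulrC.
have nle : n%:R <= (4 * c1 + 1) * (e ^+ 2 * D ^+ 2).
  have : n%:R <= m1.+1%:R * D / p + 1.
    by apply: nat_above_le; rewrite divr_ge0 ?mulr_ge0 // ltW //; case/andP: p01.
  move=> /le_trans; apply; rewrite pV.
  apply: (@le_trans _ _ (c1 * (e * D) * D * (4 * e) + 1)).
    by rewrite lerD2r ler_pM2r ?mulr_gt0 // ler_pM2r.
  rewrite [leRHS]mulrDl mul1r; apply: lerD; last first.
    by rewrite -exprMn -[leLHS](expr1n _ 2) lerXn2r // nnegrE ltW // mulr_gt0.
  by apply: le_of_eq; ring.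
have total : (n * (d * m2.+1).+1)%:R <= C * e ^+ 3 * D ^+ 4.
  have h2 : (d * m2.+1).+1%:R <= (c2 + 2) * (e * D ^+ 2).
    rewrite -natr1 natrM -natr1 -/D.
    have h3 : D * (m2%:R + 1) <= D * (c2 * (e * D) + 1).
      by rewrite ler_pM2l // lerD2r.
    have : D <= e * D ^+ 2.
      by rewrite expr2 mulrA -[leLHS]mul1r ler_pM2r.
    have : 1 <= e * D ^+ 2.
      by rewrite expr2 mulrA -[leLHS]mulr1 ler_pM // ?mulr_ge0 // ltW.
    have -> : (c2 + 2) * (e * D ^+ 2) = D * (c2 * (e * D)) + 2 * (e * D ^+ 2) by ring.
    lra.
  rewrite natrM; apply: le_trans (ler_pM _ _ nle h2) _ => //.
  by apply: le_of_eq; rewrite /C; ring.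
move: total; rewrite -lee_fin; apply: le_trans.
apply: (@complexity_le_hitting _ r M K eps p d _ (@grid m1) n m2) => //.
- by move=> s; exact: grid_unit.
- move=> g x gF cx ux.
  pose u i := `|g i (tnth x i)|.
  have u01 i : 0 <= u i <= 1.
    by rewrite normr_ge0 /=; exact: factor_norm_le1 (gF i) (cx i).
  have ue i : eps / 2 < u i by apply: lt_le_trans (prod_ge_factor _ u01).
  pose w : R := 1 - (2 * D)^-1.
  have w0 : 0 <= (2 * D)^-1 <= 1.
    by rewrite invr_ge0 mulr_ge0 ?(ltW D0) //= invf_le1 ?mulr_gt0 //; lra.
  apply: (@le_trans _ _ (\prod_i (u i * w))).
    rewrite big_split prodr_const card_ord /=.
    have : 1/2 <= w ^+ d.
      apply: le_trans (bernoulli _ w0); rewrite -/D invfM mulrCA divff ?gt_eqF //.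
      lra.
    move: ux; rewrite -[\prod_i `|_|]/(\prod_i u i) => ux wd.
    have -> : p = eps / 2 * (1/2) by rewrite /p; field.
    by apply: ler_pM => //; [rewrite divr_ge0 // ltW|exact: ltW].
  apply: ler_prod => i _; rewrite mulr_ge0 /=; last 2 first.
  - by case/andP: (u01 i).
  - by rewrite subr_ge0; case/andP: w0.
  rewrite card_ord ler_pdivlMr ?ltr0n //.
  have := grid_nonzero_small r0 M0 Mr (gF i) (ltn0Sn (Num.truncn (4 * r.+2%:R * e * D)) : (0 < m1)%N) (cx i).
  rewrite -/(u i) ler_pdivlMr ?ltr0n // natrD.
  set nz := #|_|%:R => unz.
  have m1ge : 4 * r.+2%:R * e * D <= m1%:R by exact: nat_above_ge.
  have uw : u i * w = u i - u i / (2 * D) by rewrite /w; ring.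
  have : r.+2%:R * (2 * D) <= u i * m1%:R.
    apply: le_trans (ler_pM _ _ (ltW (ue i)) m1ge); last 2 first.
    + by rewrite divr_ge0 // ltW.
    + by rewrite !mulr_ge0 // ltW.
    by apply: le_of_eq; transitivity (eps * e * (r.+2%:R * (2 * D))); [rewrite ee mul1r|field].
  have /andP[ui0 ui1] := u01 i.
  move=> h; set v := u i / (2 * D) in uw.
  have v0 : 0 <= v by rewrite divr_ge0 // mulr_ge0 // ltW.
  have h' : r.+2%:R <= v * m1%:R.
    have -> : v * m1%:R = u i * m1%:R / (2 * D) by rewrite /v; ring.
    by rewrite ler_pdivlMr // mulr_gt0.
  have E1 : m1.+1%:R = m1%:R + 1 :> R by rewrite natr1.
  have E2 : r.+2%:R = r%:R + 2 :> R by rewrite -natrD addn2.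
  move: unz h'; rewrite uw E1 E2; move: (m1%:R : R) => mm; lra.
- by rewrite card_ord.
- rewrite card_ord natrM -/D -ler_pdivrMr; last by case/andP: p01.
  exact: nat_above_ge.
- have : 2 * K * e * D <= m2%:R by exact: nat_above_ge.
  rewrite -(ler_pM2l eps0); apply: le_trans; apply: le_of_eq.
  by transitivity (eps * e * (2 * K * D)); [rewrite ee mul1r|ring].
Qed.

End Tractability.

(** * Weighted sampling and the quasi-polynomial bound for M < 2^r r! *)

Section QuasiPolynomial.
Context {R : realType}.
Local Notation RT := (measurableTypeR R).
Implicit Types (f : R -> R).

Lemma exp1D_le (y : R) n : 0 <= y <= 1 -> (1 + y) ^+ n <= 1 + 3 ^+ n * y.
Proof.
move=> /andP[y0 y1]; elim: n => [|n IH]; first by rewrite !expr0 mul1r lerDl.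
have t0 : (1 : R) <= 3 ^+ n by rewrite exprn_ege1 //; lra.
have h : 0 <= 1 + y by lra.
rewrite !exprS; apply: le_trans (ler_wpM2l h IH) _.
set T := 3 ^+ n in t0 *.
have : T * y * y <= T * y by rewrite ler_piMr // mulr_ge0 // (le_trans ler01).
have : y <= T * y by rewrite ler_peMl.
lra.
Qed.

(** At a = 1/2 the left side is theta = M / (2^r r!) < 1, so a slightly larger radius keeps it below
    the midpoint of theta and 1. *)
Lemma ball_radius r (M : R) : (0 < r)%N -> 0 < M -> M < (2 ^ r * r`!)%:R ->
  exists a beta : R, [/\ 1 / 2 <= a <= 1, 1 / 2 < a, 0 < beta < 1 & M / r`!%:R * a ^+ r <= beta].
Proof.
move=> r0 M0 M2.
have fact0 : (0 : R) < r`!%:R by rewrite ltr0n fact_gt0.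
pose theta := M / r`!%:R / 2 ^+ r.
have two0 : (0 : R) < 2 ^+ r by rewrite exprn_gt0.
have theta0 : 0 < theta by rewrite !divr_gt0.
have theta1 : theta < 1.
  by rewrite /theta ltr_pdivrMr // mul1r ltr_pdivrMr // -natrX -natrM.
have three0 : (1 : R) <= 3 ^+ r by rewrite exprn_ege1 //; lra.
(* Chosen so that the error term 3^r y of [exp1D_le] equals (1 - theta) / 2. *)
pose y := (1 - theta) / (2 * 3 ^+ r).
have y0 : 0 < y by rewrite divr_gt0 ?subr_gt0 // mulr_gt0 //; lra.
have y1 : y <= 1.
  by rewrite ler_pdivrMr; [lra|rewrite mulr_gt0 //; lra].
exists ((1 + y) / 2), ((1 + theta) / 2); split; [lra|lra|lra|].
have -> : M / r`!%:R * ((1 + y) / 2) ^+ r = theta * (1 + y) ^+ r.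
  by rewrite exprMn exprVn /theta; ring.
have y01 : 0 <= y <= 1 by lra.
apply: le_trans (ler_wpM2l (ltW theta0) (exp1D_le r y01)) _.
have -> : 3 ^+ r * y = (1 - theta) / 2 by rewrite /y; field; lra.
have : theta * ((1 - theta) / 2) <= (1 - theta) / 2 by rewrite ler_piMl //; lra.
lra.
Qed.

Lemma card_set_pair (A B : finType) (P : A -> B -> bool) :
  #|[set s : A * B | P s.1 s.2]%SET| = (\sum_a #|[set b | P a b]%SET|)%N.
Proof.
rewrite -sum1_card (eq_bigl (fun s => true && P s.1 s.2)) => [|s]; last by rewrite inE.
rewrite -(pair_big_dep xpredT P (fun _ _ => 1%N)) /=.
by apply: eq_bigr => a _; rewrite -sum1_card; apply: eq_bigl => b; rewrite inE.
Qed.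

Lemma powR_prodl (I : Type) (s : seq I) (u : I -> R) (t : R) : (forall i, 0 <= u i) ->
  (\prod_(i <- s) u i) `^ t = \prod_(i <- s) (u i) `^ t.
Proof.
move=> u0; elim: s => [|i s IH]; first by rewrite !big_nil powR1.
by rewrite !big_cons powRM ?IH // prodr_ge0.
Qed.

(* Sampling points: a fraction 1 / (4 d) of them is spread over [0, 1], the remaining ones
   are near 1/2, where a factor of norm close to 1 has fewer than r zeros. *)
Definition weighted_points d m (a : R) (s : 'I_(4 * d) * 'I_m.+1) : R :=
  if s.1 == 0%N :> nat then grid s.2 else 1 / 2 + (a - 1 / 2) * grid s.2.

Lemma scale_unit (b g : R) : 0 <= b -> unit_itv g -> 0 <= b * g <= b.
Proof. by rewrite unit_itvE => b0 /andP[g0 g1]; rewrite mulr_ge0 //= ler_piMr. Qed.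

(** Points of [1/2, a] are within a of 0 and within 1/2 of 1, hence within a of all of [0, 1]. *)
Lemma dist_upper_half (x a t : R) : unit_itv x -> 1 / 2 <= a -> 0 <= t <= a - 1 / 2 ->
  `|x - (1 / 2 + t)| <= a.
Proof. by rewrite unit_itvE ler_norml; lra. Qed.

Lemma powR_le1 (x t : R) : 0 <= x <= 1 -> 0 <= t -> x `^ t <= 1.
Proof.
move=> /andP[x0 x1] t0; have <- : 1 `^ t = 1 :> R by rewrite powR1.
by rewrite ge0_ler_powR ?nnegrE.
Qed.

Lemma weighted_points_unit d m (a : R) s : (0 < m)%N -> 1 / 2 <= a <= 1 ->
  unit_itv (@weighted_points d m a s).
Proof.
move=> m0 a1; rewrite /weighted_points; have g01 := @grid_unit R _ s.2 m0.
case: ifP => // _; have a12 : 0 <= a - 1 / 2 by lra.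
by have := scale_unit a12 g01; rewrite unit_itvE; lra.
Qed.

Lemma weighted_fractionE d m a f :
  #|[set s | f (@weighted_points d m a s) != 0]%SET|%:R /
    #|{: 'I_(4 * d) * 'I_m.+1}|%:R =
  (\sum_(c < 4 * d) #|[set l : 'I_m.+1 | f (weighted_points a (c, l)) != 0%R]%SET|)%N%:R /
    (4 * d%:R * m.+1%:R) :> R.
Proof.
rewrite card_prod !card_ord !natrM; congr (_%:R / _).
rewrite -(card_set_pair (fun c l => f (weighted_points a (c, l)) != 0)).
by apply: eq_card => -[c l]; rewrite !inE.
Qed.

(** In each of the 4 d - 1 central blocks, r zeros within a of x would force |f x| <= beta. So fewer
    than r points per block are lost; together with the uniform block this is at most 1 / (4 d) + r
    / (m + 1) <= 1 / (2 d) of all points. *)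
Lemma weighted_fraction_large r (M : R) d m (a beta : R) f x : 0 < M -> (0 < d)%N -> (0 < m)%N ->
  1 / 2 < a -> a <= 1 -> M / r`!%:R * a ^+ r <= beta ->
  factor_class r M f -> unit_itv x -> beta < `|f x| -> 4 * r%:R * d%:R <= m.+1%:R :> R ->
  1 - (2 * d%:R : R)^-1 <= #|[set s | f (@weighted_points d m a s) != 0]%SET|%:R /
    #|{: 'I_(4 * d) * 'I_m.+1}|%:R.
Proof.
move=> M0 d0 m0 a2 a1 Mbeta ff ux fx rm; rewrite weighted_fractionE.
set cnt := fun c : 'I_(4 * d) => #|[set l : 'I_m.+1 | f (weighted_points a (c, l)) != 0]%SET|.
have D1 : (1 : R) <= d%:R by rewrite ler1n.
have den0 : (0 : R) < 4 * d%:R * m.+1%:R by rewrite !mulr_gt0 ?ltr0n.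
have few (c : 'I_(4 * d)) : (c != 0%N :> nat) -> (m.+1 - r <= cnt c)%N.
  move=> c0; rewrite /cnt; set N := [set l | _]%SET.
  have wE l : weighted_points a (c, l) = 1 / 2 + (a - 1 / 2) * grid l.
    by rewrite /weighted_points /= (negbTE c0).
  have : (#|~: N| < r)%N.
    rewrite ltnNge; apply/negP => rN; have := fx; apply/negP; rewrite -leNgt.
    apply: le_trans Mbeta.
    apply: (factor_many_zeros (Z := (~: N)%SET) (pt := fun l => weighted_points a (c, l))) => //.
    - exact: ltW.
    - move=> i j _ _; rewrite !wE => /addrI /mulfI H; apply: (grid_inj m0).
      by apply: H; rewrite subr_eq0 gt_eqF.
    - move=> l; rewrite !inE negbK => /eqP fl; split => //.
        by apply: (weighted_points_unit (c, l)) => //; rewrite a1 ltW.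
      rewrite wE; apply: dist_upper_half => //; first exact: ltW.
      by apply: scale_unit; [rewrite subr_ge0 ltW|exact: grid_unit].
  have := cardsC N; rewrite card_ord; set n1 := #|N|; set n2 := #|(~: N)%SET|.
  by move: n1 n2 => n1 n2 <- h; rewrite leq_subLR addnC leq_add2r ltnW.
rewrite ler_pdivlMr //.
have : ((4 * d).-1 * (m.+1 - r) <= \sum_c cnt c)%N.
  have d4 : (0 < 4 * d)%N by rewrite muln_gt0.
  rewrite (bigD1 (Ordinal d4)) //= (leq_trans _ (leq_addl _ _)) //.
  rewrite -[X in (X.-1 * _)%N]card_ord -(cardC1 (Ordinal d4)) -sum_nat_const.
  by apply: leq_sum => c; rewrite inE => c0; apply: few.
rewrite -(ler_nat R); apply: le_trans.
have rm' : (r <= m.+1)%N.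
  by rewrite -(ler_nat R) (le_trans _ rm) // mulrAC ler_peMl //; lra.
rewrite natrM natrB // -subn1 natrB ?muln_gt0 // natrM.
move: rm; set D : R := d%:R in D1 *; move: (m.+1%:R : R) => mm rm.
have -> : (1 - (2 * D)^-1) * (4 * D * mm) = 4 * D * mm - 2 * mm.
  by field; lra.
have r0' : (0 : R) <= r%:R by [].
lra.
Qed.

(** Only the uniform block is counted, which is 1 / (4 d) of the points. One zero near x bounds |f
    x|, so about u / K of this block is nonzero; the lower bound on m absorbs the rounding into a
    factor 2. *)
Lemma weighted_fraction_lipschitz r (M K : R) d m a f x u : (0 < d)%N -> (0 < m)%N -> 1 <= K ->
  (forall f, factor_class r M f -> forall x y, unit_itv x -> unit_itv y ->
    `|f x - f y| <= K * `|x - y|) ->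
  factor_class r M f -> unit_itv x -> 0 < u -> u <= `|f x| -> 2 * K / u + 1 <= m%:R ->
  u / (8 * K * d%:R) <= #|[set s | f (@weighted_points d m a s) != 0]%SET|%:R /
    #|{: 'I_(4 * d) * 'I_m.+1}|%:R.
Proof.
move=> d0 m0 K1 lipK ff ux u0 ufx um; have K0 : 0 < K by rewrite (lt_le_trans ltr01).
rewrite weighted_fractionE.
have D0 : (0 : R) < d%:R by rewrite ltr0n.
have d4 : (0 < 4 * d)%N by rewrite muln_gt0.
have den0 : (0 : R) < 4 * d%:R * m.+1%:R by rewrite !mulr_gt0 ?ltr0n.
rewrite ler_pdivlMr //.
apply: (@le_trans _ _ (#|[set l : 'I_m.+1 | f (grid l) != 0]%SET|)%:R); last first.
  by rewrite ler_nat (bigD1 (Ordinal d4)) //= leq_addr.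
have := grid_nonzero_lipschitz K1 lipK ff m0 ux.
set nz := #|_|; rewrite natrD => h.
have m1 : (0 : R) < m%:R by rewrite ltr0n.
have : u * m%:R <= K * (nz%:R + 1).
  by rewrite -ler_pdivlMr // -mulrA; exact: le_trans ufx h.
have -> : u / (8 * K * d%:R) * (4 * d%:R * m.+1%:R) = u * (m%:R + 1) / (2 * K).
  by rewrite -[m.+1%:R]natr1; field; rewrite !gt_eqF.
rewrite ler_pdivrMr ?mulr_gt0 //.
have : (2 * K / u + 1) * u <= m%:R * u by rewrite ler_pM2r.
have -> : (2 * K / u + 1) * u = 2 * K + u by field; rewrite gt_eqF.
lra.
Qed.

(** A factor with u > beta has nonzero fraction at least 1 - 1 / (2 d), any other at least u / (8 K
    d) >= u^(1 + tau). In both cases u^(1 + tau) (1 - 1 / (2 d)) is a lower bound, and the product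
    is at least p. *)
Lemma quasi_polynomial r (M : R) : (0 < r)%N -> 0 < M -> M < (2 ^ r * r`!)%:R ->
  quasi_polynomially_tractable r M.
Proof.
move=> r0 M0 M2; have [K K1 lipK] := factor_lipschitz r0 (ltW M0).
have [a [beta [a1 a2 /andP[beta0 beta1] Mbeta]]] := ball_radius r0 M0 M2.
have K0 : 0 < K by rewrite (lt_le_trans ltr01).
pose lam := ln beta^-1.
have lam0 : 0 < lam by rewrite ln_gt0 // invf_gt1.
have lnK0 : 0 <= ln (8 * K) by rewrite ln_ge0 //; lra.
(* Makes 1 + tau <= kappa (1 + ln d); the 5 added to kappa below covers the powers e^2 d^5 in the
   cost. *)
pose kappa := 1 + (ln (8 * K) + 1) / lam.
have kappa0 : 0 < kappa by rewrite addr_gt0 // divr_gt0 //; lra.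
pose c1 := 4 * r%:R + 4 * K + 3.
have c10 : 0 < c1 by rewrite ltr_wpDl // addr_ge0 // mulr_ge0 // ltW.
pose c2 := 2 * K + 1. have c20 : 0 < c2 by rewrite addr_gt0 // mulr_gt0.
pose C := (4 * c1 + 1) * (c2 + 2) * 2.
have C0 : 0 < C by rewrite !mulr_gt0 // addr_gt0 // mulr_gt0.
exists C, (5 + kappa); split => //; first by rewrite addr_gt0.
move=> eps d /andP[eps0 eps1] d0.
set e := eps^-1; have e1 : 1 <= e by rewrite invf_ge1 // ltW.
have e0 : 0 < e by rewrite (lt_le_trans ltr01).
have ee : eps * e = 1 by rewrite mulfV // gt_eqF.
set D : R := d%:R; have D1 : 1 <= D by rewrite ler1n.
have D0 : 0 < D by rewrite (lt_le_trans ltr01).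
have eD1 : 1 <= e * D by rewrite -[leLHS]mulr1 ler_pM.
set A := ln e; set b := ln D.
have A0 : 0 <= A by rewrite ln_ge0.
have b0 : 0 <= b by rewrite ln_ge0.
(* The solution of beta^tau = 1 / (8 K d), so that u <= beta implies u^(1 + tau) <= u / (8 K d). *)
pose tau := (ln (8 * K) + b) / lam.
have tau0 : 0 <= tau by rewrite divr_ge0 ?addr_ge0 // ltW.
have betatau : beta `^ tau = (8 * K * D)^-1.
  rewrite /powR gt_eqF // -[ln beta]opprK -lnV ?posrE // -/lam mulrN /tau mulfVK ?gt_eqF //.
  by rewrite expRN -lnM ?posrE ?mulr_gt0 // lnK // posrE !mulr_gt0.
pose p := (eps / 2) `^ (1 + tau) / 2.
have p0 : 0 < p by rewrite divr_gt0 // powR_gt0 // divr_gt0.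
have p1 : p <= 1.
  have : (eps / 2) `^ (1 + tau) <= 1.
    by apply: powR_le1; lra.
  by rewrite /p; lra.
have pV : p^-1 = 2 * expR ((1 + tau) * (ln 2 + A)).
  rewrite /p invfM invrK mulrC; congr (_ * _).
  rewrite /powR gt_eqF ?divr_gt0 // -expRN -mulrN; congr (expR (_ * _)).
  by rewrite -lnV ?posrE ?divr_gt0 // invf_div lnM ?posrE ?invr_gt0.
(* The term in r and D serves [weighted_fraction_large]. The rest serves
   [weighted_fraction_lipschitz], since 1 / u < 2 e. *)
pose m1 := nat_above (4 * r%:R * D + 4 * K * e + 1).
pose m2 := nat_above (2 * K * e * D).
pose n := nat_above (4 * D * m1.+1%:R * D / p).
have m1le : m1.+1%:R <= c1 * (e * D).
  rewrite -[m1.+1%:R]natr1; have : m1%:R <= 4 * r%:R * D + 4 * K * e + 1 + 1.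
    by apply: nat_above_le; rewrite !addr_ge0 // !mulr_ge0 // ltW.
  have : r%:R * D <= r%:R * (e * D) by rewrite ler_wpM2l // ler_peMl // ltW.
  have : K * e <= K * (e * D) by rewrite ler_wpM2l ?ler_peMr // ltW.
  rewrite /c1; lra.
have m2le : m2%:R <= c2 * (e * D).
  have : m2%:R <= 2 * K * e * D + 1.
    by apply: nat_above_le; rewrite !mulr_ge0 // ltW.
  rewrite /c2; have -> : 2 * K * e * D = 2 * K * (e * D) by ring.
  by lra.
have pV1 : 1 <= p^-1 by rewrite invf_ge1.
have nle : n%:R <= (4 * c1 + 1) * (e * D ^+ 3 / p).
  have : n%:R <= 4 * D * m1.+1%:R * D / p + 1.
    by apply: nat_above_le; rewrite divr_ge0 ?(ltW p0) // !mulr_ge0 // ltW.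
  move=> /le_trans; apply.
  rewrite [leRHS]mulrDl mul1r; apply: lerD; last first.
    have : 1 <= e * D ^+ 3 by rewrite -[leLHS]mulr1 ler_pM // exprn_ege1.
    by move=> h; rewrite -[leLHS]mulr1 ler_pM.
  have -> : 4 * c1 * (e * D ^+ 3 / p) = 4 * D * (c1 * (e * D)) * D / p by ring.
  by rewrite ler_pM2r ?invr_gt0 // ler_pM2r // ler_pM2l // mulr_gt0.
have total : (n * (d * m2.+1).+1)%:R <= C * (e ^+ 2 * D ^+ 5 * expR ((1 + tau) * (ln 2 + A))).
  have h2 : (d * m2.+1).+1%:R <= (c2 + 2) * (e * D ^+ 2).
    rewrite -natr1 natrM -natr1 -/D.
    have h3 : D * (m2%:R + 1) <= D * (c2 * (e * D) + 1).
      by rewrite ler_pM2l // lerD2r.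
    have : D <= e * D ^+ 2.
      by rewrite expr2 mulrA -[leLHS]mul1r ler_pM2r.
    have : 1 <= e * D ^+ 2.
      by rewrite expr2 mulrA -[leLHS]mulr1 ler_pM // ?mulr_ge0 // ltW.
    have -> : (c2 + 2) * (e * D ^+ 2) = D * (c2 * (e * D)) + 2 * (e * D ^+ 2) by ring.
    lra.
  rewrite natrM; apply: le_trans (ler_pM _ _ nle h2) _ => //.
  by apply: le_of_eq; rewrite pV /C; ring.
have expo : e ^+ 2 * D ^+ 5 * expR ((1 + tau) * (ln 2 + A)) <=
    expR ((5 + kappa) * (1 + A) * (1 + b)).
  rewrite -{1}(lnK (e0 : e \in Num.pos)) -{1}(lnK (D0 : D \in Num.pos)) -/A -/b.
  rewrite -!expRM_natl -!expRD ler_expR.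
  have tk : 1 + tau <= kappa * (1 + b).
    rewrite /kappa /tau.
    have -> : (ln (8 * K) + b) / lam = ln (8 * K) / lam + b / lam by ring.
    have -> : (1 + (ln (8 * K) + 1) / lam) * (1 + b) =
      1 + ln (8 * K) / lam + b / lam + (b + lam^-1 + ln (8 * K) / lam * b) by ring.
    have : 0 <= b + lam^-1 + ln (8 * K) / lam * b.
      by rewrite !addr_ge0 ?invr_ge0 ?mulr_ge0 ?invr_ge0 // ltW.
    lra.
  have ln2 : ln 2 <= 1 :> R.
    by have := @le_ln1Dx R 1; rewrite -[1 + 1]/(2%:R) => -> //; lra.
  have ln20 : 0 <= ln 2 :> R by rewrite ln_ge0 //; lra.
  have h1 : (1 + tau) * (ln 2 + A) <= kappa * (1 + b) * (1 + A).
    by apply: ler_pM => //; rewrite ?addr_ge0 // lerD2r.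
  have h2 : 2 * A + 5 * b <= 5 * (1 + A) * (1 + b).
    have : 0 <= A * b by exact: mulr_ge0.
    lra.
  have -> : (5 + kappa) * (1 + A) * (1 + b) =
    5 * (1 + A) * (1 + b) + kappa * (1 + b) * (1 + A) by ring.
  exact: lerD.
have := ler_wpM2l (ltW C0) expo; rewrite -lee_fin; apply: le_trans.
move: total; rewrite -lee_fin; apply: le_trans.
have m10 : (0 < m1)%N by [].
have m1ge : 4 * r%:R * D + 4 * K * e + 1 <= m1%:R by exact: nat_above_ge.
apply: (@complexity_le_hitting _ r M K eps p d _ (@weighted_points d m1 a) n m2) => //.
- by rewrite p0.
- by move=> s; exact: weighted_points_unit.
- move=> g x gF cx gx.
  pose u i := `|g i (tnth x i)|.
  have u01 i : 0 <= u i <= 1.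
    by rewrite normr_ge0 /=; exact: factor_norm_le1 (gF i) (cx i).
  have ue i : eps / 2 < u i by apply: lt_le_trans (prod_ge_factor _ u01).
  pose w : R := 1 - (2 * D)^-1.
  have w0 : 0 <= (2 * D)^-1 <= 1.
    by rewrite invr_ge0 mulr_ge0 ?(ltW D0) //= invf_le1 ?mulr_gt0 //; lra.
  apply: (@le_trans _ _ (\prod_i (u i `^ (1 + tau) * w))).
    rewrite big_split prodr_const card_ord /= -powR_prodl; last by move=> i; case/andP: (u01 i).
    have wd : 1/2 <= w ^+ d.
      apply: le_trans (bernoulli _ w0); rewrite -/D invfM mulrCA divff ?gt_eqF //.
      lra.
    have -> : p = (eps / 2) `^ (1 + tau) * (1 / 2) by rewrite /p mul1r.
    apply: ler_pM => //; first exact: powR_ge0.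
    apply: ge0_ler_powR; rewrite ?nnegrE.
    - by rewrite addr_ge0.
    - by rewrite divr_ge0 // ltW.
    - by apply: prodr_ge0 => i _; case/andP: (u01 i).
    - exact: ltW.
  apply: ler_prod => i _; have /andP[ui0 ui1] := u01 i.
  rewrite mulr_ge0 ?powR_ge0 ?subr_ge0 //=; last by case/andP: w0.
  have ui : 0 < u i by apply: lt_trans (ue i); rewrite divr_gt0.
  have [ub|bu] := leP (u i) beta.
  + apply: (@le_trans _ _ (u i / (8 * K * D))).
      rewrite -betatau -[leRHS]mulr1; apply: ler_pM; rewrite ?powR_ge0 //.
      * by rewrite subr_ge0; case/andP: w0.
      * have -> : u i `^ (1 + tau) = u i * u i `^ tau.
          by rewrite powRD ?powRr1 // (gt_eqF ui) implybT.
        rewrite ler_wpM2l //.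
        by rewrite ge0_ler_powR // nnegrE // ltW.
      * by rewrite /w gerBl; case/andP: w0.
    apply: (@weighted_fraction_lipschitz r M K d m1 a (g i) (tnth x i) (u i) d0 m10 K1 lipK (gF i) (cx i) ui (lexx _)).
    apply: le_trans m1ge; rewrite lerD2r.
    have : (u i)^-1 <= 2 * e.
      rewrite -[2 * e]invrK lef_pV2 ?posrE ?invr_gt0 ?mulr_gt0 //.
      by rewrite invfM /e invrK mulrC ltW.
    have : 0 <= 4 * r%:R * D by rewrite !mulr_ge0 // ltW.
    move=> h1 h2; have : 2 * K / u i <= 2 * K * (2 * e) by rewrite ler_wpM2l // mulr_ge0 // ltW.
    lra.
  + apply: (@le_trans _ _ w).
      rewrite ler_piMl ?subr_ge0 //; first by case/andP: w0.
      by apply: powR_le1 => //; lra.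
    have a3 : a <= 1 by case/andP: a1.
    apply: (weighted_fraction_large M0 d0 m10 a2 a3 Mbeta (gF i) (cx i) bu).
    rewrite -[m1.+1%:R]natr1; have : 0 <= 4 * K * e by rewrite !mulr_ge0 // ltW.
    lra.
- by rewrite card_prod !card_ord !muln_gt0 d0.
- rewrite card_prod !card_ord !natrM -/D -ler_pdivrMr //.
  exact: nat_above_ge.
- have : 2 * K * e * D <= m2%:R by exact: nat_above_ge.
  rewrite -(ler_pM2l eps0); apply: le_trans; apply: le_of_eq.
  by transitivity (eps * e * (2 * K * D)); [rewrite ee mul1r|ring].
Qed.

End QuasiPolynomial.

(** * Lower bounds *)

Section LowerBound.
Context {R : realType}.
Local Notation RT := (measurableTypeR R).
Local Notation leb := (@lebesgue_measure R).
Local Notation pow d := (power_measure leb d).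

Lemma measurable_box d (A : 'I_d -> set RT) : (forall i, measurable (A i)) ->
  measurable [set t : d.-tuple RT | forall i, A i (tnth t i)].
Proof.
move=> mA; rewrite (_ : [set _ | _] =
    \bigcap_(i in setT) ((@tnth d RT ^~ i) @^-1` A i)).
  apply: fin_bigcap_measurable => // i _.
  by rewrite -[X in measurable X]setTI; exact: measurable_tnth.
by apply/seteqP; split => t /= At i; [move=> _|]; exact: At.
Qed.

Lemma power_measure_setT_gt0 d : (0 < pow d [set: d.-tuple RT])%E.
Proof.
apply: (@lt_le_trans _ _ (pow d [set t | forall i, unit_itv (tnth t i)])).
  rewrite (@power_measureE _ _ _ leb d (fun=> unit_itv)); last first.
    by move=> i; exact: measurable_unit_itv.
  by rewrite big1 ?lte01 // => i _; exact: leb_unit_itv.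
apply: le_measure => //; rewrite inE //.
exact: (@measurable_box d (fun=> unit_itv) (fun=> measurable_unit_itv)).
Qed.

(** Both functions are continuous on the cube, so an excess over c at x persists on a box of
    positive measure. *)
Lemma rank_one_ae_le r (M c : R) d (f h : d.-tuple RT -> R) :
  rank_one r M f -> rank_one r M h ->
  {ae pow d, forall x, cube x -> `|f x - h x| <= c} ->
  forall x, cube x -> `|f x - h x| <= c.
Proof.
move=> [g gF fg] [k kF hk] [N [mN N0 sN]] x cx.
rewrite leNgt; apply/negP => cfh.
pose gam := (`|f x - h x| - c) / 2.
have gam0 : 0 < gam by rewrite divr_gt0 // subr_gt0.
pose eta := gam / (2 * d%:R + 1).
have den0 : (0 : R) < 2 * d%:R + 1 by rewrite ltr_wpDl // mulr_ge0.
have eta0 : 0 < eta by rewrite divr_gt0.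
have H i : exists delta : R, [/\ 0 < delta, delta <= 1 / 2 & forall y, unit_itv y ->
    `|y - tnth x i| <= delta -> `|g i y - g i (tnth x i)| <= eta /\
    `|k i y - k i (tnth x i)| <= eta].
  have [_ [cg _] _] := gF i; have [_ [ck _] _] := kF i.
  have [d1 d10 d1P] := unit_continuous_modulus cg (cx i) eta0.
  have [d2 d20 d2P] := unit_continuous_modulus ck (cx i) eta0.
  pose de := Num.min (1 / 2) (Num.min (d1 / 2) (d2 / 2)).
  have e1 : de <= 1 / 2 by rewrite /de ge_min lexx.
  have e2 : de <= d1 / 2 by rewrite /de !ge_min lexx orbT.
  have e3 : de <= d2 / 2 by rewrite /de !ge_min lexx !orbT.
  exists de; split => //; first by rewrite !lt_min !divr_gt0.
  move=> y uy yx; split; [apply: d1P|apply: d2P] => //; apply: (le_lt_trans yx); lra.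
have [de deP] := choice H.
(* The interval extends from the coordinate of x towards the farther end of [0, 1]; as [de i] <=
   1/2, it stays inside. *)
pose A i : set RT := if tnth x i <= 1 / 2 then `[tnth x i, tnth x i + de i]%classic
  else `[tnth x i - de i, tnth x i]%classic.
have mA i : measurable (A i) by rewrite /A; case: ifP => _; exact: measurable_itv.
have lebA i : leb (A i) = (de i)%:E.
  have [de0 _ _] := deP i.
  rewrite /A; case: ifP => _; rewrite lebesgue_measure_itv /= lte_fin.
    by rewrite ltrDl de0 EFinN -EFinD; congr EFin; ring.
  by rewrite gtrBl de0 EFinN -EFinD; congr EFin; ring.
have AP i y : A i y -> unit_itv y /\ `|y - tnth x i| <= de i.
  have := cx i; have [de0 de1 _] := deP i; rewrite /A unit_itvE => x01.
  by case: ifPn; rewrite -?ltNge => ? /=; rewrite in_itv /= unit_itvE ler_norml; lra.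
have : (pow d [set t | forall i, A i (tnth t i)] <= pow d N)%E.
  apply: le_measure; rewrite ?inE //; first exact: measurable_box.
  move=> y /= Ay; apply: sN => /= /(_ (fun i => (AP i _ (Ay i)).1)).
  have cy : cube y by move=> i; exact: (AP i _ (Ay i)).1.
  have close (u : 'I_d -> R -> R) : (forall i, factor_class r M (u i)) ->
      (forall i, `|u i (tnth y i) - u i (tnth x i)| <= eta) ->
      `|\prod_i u i (tnth y i) - \prod_i u i (tnth x i)| <= d%:R * eta.
    move=> uF ue; rewrite (le_trans (prod_diff_le _ _ _)) // => [i|i|].
    - exact: factor_norm_le1 (uF i) (cy i).
    - exact: factor_norm_le1 (uF i) (cx i).
    by rewrite mulr_natl -[X in _ *+ X]card_ord -sumr_const; apply: ler_sum => i _.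
  have h1 : `|f y - f x| <= d%:R * eta.
    rewrite !fg //; apply: close => // i; have [_ _ P] := deP i.
    by have [uy yx] := AP i _ (Ay i); have [] := P _ uy yx.
  have h2 : `|h y - h x| <= d%:R * eta.
    rewrite !hk //; apply: close => // i; have [_ _ P] := deP i.
    by have [uy yx] := AP i _ (Ay i); have [] := P _ uy yx.
  apply/negP; rewrite -ltNge.
  have small : 2 * (d%:R * eta) < 2 * gam.
    have : 2 * (d%:R * eta) = gam * (2 * d%:R / (2 * d%:R + 1)).
      by rewrite /eta; field; rewrite gt_eqF.
    move=> ->; apply: (@le_lt_trans _ _ (gam * 1)); last lra.
    by rewrite ler_pM2l // ler_pdivrMr // mul1r lerDl.
  have gE : 2 * gam = `|f x - h x| - c by rewrite /gam; field.
  have : `|f x - h x| <= `|f y - h y| + (`|f y - f x| + `|h y - h x|).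
    have -> : f x - h x = (f y - h y) - ((f y - f x) - (h y - h x)) by ring.
    by rewrite (le_trans (ler_normB _ _)) // lerD2l ler_normB.
  lra.
rewrite power_measureE // N0 leNgt => /negP; apply.
rewrite (eq_bigr (fun i => (de i)%:E)) => [|i _]; last exact: lebA.
rewrite prodEFin lte_fin; apply: prodr_gt0 => i _.
by have [] := deP i.
Qed.

(** Equal observations give the same output, which cannot be closer than half their distance to both
    functions. The almost everywhere bound is made pointwise by [rank_one_ae_le]. *)
Lemma worst_case_error_ge r (M : R) d n (A : algorithm d n) (f h : d.-tuple RT -> R) x :
  rank_one r M f -> rank_one r M h -> observe (query A) f n = observe (query A) h n ->
  cube x -> ((`|f x - h x| / 2)%:E <= worst_case_error r M A)%E.
Proof.
move=> ff hh fh cx; rewrite leNgt; apply/negP => lt.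
have [v wv vx] : exists2 v : R, (worst_case_error r M A <= v%:E)%E & v < `|f x - h x| / 2.
  move: lt; case: (worst_case_error r M A) => [v| |] //.
    by rewrite lte_fin => ?; exists v.
  by exists (`|f x - h x| / 2 - 1); rewrite ?leNye // gtrBl.
have aeP u : rank_one r M u -> {ae pow d, forall x, cube x -> `|u x - run A u x| <= v}.
  move=> uu; apply: Linfty_norm_ae; first exact: power_measure_setT_gt0.
  by apply: le_trans wv; apply: ereal_sup_ubound; exists u.
have aefh : {ae pow d, forall x, cube x -> `|f x - h x| <= v + v}.
  apply: filterS2 (aeP _ ff) (aeP _ hh) => y fy hy cy.
  have -> : f y - h y = (f y - run A f y) - (h y - run A h y) by rewrite /run fh; ring.
  by rewrite (le_trans (ler_normB _ _)) // lerD ?fy ?hy.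
by have := rank_one_ae_le ff hh aefh cx; lra.
Qed.

Lemma complexity_ge r (M eps c : R) d (N : nat) : eps < c ->
  (forall n (A : algorithm d n), (0 < n)%N -> (n < N)%N ->
    exists f h x, [/\ rank_one r M f, rank_one r M h,
      observe (query A) f n = observe (query A) h n, cube x &
      2 * c <= `|f x - h x|]) ->
  (N%:R%:E <= complexity r M eps d)%E.
Proof.
move=> epsc H; apply: le_ereal_inf_tmp => _ [n [n0 err] <-].
rewrite lee_fin ler_nat leqNgt; apply/negP => nN.
have : (c%:E <= minimal_error r M n d)%E.
  apply: le_ereal_inf_tmp => _ [A _ <-].
  have [f [h [x [ff hh fh cx cfh]]]] := H n A n0 nN.
  apply: le_trans (worst_case_error_ge ff hh fh cx).
  by rewrite lee_fin; lra.
by move=> /le_trans /(_ err); rewrite lee_fin leNgt epsc.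
Qed.

(** As long as only c is observed, an adaptive algorithm follows the fixed points [q (nseq k c)].
    This reduces the lower bounds to nonadaptive queries. *)
Lemma observe_const d (q : seq R -> d.-tuple RT) (f : d.-tuple RT -> R) (c : R) n :
  (forall k, (k < n)%N -> f (q (nseq k c)) = c) -> observe q f n = nseq n c :> seq R.
Proof.
elim: n => [//|n IH] fc /=.
have -> : observe q f n = nseq n c :> seq R by apply: IH => k kn; exact/fc/ltnW.
by rewrite fc //; elim: {IH fc} n => //= n ->.
Qed.

Lemma observe_eq_const d (q : seq R -> d.-tuple RT) (f h : d.-tuple RT -> R) (c : R) n :
  (forall k, (k < n)%N -> f (q (nseq k c)) = c) ->
  (forall k, (k < n)%N -> h (q (nseq k c)) = c) -> observe q f n = observe q h n.
Proof. by move=> fc hc; apply: val_inj; rewrite /= !(observe_const (c := c)). Qed.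

(* An algorithm that only sees zeros cannot tell F i from - F i, and each query excludes
   at most one index i. *)
Lemma complexity_disjoint r (M eps u : R) d (I : finType) (F : I -> d.-tuple RT -> R)
    (x : I -> d.-tuple RT) : eps < u ->
  (forall i, rank_one r M (F i) /\ rank_one r M (fun y => - F i y)) ->
  (forall i j y, cube y -> F i y != 0 -> F j y != 0 -> i = j) ->
  (forall i, cube (x i) /\ u <= `|F i (x i)|) ->
  (#|I|%:R%:E <= complexity r M eps d)%E.
Proof.
move=> epsu FF disj Fx; apply: (complexity_ge epsu) => n A n0 nI.
pose q k := query A (nseq k 0).
have cq k : cube (q k) by exact: query_cube.
have [i iP] : exists i, forall k : 'I_n, F i (q k) = 0.
  pose hits (k : 'I_n) : {set I} := [set i | F i (q k) != 0]%SET.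
  have hits1 k : (#|hits k| <= 1)%N.
    rewrite leqNgt; apply/negP => /card_gt1P[i [j []]]; rewrite !inE => Fi Fj.
    by rewrite (disj _ _ _ (cq k) Fi Fj) eqxx.
  have : (#|(\bigcup_(k : 'I_n) hits k)%SET| < #|I|)%N.
    apply: leq_ltn_trans nI; apply: (@leq_trans (\sum_(k < n) #|hits k|)).
      elim/big_rec2: _ => [|k a B _ Ba]; first by rewrite cards0.
      by rewrite (leq_trans (leq_card_setU _ _).1) // leq_add2l.
    by rewrite -[leqRHS]card_ord -sum1_card; apply: leq_sum.
  rewrite -cardsT => lt; have [i] : exists i, i \in (~: \bigcup_(k : 'I_n) hits k)%SET.
    apply/set0Pn; rewrite -card_gt0.
    by have := cardsC (\bigcup_(k : 'I_n) hits k)%SET; rewrite -cardsT; lia.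
  rewrite inE => iN; exists i => k; apply: contraNeq iN => Fi.
  by apply/bigcupP; exists k => //; rewrite inE.
have [Fi nFi] := FF i; have [cxi ux] := Fx i.
exists (F i), (fun y => - F i y), (x i); split => //.
- apply: (observe_eq_const (c := 0)) => k kn; have := iP (Ordinal kn); rewrite /q /= => -> //.
  by rewrite oppr0.
- have -> : F i (x i) - - F i (x i) = 2 * F i (x i) by ring.
  by rewrite normrM ger0_norm // ler_pM2l.
Qed.

End LowerBound.

(** * Truncated polynomials as members of the class *)

Section TruncatedPolynomial.
Context {R : realType}.
Local Notation RT := (measurableTypeR R).
Local Notation leb := (@lebesgue_measure R).
Implicit Types (p q : {poly R}) (a b : R).
Hint Resolve measurable_unit_itv : core.

Lemma test_function_boundary (phi : R -> R) k x : test_function phi -> ~ (0 < x < 1) ->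
  derive1n k phi x = 0.
Proof.
move=> [_ [K [cK K01 phi0]]] x01.
have cloK : closed K by apply: compact_closed cK; exact: Rhausdorff.
apply: (@derive1n_eq0_open R phi (~` K)) => //; first exact: closed_openC.
by move=> /K01 /=; rewrite in_itv.
Qed.

Definition truncated p a b (x : R) : R := if a <= x <= b then p.[x] else 0.

Lemma truncatedE p a b : truncated p a b = (horner p) \_ `[a, b].
Proof.
apply/funext => x; rewrite /truncated patchE; case: ifPn => axb.
  by rewrite mem_set //= in_itv.
by rewrite memNset //= in_itv; apply/negP.
Qed.

Lemma truncated_measurable p a b (D : set RT) : measurable D ->
  measurable_fun D (truncated p a b).
Proof.
move=> mD; apply: (measurable_funS measurableT) => //; rewrite truncatedE.
apply/(measurable_restrictT _ _).1; first exact: measurable_itv.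
by apply: continuous_measurable; [exact: continuous_horner|exact: measurable_itv].
Qed.

Lemma truncated_bounded p a b : exists C : R, forall x, `|truncated p a b x| <= C.
Proof.
have [ab|ba] := leP a b.
  have [C pC] := continuous_segment_bounded ab (@continuous_horner R p).
  exists `|C| => x; rewrite /truncated; case: ifP => axb; last by rewrite normr0.
  by rewrite (le_trans (pC _ axb)) // ler_norm.
exists 0 => x; rewrite /truncated ifF ?normr0 //; apply/negbTE/negP => /andP[ax xb].
by have := le_lt_trans xb ba; rewrite ltNge ax.
Qed.

(** Contact of order n with 0 at both ends of [a, b], except at an end that is also an end of
    [0, 1], where test functions vanish. *)
Definition vanishing n p a b :=
  forall j, (j < n)%N -> (a = 0 \/ (p^`(j)).[a] = 0) /\ (b = 1 \/ (p^`(j)).[b] = 0).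

Lemma vanishing_deriv n p a b : vanishing n.+1 p a b -> vanishing n p^`() a b.
Proof. by move=> v j jn; have := v j.+1 jn; rewrite derivSn. Qed.

Lemma vanishingW n m p a b : (m <= n)%N -> vanishing n p a b -> vanishing m p a b.
Proof. by move=> mn v j jm; apply: v; exact: leq_trans mn. Qed.

(** At each step a boundary term vanishes through a derivative of p or, at 0 and 1, through the test
    function. *)
Lemma integral_by_parts_test p a b (phi : R -> R) k : 0 <= a -> a < b -> b <= 1 ->
  vanishing k p a b -> test_function phi ->
  \int[leb]_(x in `[a, b]) (p.[x] * derive1n k phi x) =
  (-1) ^+ k * \int[leb]_(x in `[a, b]) ((p^`(k)).[x] * phi x).
Proof.
move=> a0 ab b1 + tp; have [sm _] := tp.
have cphi j : continuous (derive1n j phi) by apply: derivable_continuous; exact: sm.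
elim: k p => [|k IH] p vp; first by rewrite expr0 mul1r derivn0.
have lr (f : R -> R) : (forall x, derivable f x 1) -> derivable_oo_LRcontinuous f a b.
  move=> df; have cf := derivable_continuous df; split => [x _||]; first exact: df.
    by apply: cvg_at_right_filter; exact: cf.
  by apply: cvg_at_left_filter; exact: cf.
rewrite (@Rintegration_by_parts R (horner p) (derive1n k phi) (horner p^`()) (derive1n k.+1 phi)) //.
- have [ha hb] := vp 0%N isT.
  have -> : p.[b] * derive1n k phi b = 0.
    by case: hb => [->|]; [rewrite test_function_boundary ?mulr0 //; lra|rewrite derivn0 => ->; rewrite mul0r].
  have -> : p.[a] * derive1n k phi a = 0.
    by case: ha => [->|]; [rewrite test_function_boundary ?mulr0 //; lra|rewrite derivn0 => ->; rewrite mul0r].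
  rewrite IH; last exact: vanishing_deriv.
  by rewrite subrr sub0r exprS mulN1r mulNr derivSn.
- by apply: continuous_subspaceT; exact: continuous_horner.
- by apply: lr => x; exact: derivable_horner.
- by move=> x _; rewrite -derivE.
- by apply: continuous_subspaceT; exact: cphi.
- by apply: lr; exact: sm.
Qed.

Lemma truncated_integral p a b (phi : R -> R) : 0 <= a -> b <= 1 ->
  \int[leb]_(x in unit_itv) (truncated p a b x * phi x) =
  \int[leb]_(x in `[a, b]) (p.[x] * phi x).
Proof.
move=> a0 b1; have sub : `[a, b] `<=` (unit_itv : set R).
  by move=> x /=; rewrite unit_itvE in_itv /= => /andP[ax xb]; rewrite (le_trans a0) //= (le_trans xb).
rewrite -[in RHS](setIidr sub) Rintegral_mkcondr; apply: eq_Rintegral => x _.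
by rewrite truncatedE !patchE; case: ifP => _ //; rewrite mul0r.
Qed.

Lemma weak_derivative_truncated p a b k : 0 <= a -> a < b -> b <= 1 ->
  vanishing k p a b -> weak_derivative k (truncated p a b) (truncated p^`(k) a b).
Proof.
move=> a0 ab b1 vp phi tp.
by rewrite !truncated_integral // integral_by_parts_test.
Qed.

Lemma test_function_bounded (phi : R -> R) k : test_function phi ->
  exists C : R, forall x, unit_itv x -> `|derive1n k phi x| <= C.
Proof.
move=> [sm _]; have cphi : continuous (derive1n k phi) by apply: derivable_continuous; exact: sm.
have [C phiC] := continuous_segment_bounded ler01 cphi.
by exists C => x; rewrite unit_itvE => /phiC.
Qed.

Lemma truncated_test_integrable p a b (phi : R -> R) k : test_function phi ->
  leb.-integrable unit_itv (EFin \o (fun x => truncated p a b x * derive1n k phi x)).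
Proof.
move=> tp; have [C pC] := truncated_bounded p a b; have [D phiD] := test_function_bounded k tp.
apply: (@integrable_unit _ _ (C * D)).
  apply: measurable_funM; first exact: truncated_measurable.
  apply: continuous_measurable => //; apply: derivable_continuous; exact: tp.1.
by move=> x ux; rewrite normrM ler_pM // phiD.
Qed.

Lemma weak_derivative_sum p q a b k : 0 <= a -> a < b -> b <= 1 -> vanishing k p a b ->
  weak_derivative k (fun x => truncated q 0 1 x + truncated p a b x)
    (fun x => truncated q^`(k) 0 1 x + truncated p^`(k) a b x).
Proof.
move=> a0 ab b1 vp phi tp.
have split_sum p1 p2 j : \int[leb]_(x in unit_itv)
      ((truncated p2 0 1 x + truncated p1 a b x) * derive1n j phi x) =
    \int[leb]_(x in unit_itv) (truncated p2 0 1 x * derive1n j phi x) +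
    \int[leb]_(x in unit_itv) (truncated p1 a b x * derive1n j phi x).
  rewrite -RintegralD //; try exact: truncated_test_integrable.
  by apply: eq_Rintegral => x _; rewrite mulrDl.
rewrite split_sum (split_sum _ _ 0%N) mulrDr; congr (_ + _).
  by apply: weak_derivative_truncated => // j _; split; left.
exact: weak_derivative_truncated.
Qed.

(** Clamping x to [a, b] writes the truncation as a composition of continuous maps, which provides
    the continuity required by [sobolev]. *)
Lemma truncated_clamp p a b x : a <= b -> vanishing 1 p a b -> unit_itv x ->
  truncated p a b x = p.[Num.max a (Num.min x b)].
Proof.
move=> ab v; rewrite unit_itvE => /andP[x0 x1]; have [ha hb] := v 0%N isT.
rewrite derivn0 in ha hb; rewrite /truncated.
have [ax|xa] := leP a x; have [xb|bx] := leP x b => //=.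
- by rewrite max_r.
- rewrite max_r //; case: hb => // b1.
  by move: bx; rewrite b1 ltNge x1.
- rewrite max_l; last exact: ltW.
  by case: ha => // a0; move: xa; rewrite a0 ltNge x0.
- by have := lt_trans bx xa; rewrite ltNge ab.
Qed.

(** The constant c is 0 for truncated powers and 1 for functions with a dip. *)
Lemma truncated_factor r (M c : R) p a b : (0 < r)%N -> 0 <= M -> 0 <= a -> a < b -> b <= 1 ->
  vanishing r p a b ->
  (forall x, unit_itv x -> `|c + truncated p a b x| <= 1) ->
  (forall x, a <= x <= b -> `|(p^`(r)).[x]| <= M) ->
  factor_class r M (fun x => c + truncated p a b x).
Proof.
move=> r0 M0 a0 ab b1 vp f1 pM.
have cE x : unit_itv x -> truncated c%:P 0 1 x = c.
  by rewrite unit_itvE /truncated => ->; rewrite hornerC.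
have wd k : (k <= r)%N -> weak_derivative k (fun x => c + truncated p a b x)
    (fun x => truncated (c%:P)^`(k) 0 1 x + truncated p^`(k) a b x).
  move=> kr phi tp; have := weak_derivative_sum c%:P a0 ab b1 (vanishingW kr vp) tp.
  move=> <-; apply: eq_Rintegral => x; rewrite inE => ux.
  by rewrite cE.
have Lg k : Linfty leb unit_itv (fun x => truncated (c%:P)^`(k) 0 1 x + truncated p^`(k) a b x).
  have [C1 h1] := truncated_bounded (c%:P)^`(k) 0 1.
  have [C2 h2] := truncated_bounded p^`(k) a b.
  apply: (@Linfty_bounded _ _ _ _ _ _ (C1 + C2)).
    apply/(measurable_restrictT _ _).1 => //.
    by apply: measurable_funD; exact: truncated_measurable.
  by move=> x _; rewrite (le_trans (ler_normD _ _)) // lerD.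
split.
- by move=> x /f1; rewrite ler_norml /= in_itv.
- split => [|k kr]; last by exists (fun x => truncated (c%:P)^`(k) 0 1 x + truncated p^`(k) a b x); auto.
  apply: (@subspace_eq_continuous _ unit_itv _ (fun x => c + p.[Num.max a (Num.min x b)])).
    move=> x; rewrite inE => ux /=; rewrite -truncated_clamp //; first exact: ltW.
    exact: vanishingW vp.
  apply: continuous_subspaceT => x.
  apply: cvgD; first exact: cvg_cst.
  apply: (@continuous_comp _ _ _ (fun x : R => Num.max a (Num.min x b)) (horner p)); last first.
    exact: continuous_horner.
  apply: (@continuous_max _ _ (fun=> a) (fun x : R => Num.min x b)); first exact: cvg_cst.
  by apply: (@continuous_min _ _ (fun x : R => x) (fun=> b)); [exact: cvg_id|exact: cvg_cst].
- exists (fun x => truncated (c%:P)^`(r) 0 1 x + truncated p^`(r) a b x); split; [exact: Lg|exact: wd|].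
  apply: Linfty_norm_le => // x _; rewrite derivnC gtn_eqF //.
  rewrite {1}/truncated horner0 if_same add0r /truncated.
  by case: ifP => [/pM|_]; rewrite ?normr0.
Qed.

Lemma derivn_root n q (c : R) j : (j < n)%N -> ((('X - c%:P) ^+ n * q)^`(j)).[c] = 0.
Proof.
elim: j n q => [|j IH] [|n] q // jn.
  by rewrite derivn0 exprS !hornerE subrr !mul0r.
rewrite derivSn derivM deriv_exp derivXsubC mul1r.
have -> : ('X - c%:P) ^+ n.+1.-1 *+ n.+1 * q + ('X - c%:P) ^+ n.+1 * q^`() =
    ('X - c%:P) ^+ n * (q *+ n.+1 + ('X - c%:P) * q^`()).
  by rewrite mulrDr mulrnAr mulrnAl mulrA -exprSr.
exact: IH.
Qed.

Lemma derivn_XsubC_exp n (c C : R) : (C *: ('X - c%:P) ^+ n)^`(n) = (C * n`!%:R)%:P.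
Proof.
rewrite derivnZ derivn_monic ?monic_exp ?monicXsubC //; last by rewrite size_exp_XsubC.
by rewrite -mul_polyC -polyCM.
Qed.

Lemma vanishing_XsubC n q (c : R) : vanishing n (('X - c%:P) ^+ n * q) c 1 /\
  vanishing n (('X - c%:P) ^+ n * q) 0 c.
Proof. by split => j jn; split; [right| | |right]; rewrite ?derivn_root //; left. Qed.

(** The two bounds on C concern the largest absolute value, taken at 1, and the r-th derivative,
    constant on [delta, 1]. *)
Lemma right_power_factor r (M delta C : R) : (0 < r)%N -> 0 <= delta < 1 ->
  `|C| * (1 - delta) ^+ r <= 1 -> `|C| * r`!%:R <= M ->
  factor_class r M (truncated (C *: ('X - delta%:P) ^+ r) delta 1).
Proof.
move=> r0 /andP[d0 d1] C1 CM.
rewrite (_ : truncated _ _ _ = fun x => 0 + truncated (C *: ('X - delta%:P) ^+ r) delta 1 x); last first.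
  by apply/funext => x; rewrite add0r.
apply: truncated_factor => //.
- by apply: le_trans CM; rewrite mulr_ge0.
- by rewrite -mul_polyC mulrC; have [] := vanishing_XsubC r C%:P delta.
- move=> x ux; rewrite add0r /truncated; case: ifP => [/andP[dx x1]|_]; last by rewrite normr0.
  rewrite !hornerE normrM (le_trans _ C1) // ler_wpM2l // ger0_norm ?exprn_ge0 ?subr_ge0 //.
  by apply: lerXn2r; rewrite ?nnegrE; lra.
- by move=> x _; rewrite derivn_XsubC_exp hornerC normrM [X in _ * X]ger0_norm.
Qed.

Lemma left_power_factor r (M delta C : R) : (0 < r)%N -> 0 < delta <= 1 ->
  `|C| * delta ^+ r <= 1 -> `|C| * r`!%:R <= M ->
  factor_class r M (truncated (C *: ('X - delta%:P) ^+ r) 0 delta).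
Proof.
move=> r0 /andP[d0 d1] C1 CM.
rewrite (_ : truncated _ _ _ = fun x => 0 + truncated (C *: ('X - delta%:P) ^+ r) 0 delta x); last first.
  by apply/funext => x; rewrite add0r.
apply: truncated_factor => //.
- by apply: le_trans CM; rewrite mulr_ge0.
- by rewrite -mul_polyC mulrC; have [] := vanishing_XsubC r C%:P delta.
- move=> x ux; rewrite add0r /truncated; case: ifP => [/andP[x0 xd]|_]; last by rewrite normr0.
  rewrite !hornerE normrM (le_trans _ C1) // ler_wpM2l // normrX.
  by rewrite lerXn2r ?nnegrE ?(ltW d0) // ler_norml; lra.
- by move=> x _; rewrite derivn_XsubC_exp hornerC normrM [X in _ * X]ger0_norm.
Qed.

End TruncatedPolynomial.

(** * Fooling functions and the limits of tractability *)

Section NonTractability.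
Context {R : realType}.
Local Notation RT := (measurableTypeR R).
Implicit Types (L : R -> R).

Lemma rank_one_prod r (M : R) d (g : 'I_d -> R -> R) : (forall i, factor_class r M (g i)) ->
  rank_one r M (fun y : d.-tuple RT => \prod_(i < d) g i (tnth y i)).
Proof. by exists g. Qed.

(** The sign is absorbed by a single factor, hence d > 0. *)
Lemma rank_one_opp r (M : R) d (g : 'I_d -> R -> R) : (0 < d)%N ->
  (forall i, factor_class r M (g i)) -> (forall i, factor_class r M (fun x => - g i x)) ->
  rank_one r M (fun y : d.-tuple RT => - \prod_(i < d) g i (tnth y i)).
Proof.
move=> d0 gF nF; pose i0 := Ordinal d0.
exists (fun i x => if i == i0 then - g i x else g i x) => [i|y _].
  by case: (i == i0).
rewrite [RHS](bigD1 i0) //= mulNr (bigD1 i0) //=; congr (- (_ * _)).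
by apply: eq_bigr => i /negbTE ->.
Qed.

Lemma truncated_opp (C delta a b : R) n :
  (fun x => - truncated (C *: ('X - delta%:P) ^+ n) a b x) =
  truncated (- C *: ('X - delta%:P) ^+ n) a b.
Proof.
apply/funext => x; rewrite /truncated scaleNr hornerN.
by case: ifP; rewrite ?oppr0.
Qed.

Lemma right_power_support n (C delta x : R) : (0 < n)%N ->
  truncated (C *: ('X - delta%:P) ^+ n) delta 1 x != 0 -> delta < x.
Proof.
rewrite /truncated => n0; case: ifP => [/andP[dx _]|]; last by rewrite eqxx.
rewrite !hornerE mulf_eq0 negb_or expf_eq0 n0 subr_eq0 => /andP[_ xd].
by rewrite lt_neqAle eq_sym xd.
Qed.

Lemma left_power_support n (C delta x : R) : (0 < n)%N ->
  truncated (C *: ('X - delta%:P) ^+ n) 0 delta x != 0 -> x < delta.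
Proof.
rewrite /truncated => n0; case: ifP => [/andP[_ xd]|]; last by rewrite eqxx.
rewrite !hornerE mulf_eq0 negb_or expf_eq0 n0 subr_eq0 => /andP[_ dx].
by rewrite lt_neqAle dx.
Qed.

(** Member i has the left power in the coordinates of [T i] and the right power elsewhere. Distinct
    sets give supports in disjoint orthants around the point with all coordinates delta, and the
    norm is attained at a vertex of the cube. *)
Lemma complexity_orthants r (M eps u CL CR delta : R) d (I : finType) (T : I -> {set 'I_d}) :
  (0 < r)%N -> (0 < d)%N -> 0 < delta < 1 -> eps < u ->
  `|CL| * r`!%:R <= M -> `|CR| * r`!%:R <= M ->
  `|CL| * delta ^+ r <= 1 -> `|CR| * (1 - delta) ^+ r <= 1 -> injective T ->
  (forall i, u <= \prod_(c < d) (if c \in T i then `|CL| * delta ^+ r else `|CR| * (1 - delta) ^+ r)) ->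
  (#|I|%:R%:E <= complexity r M eps d)%E.
Proof.
move=> r0 d0 /andP[delta0 delta1] epsu CLM CRM CL1 CR1 TI uT.
pose Lf := truncated (CL *: ('X - delta%:P) ^+ r) 0 delta.
pose Rf := truncated (CR *: ('X - delta%:P) ^+ r) delta 1.
have LF : factor_class r M Lf by apply: left_power_factor => //; rewrite delta0 ltW.
have RF : factor_class r M Rf by apply: right_power_factor => //; rewrite delta1 ltW.
have LN : factor_class r M (fun x => - Lf x).
  by rewrite truncated_opp; apply: left_power_factor; rewrite ?normrN // delta0 ltW.
have RN : factor_class r M (fun x => - Rf x).
  by rewrite truncated_opp; apply: right_power_factor; rewrite ?normrN // delta1 ltW.
pose g i (c : 'I_d) := if c \in T i then Lf else Rf.
pose F i (y : d.-tuple RT) := \prod_(c < d) g i c (tnth y c).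
pose x i : d.-tuple RT := [tuple (if c \in T i then 0 else 1) | c < d].
apply: (complexity_disjoint (F := F) (x := x) epsu) => [i|i j y cy Fi Fj|i].
- split; first by apply: rank_one_prod => c; rewrite /g; case: ifP.
  by apply: rank_one_opp => // c; rewrite /g; case: ifP.
- apply: TI; apply/setP => c.
  have nz k : F k y != 0 -> g k c (tnth y c) != 0 by move/prodf_neq0 => /(_ c isT).
  have := nz _ Fi; have := nz _ Fj; rewrite /g.
  case: (c \in T i); case: (c \in T j) => //.
  + by move=> /right_power_support-/(_ r0) h1 /left_power_support-/(_ r0) h2; have := lt_trans h1 h2; rewrite ltxx.
  + by move=> /left_power_support-/(_ r0) h1 /right_power_support-/(_ r0) h2; have := lt_trans h1 h2; rewrite ltxx.
- split.
    by move=> c; rewrite tnth_mktuple unit_itvE; case: ifP => _; rewrite lexx ler01.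
  apply: le_trans (uT i) _; rewrite /F normr_prod; apply: le_of_eq; apply: eq_bigr => c _.
  rewrite tnth_mktuple /g; case: ifP => _; rewrite /Lf /Rf /truncated ?lexx ?(ltW delta0) ?(ltW delta1) /=.
    by rewrite hornerZ horner_exp hornerXsubC normrM normrX sub0r normrN (gtr0_norm delta0).
  by rewrite hornerZ horner_exp hornerXsubC normrM normrX [`|1 - delta|]gtr0_norm // subr_gt0.
Qed.

(** With delta = 1/2 and coefficient 2^r both powers have norm 1 and r-th derivative 2^r r! <= M in
    absolute value, so all 2^d orthants are available. *)
Lemma curse_large r (M : R) : (0 < r)%N -> (2 ^ r * r`!)%:R <= M ->
  curse_of_dimensionality r M.
Proof.
move=> r0 hM; exists (1 / 2), 1, 2; split; [lra|lra|lra|move=> d d0].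
rewrite mul1r -natrX.
have -> : (2 ^ d)%N = #|{: {set 'I_d}}|.
  by rewrite -cardsT -powersetT card_powerset cardsT card_ord.
have two : `|2 ^+ r| = (2 ^+ r : R) by rewrite ger0_norm // exprn_ge0.
have half : (2 ^+ r : R) * (1 / 2) ^+ r = 1 by rewrite -exprMn mul1r divff ?expr1n.
have half' : (2 ^+ r : R) * (1 - 1 / 2) ^+ r = 1.
  by rewrite (_ : 1 - 1 / 2 = 1 / 2 :> R) //; lra.
apply: (@complexity_orthants r M _ 1 (2 ^+ r) (2 ^+ r) (1 / 2) d _ id) => //; rewrite ?two ?half ?half' //.
- by lra.
- by lra.
- by rewrite -natrX -natrM.
- by rewrite -natrX -natrM.
- by move=> T; rewrite big1 // => c _; case: ifP; rewrite ?half ?half'.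
Qed.

(** Each of the k factors n - i of the falling factorial is at least n / 2. *)
Lemma bin_ge n k : (2 * k <= n)%N -> (n%:R / 2) ^+ k <= k`!%:R * 'C(n, k)%:R :> R.
Proof.
move=> kn; rewrite -natrM mulnC bin_ffact ffact_prod natr_prod.
rewrite -[X in _ ^+ X]card_ord -prodr_const; apply: ler_prod => i _.
rewrite divr_ge0 //= ler_pdivrMr // -natrM ler_nat.
have := ltn_ord i; lia.
Qed.

(** The right power is scaled to norm 1, which M > r! permits for small delta; the left power has
    norm delta^r. With the left power in exactly k coordinates the norm delta^(r k) is independent
    of d, and the number of such functions grows like d^k with k > q. *)
Lemma not_polynomially_tractable r (M : R) : (0 < r)%N -> r`!%:R < M ->
  ~ polynomially_tractable r M.
Proof.
move=> r0 rM [c [q [p [c0 q0 p0 pt]]]].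
have fact0 : (0 : R) < r`!%:R by rewrite ltr0n fact_gt0.
have M0 : 0 < M by apply: lt_trans rM.
pose t := r`!%:R / M.
have t0 : 0 < t by rewrite divr_gt0.
have t1 : t < 1 by rewrite ltr_pdivrMr // mul1r.
(* By Bernoulli's inequality (1 - delta)^r >= 1 - r delta >= r! / M, so the scaled right power has
   r-th derivative at most M. *)
pose delta := (1 - t) / r.+1%:R.
have r1 : (0 : R) < r.+1%:R by rewrite ltr0n.
have delta0 : 0 < delta by rewrite divr_gt0 // subr_gt0.
have deltar : r%:R * delta <= 1 - t.
  by rewrite /delta mulrCA ler_piMr ?subr_ge0 ?(ltW t1) // ler_pdivrMr // mul1r ler_nat.
have delta1 : delta < 1.
  rewrite /delta ltr_pdivrMr // mul1r; apply: (@lt_le_trans _ _ 1); first lra.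
  by rewrite ler1n.
have d01 : 0 <= delta <= 1 by rewrite !ltW.
have tdelta : t <= (1 - delta) ^+ r by apply: le_trans (bernoulli r d01); lra.
have dr0 : 0 < (1 - delta) ^+ r by rewrite exprn_gt0 // subr_gt0.
(* One more than the exponent [nat_above q] >= q, so that a factor d remains unbounded after
   cancellation. *)
pose k := (nat_above q).+1.
pose kap := delta ^+ r.
have kap0 : 0 < kap by rewrite exprn_gt0.
have kap1 : kap <= 1 by rewrite exprn_ile1 ?ltW.
pose eps := kap ^+ k / 2.
have kapk : 0 < kap ^+ k <= 1 by rewrite exprn_gt0 //= exprn_ile1 // ltW.
have eps01 : 0 < eps < 1 by rewrite /eps; lra.
pose C0 := c * eps `^ (- p).
pose B := 2 ^+ k * k`!%:R * C0.
have C00 : 0 <= C0 by rewrite mulr_ge0 ?powR_ge0 // ltW.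
have lower d : (0 < d)%N -> ('C(d, k)%:R%:E <= complexity r M eps d)%E.
  move=> d0.
  have -> : 'C(d, k) = #|{: {A : {set 'I_d} | #|A| == k}}|.
    by rewrite card_sig -[in LHS](card_ord d) -card_draws cardsE.
  have CRN : `|((1 - delta) ^+ r)^-1| = ((1 - delta) ^+ r)^-1 :> R.
    by rewrite ger0_norm // invr_ge0 ltW.
  apply: (@complexity_orthants r M eps (kap ^+ k) 1 ((1 - delta) ^+ r)^-1 delta d _ val) => //.
  - by rewrite delta0.
  - by rewrite /eps; lra.
  - by rewrite normr1 mul1r ltW.
  - rewrite CRN mulrC ler_pdivrMr // mulrC -ler_pdivrMr //.
  - by rewrite normr1 mul1r.
  - by rewrite CRN mulVf // gt_eqF.
  - move=> [A /= /eqP Ak]; rewrite normr1 mul1r CRN mulVf ?gt_eqF // -/kap.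
    by rewrite -big_mkcond /= prodr_const Ak.
have bound d : (2 * k <= d)%N -> d%:R <= B.
  move=> kd; have d0 : (0 < d)%N by apply: leq_trans kd; rewrite muln_gt0.
  have D0 : (0 : R) < d%:R by rewrite ltr0n.
  have := le_trans (lower d d0) (pt eps d eps01 d0); rewrite lee_fin -/C0 => h.
  have dq : (d%:R : R) `^ q <= d%:R ^+ nat_above q.
    rewrite -powR_mulrn // ler_powR ?ler1n //; exact: nat_above_ge.
  have h1 : 'C(d, k)%:R <= C0 * d%:R ^+ nat_above q.
    by apply: (le_trans h); rewrite ler_wpM2l.
  have h2 : (d%:R / 2) ^+ k <= k`!%:R * (C0 * d%:R ^+ nat_above q).
    by apply: le_trans (bin_ge kd) _; rewrite ler_wpM2l.
  move: h2; rewrite exprMn exprVn ler_pdivrMr ?exprn_gt0 // {1}/k exprS.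
  rewrite (_ : k`!%:R * _ * _ = B * d%:R ^+ nat_above q); last by rewrite /B; ring.
  by rewrite ler_pM2r // exprn_gt0.
pose d := maxn (2 * k) (nat_above B).+1.
have := bound d (leq_maxl _ _); apply/negP; rewrite -ltNge.
apply: (le_lt_trans (nat_above_ge B)); rewrite ltr_nat.
exact: leq_maxr.
Qed.

(** The constant 1 is compared with a product of factors that dip in one of n + 1 cells. At most n
    queries leave a free cell in every coordinate, so both functions look like 1. The common depth
    eta does not depend on d, and many coordinates make the product small. *)
Lemma complexity_unbounded r (M : R) n : (0 < r)%N -> 0 < M ->
  exists2 d, (0 < d)%N & (n.+1%:R%:E <= complexity r M (1 / 4) d)%E.
Proof.
move=> r0 M0; pose N : R := n.+1%:R.
have N0 : 0 < N by rewrite ltr0n.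
pose a (k : 'I_n.+1) : R := k%:R / N.
pose b (k : 'I_n.+1) : R := k.+1%:R / N.
have ab k : a k < b k by rewrite ltr_pM2r ?invr_gt0 // ltr_nat.
have a0 k : 0 <= a k by rewrite divr_ge0 // ltW.
have b1 k : b k <= 1 by rewrite ler_pdivrMr // mul1r ler_nat.
have abN k : b k - a k = N^-1 by rewrite /a /b -mulrBl -natrB // subSnn mul1r.
(* Zeros of order r at both ends of the cell, as [vanishing] demands. *)
pose q k : {poly R} := ('X - (a k)%:P) ^+ r * ('X - (b k)%:P) ^+ r.
have /choice[C qC] : forall k, exists C : R, forall x, 0 <= x <= 1 -> `|((q k)^`(r)).[x]| <= C.
  by move=> k; apply: continuous_segment_bounded => //; exact: continuous_horner.
pose B := \sum_k `|C k|.
have B0 : 0 <= B by exact: sumr_ge0.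
have CB k : C k <= B.
  by rewrite (le_trans (ler_norm _)) // /B (bigD1 k) //= lerDl sumr_ge0.
(* Bounds the depth by 1 and all r-th derivatives by M. *)
pose kap := Num.min 1 (M / (B + 1)).
have kap0 : 0 < kap by rewrite lt_min ltr01 divr_gt0 // ltr_wpDl.
have kap1 : kap <= 1 by rewrite ge_min lexx.
have kapB : kap * B <= M.
  apply: (@le_trans _ _ (M / (B + 1) * B)).
    by rewrite ler_wpM2r // ge_min lexx orbT.
  by rewrite mulrAC ler_pdivrMr ?ltr_wpDl // ler_wpM2l ?(ltW M0) // lerDl.
(* The sign (-1)^r turns (x - b)^r into (b - x)^r, and the minus makes the bump a dip. *)
pose s : R := - (kap * (-1) ^+ r).
have sN : `|s| = kap by rewrite normrN normrM normrX normrN1 expr1n mulr1 gtr0_norm.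
pose p k := s *: q k.
have pE k x : (p k).[x] = - (kap * ((x - a k) * (b k - x)) ^+ r).
  rewrite /p /q /s hornerZ hornerM !horner_exp !hornerXsubC.
  by rewrite (_ : b k - x = -1 * (x - b k)) ?exprMn; ring.
have pb k x : a k <= x <= b k -> -1 <= (p k).[x] <= 0.
  move=> /andP[ax xb]; rewrite pE.
  have h : 0 <= ((x - a k) * (b k - x)) ^+ r <= 1.
    have h1 : 0 <= (x - a k) * (b k - x) by rewrite mulr_ge0 // subr_ge0.
    have h2 : (x - a k) * (b k - x) <= 1.
      have := a0 k; have := b1 k => ? ?.
      by rewrite -[leRHS]mulr1; apply: ler_pM; lra.
    by rewrite exprn_ge0 //= exprn_ile1.
  move: h => /andP[h1 h2].
  have h3 : 0 <= kap * ((x - a k) * (b k - x)) ^+ r by rewrite mulr_ge0 // ltW.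
  have h4 : kap * ((x - a k) * (b k - x)) ^+ r <= 1.
    by rewrite -[leRHS]mulr1; apply: ler_pM => //; rewrite ltW.
  lra.
pose f k x := 1 + truncated (p k) (a k) (b k) x.
have fF k : factor_class r M (f k).
  apply: truncated_factor => //; first exact: ltW.
  - move=> j jr; rewrite /p derivnZ; split; right; rewrite hornerZ.
      by rewrite derivn_root ?mulr0.
    by rewrite /q [_ ^+ r * _]mulrC derivn_root ?mulr0.
  - move=> x _; rewrite /truncated; case: ifP => [/pb|_]; last by rewrite addr0 normr1.
    by rewrite ler_norml; lra.
  - move=> x /andP[ax xb]; rewrite /p derivnZ hornerZ normrM sN.
    apply: le_trans kapB; rewrite ler_wpM2l ?(ltW kap0) // (le_trans (qC k x _)) //.
    by rewrite (le_trans (a0 k)) //= (le_trans xb).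
have oneF : factor_class r M (fun x : R => 1 + truncated 0 0 1 x).
  apply: truncated_factor => //; first exact: ltW.
  - by move=> j _; split; left.
  - by move=> x _; rewrite /truncated horner0 if_same addr0 normr1.
  - by move=> x _; rewrite linear0 horner0 normr0 ltW.
pose eta := kap * ((N^-1 / 2) ^+ 2) ^+ r.
have eta0 : 0 < eta by rewrite mulr_gt0 // !exprn_gt0 // divr_gt0 // invr_gt0.
(* With d eta >= 2, (1 - eta)^d <= exp(- 2) <= 1/3. The distance of the two functions is then at
   least 2/3 = 2 c for c = 1/3 > 1/4. *)
pose d := nat_above (2 / eta).
have d0 : (0 < d)%N by [].
have etad : 2 <= d%:R * eta by rewrite -ler_pdivrMr //; exact: nat_above_ge.
exists d => //; apply: (@complexity_ge _ r M (1 / 4) (1 / 3)); first lra.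
move=> m A m0 mn.
pose z k := query A (nseq k 1).
have uz k i : 0 <= tnth (z k) i <= 1 by have := query_cube A (nseq k 1) i; rewrite unit_itvE.
(* There are more cells than queries. *)
have /choice[cell cellP] : forall i : 'I_d, exists k : 'I_n.+1, forall l : 'I_m,
    f k (tnth (z l) i) = 1.
  (* The cell containing the i-th coordinate of query l. The coordinate 1 overflows, and [inord]
     then returns cell 0; this is harmless because the dips vanish at the ends of their cells. *)
  move=> i; pose hit (l : 'I_m) : 'I_n.+1 := inord (Num.truncn (tnth (z l) i * N)).
  have [k kP] : exists k, k \notin codom hit.
    apply/existsP; rewrite -negb_forall; apply/negP => /forallP H.
    have : (#|'I_n.+1| <= size (codom hit))%N.
      by rewrite cardE; apply: uniq_leq_size; [exact: enum_uniq|move=> k _; exact: H].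
    by rewrite size_codom !card_ord leqNgt mn.
  exists k => l; rewrite /f /truncated; case: ifPn => [/andP[ak kb]|_]; last by rewrite addr0.
  have [tb|bt] := ltP (tnth (z l) i) (b k); last first.
    have -> : tnth (z l) i = b k by apply/le_anti; rewrite kb.
    by rewrite pE subrr mulr0 expr0n gtn_eqF // mulr0 oppr0 addr0.
  case/negP: kP; apply/codomP; exists l; apply: val_inj; rewrite /hit /=.
  have <- : nat_of_ord k = Num.truncn (tnth (z l) i * N).
    apply/esym/truncn_def; apply/andP; split.
      by rewrite -ler_pdivrMr.
    by rewrite -ltr_pdivlMr.
  by rewrite inordK.
pose f1 (y : d.-tuple RT) : R := \prod_(i < d) (1 + truncated 0 0 1 (tnth y i)).
pose f2 (y : d.-tuple RT) : R := \prod_(i < d) f (cell i) (tnth y i).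
have f1E y : f1 y = 1 by rewrite /f1 big1 // => i _; rewrite /truncated horner0 if_same addr0.
pose x : d.-tuple RT := [tuple (a (cell i) + b (cell i)) / 2 | i < d].
have f2x : f2 x = (1 - eta) ^+ d.
  rewrite /f2 (eq_bigr (fun=> 1 - eta)) => [|i _]; first by rewrite prodr_const card_ord.
  rewrite tnth_mktuple /f /truncated ifT; last by have := ab (cell i); lra.
  rewrite pE /eta; congr (1 - kap * _ ^+ r); rewrite -(abN (cell i)) expr2.
  by field.
exists f1, f2, x; split.
- exact: (rank_one_prod (g := fun _ x => 1 + truncated 0 0 1 x)).
- exact: (rank_one_prod (g := fun i => f (cell i))).
- apply: (observe_eq_const (c := 1)) => k km; first exact: f1E.
  by rewrite /f2 big1 // => i _; exact: (cellP i (Ordinal km)).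
- move=> i; rewrite tnth_mktuple unit_itvE.
  by have := a0 (cell i); have := b1 (cell i); have := ab (cell i); lra.
rewrite f1E f2x.
have eta1 : eta <= 1.
  rewrite /eta -[leRHS]mulr1; apply: ler_pM => //; first exact: ltW.
    by rewrite !exprn_ge0 // divr_ge0 // invr_ge0 ltW.
  have h : 0 <= N^-1 / 2 <= 1.
    have : N^-1 <= 1 by rewrite invf_le1 // ler1n.
    have : 0 < N^-1 by rewrite invr_gt0.
    by move: (N^-1) => y y0 y1; rewrite divr_ge0 ?(ltW y0) //= ler_pdivrMr // mul1r (le_trans y1) // ler1n.
  by move: h => /andP[h1 h2]; rewrite !exprn_ile1 // exprn_ge0.
have e1 : (1 - eta) ^+ d <= expR (- (d%:R * eta)).
  rewrite -[- (d%:R * eta)]mulrN expRM_natl; apply: lerXn2r; rewrite ?nnegrE ?subr_ge0 ?expR_ge0 //.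
  exact: expR_ge1Dx.
have e2 : expR (- (d%:R * eta)) <= 3^-1.
  rewrite expRN lef_pV2 ?posrE ?expR_gt0 // (le_trans _ (expR_ge1Dx _)) //.
  lra.
have e3 := le_trans e1 e2.
rewrite ger0_norm; lra.
Qed.

Lemma not_strongly_polynomially_tractable r (M : R) : (0 < r)%N -> 0 < M ->
  ~ strongly_polynomially_tractable r M.
Proof.
move=> r0 M0 [c [p [c0 p0 spt]]].
pose B := c * (1 / 4) `^ (- p).
have [d d0 h] := complexity_unbounded (nat_above B) r0 M0.
have e : 0 < (1 / 4 : R) < 1 by rewrite divr_gt0 //= ltr_pdivrMr // mul1r ltr1n.
have := le_trans h (spt _ _ e d0); rewrite lee_fin -/B leNgt; apply/negP/negPn.
by apply: (le_lt_trans (nat_above_ge B)); rewrite ltr_nat.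
Qed.

Lemma polynomial r (M : R) : (0 < r)%N -> 0 < M -> M <= r`!%:R ->
  polynomially_tractable r M.
Proof.
move=> r0 M0 Mr; have [C C0 H] := complexity_small_bound r0 M0 Mr.
exists C, 4, 3; split => // eps d e01 d0.
have := H eps d e01 d0; have /andP[e0 _] := e01.
have -> : eps `^ (- 3) = eps^-1 ^+ 3 by rewrite powRN (powR_mulrn 3 (ltW e0)) exprVn.
by rewrite (powR_mulrn 4 (ler0n _ d)).
Qed.

Lemma complexity_decreasing r (M : R) d (eps1 eps2 : R) : eps1 <= eps2 ->
  (complexity r M eps2 d <= complexity r M eps1 d)%E.
Proof.
move=> e12; apply: ereal_inf_le_tmp => _ [n [n0 nE] <-]; exists n => //; split => //.
by apply: (le_trans nE); rewrite lee_fin.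
Qed.

(** For fixed eps the quasi-polynomial bound is a constant times d^T, while alpha^d exceeds a
    multiple of d^(m + 1) with m >= T by the exponential series. *)
Lemma quasi_polynomial_not_curse r (M : R) : quasi_polynomially_tractable r M ->
  ~ curse_of_dimensionality r M.
Proof.
move=> [c [t [c0 t0 qpt]]] [eps0 [c' [alpha [e0 c'0 alpha1 curse]]]].
(* The tractability bound needs eps < 1; decreasing eps only increases the complexity. *)
pose eps := Num.min eps0 (1 / 2).
have e1 : eps <= eps0 by rewrite ge_min lexx.
have e2 : eps <= 1 / 2 by rewrite ge_min lexx orbT.
have e3 : 0 < eps by rewrite lt_min e0 divr_gt0.
have e4 : 0 < eps < 1 by rewrite e3; lra.
pose T := t * (1 + ln eps^-1).
have lne : 0 <= ln eps^-1 by rewrite ln_ge0 // invf_ge1 //; lra.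
have T0 : 0 <= T by rewrite mulr_ge0 ?addr_ge0 // ltW.
pose m := nat_above T.
have lna : 0 < ln alpha by rewrite ln_gt0.
pose B := c * expR T * m.+1`!%:R / (c' * ln alpha ^+ m.+1).
have den0 : 0 < c' * ln alpha ^+ m.+1 by rewrite mulr_gt0 // exprn_gt0.
have alpha0 : 0 < alpha by apply: lt_trans alpha1.
have bound d : (0 < d)%N -> d%:R <= B.
  move=> d0; have D0 : (0 : R) < d%:R by rewrite ltr0n.
  have D1 : (1 : R) <= d%:R by rewrite ler1n.
  have := le_trans (curse d d0) (le_trans (complexity_decreasing r M d e1) (qpt eps d e4 d0)).
  rewrite lee_fin -/T => h.
  have h1 : expR (T * (1 + ln d%:R)) <= expR T * d%:R ^+ m.
    rewrite mulrDr mulr1 expRD ler_wpM2l ?expR_ge0 //.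
    rewrite -[d%:R in leRHS]lnK ?posrE // -expRM_natl ler_expR ler_wpM2r ?ln_ge0 //.
    exact: nat_above_ge.
  have h2 : (d%:R * ln alpha) ^+ m.+1 / m.+1`!%:R <= alpha ^+ d.
    rewrite -[alpha in leRHS]lnK ?posrE // -expRM_natl.
    apply: le_trans (expR_ge1Dxn m _); first by rewrite lerDr.
    by rewrite mulr_ge0 // ltW.
  have h3 : c' * ((d%:R * ln alpha) ^+ m.+1 / m.+1`!%:R) <= c * (expR T * d%:R ^+ m).
    apply: le_trans (ler_wpM2l (ltW c'0) h2) _; apply: (le_trans h).
    by rewrite ler_wpM2l // ltW.
  have f0 : (0 : R) < m.+1`!%:R by rewrite ltr0n fact_gt0.
  rewrite /B ler_pdivlMr //.
  move: h3; rewrite mulrA ler_pdivrMr // exprMn.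
  rewrite [d%:R ^+ m.+1]exprS => h3.
  rewrite -(ler_pM2r (exprn_gt0 m D0)).
  have -> : d%:R * (c' * ln alpha ^+ m.+1) * d%:R ^+ m = c' * (d%:R * d%:R ^+ m * ln alpha ^+ m.+1).
    by move: (ln alpha ^+ m.+1) (d%:R ^+ m) => x y; ring.
  apply: (le_trans h3); apply: le_of_eq.
  by rewrite [c * (_ * _)]mulrA mulrAC.
have := bound (nat_above B).+1 isT; apply/negP; rewrite -ltNge.
by apply: (le_lt_trans (nat_above_ge B)); rewrite ltr_nat.
Qed.

End NonTractability.

Theorem theorem2 (R : realType) (r : nat) (M : R) (r_gt0 : (0 < r)%N)
    (M_gt0 : 0 < M) :
  [/\ curse_of_dimensionality r M <-> (2 ^ r * r`!)%:R <= M,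
      (r`!)%:R < M < (2 ^ r * r`!)%:R ->
        quasi_polynomially_tractable r M /\ ~ polynomially_tractable r M
    & M <= (r`!)%:R ->
        polynomially_tractable r M /\ ~ strongly_polynomially_tractable r M].
Proof.
split.
- split; last exact: curse_large.
  move=> curse; rewrite leNgt; apply/negP => M2.
  exact: (quasi_polynomial_not_curse (quasi_polynomial r_gt0 M_gt0 M2)).
- move=> /andP[M1 M2]; split; first exact: quasi_polynomial.
  exact: not_polynomially_tractable.
- by move=> M1; split; [exact: polynomial|exact: not_strongly_polynomially_tractable].
Qed.
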